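(* Let $\{X_u:u\in\Lambda^*\setminus\{\emptyset\}\}$ be i.i.d. copies of a nonnegative random variable $X$ with $\mathbb E(X)=1$, let $h_X=\mathbb E(X\log X)\in[0,\infty]$, and let $Q$ be the associated Mandelbrot multiplicative cascade. Suppose that $\mathbb P(X\ne1)>0$. Let $\rho$ be a probability measure on the set $\mathcal E(\sigma)$ of $\sigma$-ergodic Borel probability measures on $\Sigma$, and put $$\overline{\mathcal E}(h_X)=\{\nu\in\mathcal E(\sigma):h_\nu(\sigma)>h_X\},\qquad\underline{\mathcal E}(h_X)=\{\nu\in\mathcal E(\sigma):h_\nu(\sigma)<h_X\}.$$ Then the measure $\int_{\overline{\mathcal E}(h_X)}\nu\,\rho(\mathrm d\nu)$ is $Q$-regular, while the measure $\int_{\underline{\mathcal E}(h_X)}\nu\,\rho(\mathrm d\nu)$ is $Q$-singular. Moreover, $\mathbb P$-almost surely, $$Q\cdot\int_{\overline{\mathcal E}(h_X)}\nu\,\rho(\mathrm d\nu)=\int_{\overline{\mathcal E}(h_X)}Q\cdot\nu\,\rho(\mathrm d\nu).$$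
   Context: Let $b\ge2$ be an integer, $\Lambda=\{0,\dots,b-1\}$, $\Lambda^*=\bigcup_{n\ge0}\Lambda^n$ the finite words, and $\Sigma=\Lambda^{\mathbb N}$ the space of sequences $x=x_1x_2\cdots$ with the product topology and Borel $\sigma$-field; $\sigma$ is the left shift on $\Sigma$. Write $x|_n=x_1\cdots x_n$, and let $[u]$ be the cylinder of sequences with prefix $u$. Convention: $0\log0=0$. For $n\ge1$ put $Q_n(\omega,x)=\prod_{k=1}^nX_{x|_k}(\omega)$. For a finite Borel measure $\mu$ on $\Sigma$, the measures $Q_n(\omega,\cdot)\,\mu$ almost surely converge weakly to a random measure $Q\cdot\mu$. The measure $\mu$ is $Q$-regular if $\mathbb E\|Q\cdot\mu\|=\|\mu\|$ (where $\|\cdot\|$ is total mass), and $Q$-singular if $Q\cdot\mu=0$ almost surely; the null measure is trivially both. ''$\sigma$-ergodic'' means $\sigma$-invariant and ergodic. $\mathcal E(\sigma)$ carries the weak-$*$ topology and its Borel $\sigma$-field. The entropy is $h_\nu(\sigma)=\lim_{n\to\infty}\frac1n\sum_{u\in\Lambda^n}-\nu([u])\log\nu([u])$. The integral of measures $\int_{\mathcal S}\nu\,\rho(\mathrm d\nu)$ is the measure $\mu$ with $\int f\,d\mu=\int_{\mathcal S}\big(\int f\,d\nu\big)\rho(\mathrm d\nu)$ for continuous $f$. In the last display, $\mathbb P$-almost surely the limit $Q\cdot\nu$ exists for $\rho$-almost every $\nu$, and the right-hand side is understood accordingly. *)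

(* Defs.v *)
From HB Require Import structures.
From mathcomp Require Export all_boot all_order all_algebra.
From mathcomp Require Export all_classical all_reals all_analysis.
Set Implicit Arguments.
Unset Strict Implicit.
Unset Printing Implicit Defensive.
Import Order.TTheory GRing.Theory Num.Theory.
Import numFieldNormedType.Exports.

Local Open Scope classical_set_scope.
Local Open Scope ring_scope.

(* This is 'I_b as soon as 0 < b; the form n.+1 makes it inhabited. *)
Definition letter (b : nat) : Type := 'I_b.-1.+1.

HB.instance Definition _ (b : nat) := Finite.on (letter b).
HB.instance Definition _ (b : nat) := isPointed.Build (letter b) ord0.

(* Sequences are indexed from 0: x n is the letter usually written x_{n+1}. *)
Definition seq_space (b : nat) : Type :=
  prod_topology (fun _ : nat => discrete_topology (letter b)).

HB.instance Definition _ (b : nat) := Pointed.on (seq_space b).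
HB.instance Definition _ (b : nat) := Topological.on (seq_space b).
HB.instance Definition _ (b : nat) :=
  Measurable.copy (seq_space b) (g_sigma_algebraType (@open (seq_space b))).

Definition shift (b : nat) (x : seq_space b) : seq_space b := fun n => x n.+1.

Definition restr (b : nat) (x : seq_space b) (n : nat) : seq (letter b) :=
  mkseq x n.

Definition cylinder (b : nat) (u : seq (letter b)) : set (seq_space b) :=
  [set x | restr x (size u) = u].

Record ergodic_measure (b : nat) (R : realType) := ErgodicMeasure {
  erg_prob :> probability (seq_space b) R ;
  erg_invariant : forall A, measurable A ->
    erg_prob (@shift b @^-1` A) = erg_prob A ;
  erg_ergodic : forall A, measurable A -> @shift b @^-1` A = A ->
    erg_prob A = 0%E \/ erg_prob A = 1%E }.

HB.instance Definition _ (b : nat) (R : realType) :=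
  gen_eqMixin (ergodic_measure b R).
HB.instance Definition _ (b : nat) (R : realType) :=
  gen_choiceMixin (ergodic_measure b R).

Section ergodic_point.
Variables (b : nat) (R : realType).
Let x0 : seq_space b := fun=> point.

Let dirac_invariant (A : set (seq_space b)) : measurable A ->
  (\d_x0 : probability (seq_space b) R) (@shift b @^-1` A) =
  (\d_x0 : probability (seq_space b) R) A.
Proof. by move=> _; rewrite /= /dirac !indicE. Qed.

Let dirac_ergodic (A : set (seq_space b)) :
  measurable A -> @shift b @^-1` A = A ->
  (\d_x0 : probability (seq_space b) R) A = 0%E \/
  (\d_x0 : probability (seq_space b) R) A = 1%E.
Proof.
by move=> _ _; rewrite /= /dirac indicE; case: (_ \in _); [right|left].
Qed.

HB.instance Definition _ := isPointed.Build (ergodic_measure b R)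
  (ErgodicMeasure dirac_invariant dirac_ergodic).

End ergodic_point.

(* The initial topology of nu |-> (\int f dnu)_f, with f ranging over the
   continuous functions, is the weak-* topology. *)
Definition test_integrals (b : nat) (R : realType) (nu : ergodic_measure b R) :
    prod_topology (fun _ : {f : seq_space b -> R | continuous f} => R) :=
  fun f => \int[nu]_x sval f x.

HB.instance Definition _ (b : nat) (R : realType) :=
  Topological.copy (ergodic_measure b R)
    (initial_topology (@test_integrals b R)).
HB.instance Definition _ (b : nat) (R : realType) :=
  Measurable.copy (ergodic_measure b R)
    (g_sigma_algebraType (@open (ergodic_measure b R))).

(* The term n = 0 is 0; ln 0 = 0 in the library, so 0 * ln 0 = 0. *)
Definition entropy (b : nat) (R : realType) (nu : ergodic_measure b R) : R :=
  limn (fun n : nat => n%:R^-1 *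
    \sum_(u : n.-tuple (letter b))
      - (fine (nu (cylinder u)) * ln (fine (nu (cylinder u))))).

Local Notation fmeasure b R := {finite_measure set (seq_space b) -> \bar R}.

(* M = \int_S N(nu) rho(dnu). *)
Definition is_measure_integral (b : nat) (R : realType)
    (rho : probability (ergodic_measure b R) R) (S : set (ergodic_measure b R))
    (N : ergodic_measure b R -> fmeasure b R) (M : fmeasure b R) : Prop :=
  forall f : seq_space b -> R, continuous f ->
    (\int[M]_x (f x)%:E = \int[rho]_(nu in S) \int[N nu]_x (f x)%:E)%E.

Definition mutually_independent (d : measure_display) (T : measurableType d)
    (R : realType) (P : probability T R) (I : eqType) (D : set I)
    (X : I -> T -> R) : Prop :=
  forall (s : seq I) (A : I -> set R), uniq s -> [set` s] `<=` D ->
    (forall i, measurable (A i)) ->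
    (P (\bigcap_(i in [set` s]) X i @^-1` A i) =
     \prod_(i <- s) P (X i @^-1` A i))%E.

Section cascade.
Context (b : nat) (R : realType) (d : measure_display) (T : measurableType d).
Implicit Types (P : probability T R) (X : seq (letter b) -> T -> R).

Definition cascade_density X (n : nat) (w : T) (x : seq_space b) : R :=
  \prod_(1 <= k < n.+1) X (restr x k) w.

(* M is the weak limit of the measures Q_n(w, .) mu. *)
Definition is_cascade_limit X (mu : fmeasure b R) (w : T) (M : fmeasure b R)
    : Prop :=
  forall f : seq_space b -> R, continuous f ->
    (\int[mu]_x (f x * cascade_density X n w x)%:E @[n --> \oo]
      --> \int[M]_x (f x)%:E)%E.

(* Qmu is a version of the random measure Q.mu. *)
Definition is_cascade P X (mu : fmeasure b R) (Qmu : T -> fmeasure b R)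
    : Prop :=
  {ae P, forall w, is_cascade_limit X mu w (Qmu w)}.

Definition Q_regular P X (mu : fmeasure b R) : Prop :=
  exists2 Qmu : T -> fmeasure b R, is_cascade P X mu Qmu &
    (\int[P]_w Qmu w [set: seq_space b] = mu [set: seq_space b])%E.

Definition Q_singular P X (mu : fmeasure b R) : Prop :=
  is_cascade P X mu (fun=> mzero).

End cascade.

(* Main.v *)
(* For a finite measure a on sequences, seen as an additive function on words, the total masses
   Y_n = sum_(|u| = n) a(u) Q_u form a nonnegative martingale, and the limits taken below every
   word are the cylinder masses of Q.a; their means ell(a) form a measure below a. When a is
   ergodic, ell(a) is shift invariant, hence ell(a) = c a, and conditioning on the first n
   generations gives E[f(Y) Y] = c E[f(Y) Y] for the limit Y, so that c is 0 or 1.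

   If c = 0, compare the entropy of a on words of length n with n h_X: the difference is at most
   the sum over m < n of the mean entropies of the first letter under the cascade measures of
   generation m, and these tend to 0 with Y_m; thus h(a) <= h_X. Hence every ergodic measure of
   entropy above h_X is regular. For a mixture, Fatou's lemma bounds Q.mu from below by the
   mixture of the Q.nu, and both sides have the same mean.

   Below h_X, fix q < h_X. Conditional codes built from integer tables are countable in number,
   so some sets G_n of at most exp(n q) words have asymptotically full measure for all ergodic
   measures of entropy less than q at once. Since E X^(1-s) < 1 - s q for a small s > 0, the
   part of Q_n carried by G_n tends to 0 in probability; then let q increase to h_X. *)
From HB Require Import structures.
Require Import Defs.
From mathcomp Require Import measurable_realfun ring lra zify.
Set Implicit Arguments.
Unset Strict Implicit.
Unset Printing Implicit Defensive.
Import Order.TTheory GRing.Theory Num.Theory.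
Import numFieldNormedType.Exports.
Local Open Scope classical_set_scope.
Local Open Scope ring_scope.

(** * Integration *)

(** Fatou's lemma bounds Q.mu from below only. With equal means this settles the regular part, but
    it says nothing when every Q.nu vanishes: singularity of a mixture cannot be read off from its
    components, and this is why the sets of words used below h_X must be common to all of them.

    The only moment available is E X = 1, and h_X may be infinite. Hence martingale convergence is
    drawn from a bounded transform, and the identity for c is tested with an f such that y f(y) is
    bounded, since Y_n need not converge in mean. Likewise x ln x is integrated with a constant
    added that makes it nonnegative, so that integrals can be split before something finite is
    subtracted.

    The link with entropy is an exact identity: the sum over |u| = n of a(u) Q_u ln(a(u) Q_u) equals
    Y_n ln Y_n - I_n, where I_n collects the entropies of the splittings of mass along the tree. For
    a of mass 1 the left side has mean n h_X minus the block entropy, and Y_n ln Y_n >= Y_n - 1 has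
    mean at least 0; so the mean of I_n bounds the entropy excess. *)

Section finite_integrals.
Context d (T : measurableType d) (R : realType).
Variable P : {finite_measure set T -> \bar R}.
Local Notation intg f := (P.-integrable [set: T] (EFin \o f)).

Lemma intg_meas (f : T -> R) : intg f -> measurable_fun setT f.
Proof. by move=> /integrableP[/measurable_EFinP]. Qed.

Lemma intg_bounded (f : T -> R) (C : R) : measurable_fun setT f ->
  (forall x, `|f x| <= C) -> intg f.
Proof.
move=> mf fC; apply: measurable_bounded_integrable => //.
  by rewrite fin_num_fun_lty//; exact: fin_num_measure.
exists C; split; first exact: num_real.
by move=> y Cy x _; rewrite /= (le_trans (fC x))// ltW.
Qed.

Lemma intg_cst (c : R) : intg (fun=> c).
Proof. exact: finite_measure_integrable_cst. Qed.

Lemma intg_le (f g : T -> R) : measurable_fun setT f ->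
  (forall x, `|f x| <= `|g x|) -> intg g -> intg f.
Proof.
move=> mf fg ig; apply: (le_integrable _ _ _ ig) => //; first exact/measurable_EFinP.
by move=> x _; rewrite /= lee_fin.
Qed.

Lemma intgD (f g : T -> R) : intg f -> intg g -> intg (fun x => f x + g x).
Proof. by move=> fi gi; have := integrableD measurableT fi gi. Qed.

Lemma intgZ (r : R) (f : T -> R) : intg f -> intg (fun x => r * f x).
Proof. by move=> fi; have := integrableZl measurableT r fi. Qed.

Lemma intgN (f : T -> R) : intg f -> intg (fun x => - f x).
Proof. by move=> fi; have := integrableN fi. Qed.

Lemma intgB (f g : T -> R) : intg f -> intg g -> intg (fun x => f x - g x).
Proof. by move=> fi gi; apply: intgD => //; exact: intgN. Qed.

Lemma intg_abs (f : T -> R) : intg f -> intg (fun x => `|f x|).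
Proof.
move=> fi; apply: (intg_le _ _ fi) => [|x]; last by rewrite normr_id.
by apply: measurableT_comp => //; exact: intg_meas.
Qed.

Lemma intg_sum I (s : seq I) (Q : pred I) (f : I -> T -> R) :
  (forall i, Q i -> intg (f i)) -> intg (fun x => \sum_(i <- s | Q i) f i x).
Proof.
move=> fi.
have := @integrable_sum _ _ _ P setT measurableT I s Q (fun i => EFin \o f i) fi.
by apply: eq_integrable => // x _; rewrite /= sumEFin.
Qed.

Lemma Rint_sum I (s : seq I) (Q : pred I) (f : I -> T -> R) :
  (forall i, Q i -> intg (f i)) ->
  \int[P]_x (\sum_(i <- s | Q i) f i x) = \sum_(i <- s | Q i) \int[P]_x f i x.
Proof.
move=> fi; elim: s => [|h s IH].
  under eq_Rintegral do rewrite big_nil.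
  by rewrite Rintegral_cst// mul0r big_nil.
under eq_Rintegral do rewrite big_cons.
rewrite big_cons; case: ifPn => Qh; last exact: IH.
by rewrite RintegralD// ?IH//; [exact: fi|exact: intg_sum].
Qed.

Lemma Rint_opp (f : T -> R) : intg f -> \int[P]_x (- f x) = - \int[P]_x f x.
Proof.
move=> fi; rewrite -[RHS]mulN1r -RintegralZl//.
by apply: eq_Rintegral => x _; rewrite mulN1r.
Qed.

Lemma Rint_EFin (f : T -> R) : intg f -> (\int[P]_x (f x)%:E = (\int[P]_x f x)%:E)%E.
Proof. by move=> fi; rewrite fineK//; exact: integrable_fin_num. Qed.

Lemma Rint_le (f g : T -> R) : intg f -> intg g -> (forall x, f x <= g x) ->
  \int[P]_x f x <= \int[P]_x g x.
Proof. by move=> fi gi fg; apply: le_Rintegral. Qed.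

Lemma Rint_DCT (f_ : nat -> T -> R) (f g : T -> R) :
  (forall n, measurable_fun setT (f_ n)) -> measurable_fun setT f -> intg g ->
  (forall n x, `|f_ n x| <= g x) ->
  {ae P, forall x, f_ n x @[n --> \oo] --> f x} ->
  \int[P]_x f_ n x @[n --> \oo] --> \int[P]_x f x.
Proof.
move=> mf_ mf gi fg cf.
have [] := @dominated_convergence _ _ _ P setT measurableT (fun n => EFin \o f_ n)
  (EFin \o f) (EFin \o g).
- by move=> n; exact/measurable_EFinP.
- exact/measurable_EFinP.
- by apply: filterS cf => x cf _; apply: cvg_EFin => //; exact: nearW.
- by [].
- by apply: aeW => x n _; rewrite /= lee_fin.
move=> ifi _ icv; apply: fine_cvg; rewrite -Rint_EFin//; exact: icv.
Qed.

End finite_integrals.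

Lemma Rint_prob_cst d (T : measurableType d) (R : realType) (P : probability T R) (c : R) :
  \int[P]_x c = c.
Proof.
transitivity (c * fine (P [set: T])); first exact: Rintegral_cst.
by rewrite probability_setT mulr1.
Qed.

Lemma measurable_limn_einf d (T : measurableType d) (R : realType) (D : set T)
    (f : nat -> T -> \bar R) :
  (forall n, measurable_fun D (f n)) -> measurable_fun D (fun x => limn_einf (f^~ x)).
Proof.
move=> mf; have -> : (fun x => limn_einf (f^~ x)) = (fun x => - limn_esup (fun n => - f n x))%E.
  by apply/funext => x; rewrite [X in (- X)%E]limn_esupN oppeK.
apply: measurableT_comp => //; apply: measurable_fun_limn_esup => n.
exact: measurableT_comp.
Qed.

Lemma limn_einf_ge0 (R : realType) (u : nat -> \bar R) :
  (forall n, 0 <= u n)%E -> (0 <= limn_einf u)%E.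
Proof.
move=> u0; rewrite limn_einf_lim; apply: lime_ge; first exact: is_cvg_einfs.
by apply: nearW => n; apply: le_ereal_inf_tmp => _ [m _ <-].
Qed.

Lemma cvg_limn_einf (R : realType) (u : nat -> \bar R) (l : \bar R) :
  u n @[n --> \oo] --> l -> limn_einf u = l.
Proof.
move=> ul; rewrite is_cvg_limn_einfE; first exact: cvg_lim ul.
by apply/cvg_ex; exists l.
Qed.

Section ge0_EFin.
Context d (T : measurableType d) (R : realType) (P : {measure set T -> \bar R}).

Lemma ge0_integral_sumr (I : Type) (s : seq I) (f : I -> T -> R) :
  (forall i, measurable_fun setT (f i)) -> (forall i x, 0 <= f i x) ->
  (\int[P]_x (\sum_(i <- s) f i x)%:E = \sum_(i <- s) \int[P]_x (f i x)%:E)%E.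
Proof.
move=> mf f0; under eq_integral do rewrite -sumEFin.
rewrite ge0_integral_sum// => [i|i x _]; first exact/measurable_EFinP.
by rewrite lee_fin.
Qed.

Lemma ge0_integralZr_EFin (c : R) (f : T -> R) : measurable_fun setT f ->
  (forall x, 0 <= f x) -> 0 <= c ->
  (\int[P]_x (c * f x)%:E = c%:E * \int[P]_x (f x)%:E)%E.
Proof.
move=> mf f0 c0; under eq_integral do rewrite EFinM.
by rewrite ge0_integralZl//; [exact/measurable_EFinP|move=> x _; rewrite lee_fin].
Qed.

Lemma ge0_integralD_EFin (f g : T -> R) : measurable_fun setT f -> measurable_fun setT g ->
  (forall x, 0 <= f x) -> (forall x, 0 <= g x) ->
  (\int[P]_x (f x + g x)%:E = \int[P]_x (f x)%:E + \int[P]_x (g x)%:E)%E.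
Proof.
move=> mf mg f0 g0; under eq_integral do rewrite EFinD.
by rewrite ge0_integralD// => [x _||x _|]; rewrite ?lee_fin//; exact/measurable_EFinP.
Qed.

End ge0_EFin.

Lemma integral_prob_cst d (T : measurableType d) (R : realType) (P : probability T R) (c : R) :
  (\int[P]_x c%:E = c%:E)%E.
Proof.
transitivity (c%:E * P [set: T])%E; first exact: integral_cst.
by rewrite probability_setT mule1.
Qed.

Lemma ae_forall_count d (T : measurableType d) (R : realType) (P : {measure set T -> \bar R})
    (I : countType) (Q : I -> T -> Prop) :
  (forall i, {ae P, forall x, Q i x}) -> {ae P, forall x, forall i, Q i x}.
Proof.
move=> PQ.
have : {ae P, forall x, forall n, if unpickle n is Some i then Q i x else True}.
  apply/ae_foralln => n; case: (unpickle n) => [i|]; first exact: PQ.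
  exact: aeW.
by apply: filterS => x H i; have := H (pickle i); rewrite pickleK.
Qed.

Lemma cvg_sumr (R : realType) (I : Type) (s : seq I) (f : I -> nat -> R) (l : I -> R) :
  (forall i, f i n @[n --> \oo] --> l i) ->
  \sum_(i <- s) f i n @[n --> \oo] --> \sum_(i <- s) l i.
Proof.
move=> fl; elim: s => [|i s IH].
  by under eq_fun do rewrite big_nil; rewrite big_nil; exact: cvg_cst.
by under eq_fun do rewrite big_cons; rewrite big_cons; exact: cvgD.
Qed.

Lemma ler_cvg_to_const (R : realType) (u : nat -> R) (l c : R) :
  u n @[n --> \oo] --> l -> (forall n, c <= u n) -> c <= l.
Proof. by move=> ul cu; apply: (cvgr_to_ge ul); exact: nearW. Qed.

Lemma cvg_to_const_le (R : realType) (u : nat -> R) (l c : R) :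
  u n @[n --> \oo] --> l -> (forall n, u n <= c) -> l <= c.
Proof. by move=> ul cu; apply: (cvgr_to_le ul); exact: nearW. Qed.

Section measurable_nat_of_bool.
Context d (T : measurableType d) (R : realType).
Implicit Types (f : T -> R) (c : R).

Lemma measurable_ltr_nat f c : measurable_fun setT f ->
  measurable_fun setT (fun x => (c < f x)%R%:R : R).
Proof.
move=> mf; have -> : (fun x => (c < f x)%R%:R : R) = (\1_`]c, +oo[%classic : R -> R) \o f.
  apply/funext => x; rewrite /= indicE; congr (nat_of_bool _)%:R.
  by apply/idP/idP; rewrite inE /= in_itv /= andbT.
exact: measurableT_comp.
Qed.

Lemma measurable_ler_nat f c : measurable_fun setT f ->
  measurable_fun setT (fun x => (c <= f x)%R%:R : R).
Proof.
move=> mf; have -> : (fun x => (c <= f x)%R%:R : R) = (\1_`[c, +oo[%classic : R -> R) \o f.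
  apply/funext => x; rewrite /= indicE; congr (nat_of_bool _)%:R.
  by apply/idP/idP; rewrite inE /= in_itv /= andbT.
exact: measurableT_comp.
Qed.

End measurable_nat_of_bool.

(** Serves to turn an inequality between cylinder masses into one on all Borel sets: if the
    difference of two masses is again a mass, the larger measure is the sum of the smaller one and a
    third. *)
Lemma measure_sum_finite d (T : measurableType d) (R : realType)
    (m1 m2 : {finite_measure set T -> \bar R}) :
  exists m : {finite_measure set T -> \bar R}, forall A, m A = (m1 A + m2 A)%E.
Proof.
pose ms n : {measure set T -> \bar R} := if n is 0%N then m1 else m2.
have msE A : msum ms 2 A = (m1 A + m2 A)%E.
  by rewrite /msum 2!big_ord_recl/= big_ord0 adde0.
have fin : fin_num_fun (msum ms 2).
  by move=> A mA; rewrite msE fin_numD; apply/andP; split; exact: fin_num_measure.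
pose m : {finite_measure set T -> \bar R} :=
  HB.pack (msum ms 2) (Measure_isFinite.Build _ _ _ (msum ms 2) fin).
by exists m => A; exact: msE.
Qed.

(** * Words, masses and cylinders *)

Section words.
Context {b : nat}.
Implicit Types (x y : seq_space b) (u v : seq (letter b)).

Lemma size_restr x n : size (restr x n) = n.
Proof. exact: size_mkseq. Qed.

Lemma restrS x n : restr x n.+1 = rcons (restr x n) (x n).
Proof. exact: mkseqS. Qed.

Lemma restr_cons x n : restr x n.+1 = x 0%N :: restr (shift x) n.
Proof. by rewrite /restr /mkseq /= -[1%N]/(1 + 0)%N iotaDl -map_comp. Qed.

Lemma take_restr x k n : (k <= n)%N -> take k (restr x n) = restr x k.
Proof. by move=> kn; rewrite /restr /mkseq -map_take take_iota (minn_idPl kn). Qed.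

Lemma restr_leq x y k n : (k <= n)%N -> restr x n = restr y n ->
  restr x k = restr y k.
Proof. by move=> kn xy; rewrite -(take_restr x kn) xy take_restr. Qed.

Lemma restrP x y n : (restr x n = restr y n) <-> (forall i, (i < n)%N -> x i = y i).
Proof.
split=> [xy i iltn|xy]; last first.
  by apply/eq_in_map => i; rewrite mem_iota add0n => /andP[_ /xy].
by have := congr1 (fun s => nth ord0 s i) xy; rewrite !nth_mkseq.
Qed.

Lemma cylinder_nil : @cylinder b [::] = setT.
Proof. by apply/seteqP; split. Qed.

Definition restr_tuple n x : n.-tuple (letter b) := [tuple of restr x n].

Lemma cylinder_restr x n : cylinder (restr x n) x.
Proof. by rewrite /cylinder /= size_restr. Qed.

Lemma cylinder_cat u v : cylinder (u ++ v) `<=` cylinder u.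
Proof.
move=> x; rewrite /cylinder /= size_cat => xuv.
by rewrite -(@take_restr x (size u) (size u + size v)) ?leq_addr// xuv take_size_cat.
Qed.

Lemma cylinder_rcons u i x :
  cylinder (rcons u i) x <-> cylinder u x /\ x (size u) = i.
Proof.
rewrite /cylinder /= size_rcons restrS; split => [/rcons_inj[-> ->]//|[-> ->]//].
Qed.

Lemma cylinder_inj u v x : size u = size v -> cylinder u x -> cylinder v x -> u = v.
Proof. by rewrite /cylinder /= => -> -> ->. Qed.

(** A sample point of the cylinder of [u], at which continuous functions are evaluated in Riemann
    sums. *)
Definition pad u : seq_space b := fun n => nth ord0 u n.

Lemma restr_pad u : restr (pad u) (size u) = u.
Proof. exact: mkseq_nth. Qed.

End words.

Section tuple_sums.
Context {b : nat} {V : nmodType}.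
Implicit Types (F : seq (letter b) -> V).

Lemma sum_tuple0 F : \sum_(u : 0.-tuple (letter b)) F u = F [::].
Proof.
rewrite (bigD1 [tuple])//= big1 ?addr0// => u /eqP[].
exact: tuple0.
Qed.

Lemma sum_tuple_cons n F : \sum_(u : n.+1.-tuple (letter b)) F u =
  \sum_(i : letter b) \sum_(u : n.-tuple (letter b)) F (i :: u).
Proof.
rewrite pair_big /= (reindex (fun p : letter b * n.-tuple (letter b) =>
  [tuple of p.1 :: p.2])) //=.
exists (fun u : n.+1.-tuple (letter b) => (thead u, [tuple of behead u])).
  by move=> [i u] _ /=; congr pair; apply/val_inj.
by move=> u _; rewrite [RHS]tuple_eta; apply/val_inj.
Qed.

Lemma sum_tuple_cat m n F : \sum_(u : (m + n).-tuple (letter b)) F u =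
  \sum_(u : m.-tuple (letter b)) \sum_(v : n.-tuple (letter b)) F (u ++ v).
Proof.
elim: m F => [|m IH] F; first by rewrite (sum_tuple0 (fun u => \sum_(v : n.-tuple (letter b)) F (u ++ v))).
rewrite sum_tuple_cons (sum_tuple_cons _ (fun u => \sum_(v : n.-tuple (letter b)) F (u ++ v))).
by apply: eq_bigr => i _; rewrite (IH (fun u => F (i :: u))).
Qed.

Lemma sum_tuple1 F : \sum_(u : 1.-tuple (letter b)) F u = \sum_i F [:: i].
Proof.
rewrite sum_tuple_cons; apply: eq_bigr => i _.
exact: (sum_tuple0 (fun u => F (i :: u))).
Qed.

Lemma sum_tuple_rcons n F : \sum_(u : n.+1.-tuple (letter b)) F u =
  \sum_(u : n.-tuple (letter b)) \sum_(i : letter b) F (rcons u i).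
Proof.
rewrite -addn1 sum_tuple_cat; apply: eq_bigr => u _.
rewrite (sum_tuple1 (fun v => F (u ++ v))).
by apply: eq_bigr => i _; rewrite cats1.
Qed.

End tuple_sums.

Section mass.
Context {b : nat} {R : realType}.
Implicit Types (a : seq (letter b) -> R) (u v : seq (letter b)).

(** These are exactly the cylinder masses of finite measures, by [is_mass_of] and [mass_extension];
    so the cascade can be studied on functions of words. *)
Definition is_mass a :=
  (forall u, 0 <= a u) /\ forall u, a u = \sum_(i : letter b) a (rcons u i).

Definition subtree a u : seq (letter b) -> R := fun v => a (u ++ v).

Lemma is_mass_subtree a u : is_mass a -> is_mass (subtree a u).
Proof.
move=> [a0 aS]; split=> [v|v]; first exact: a0.
by rewrite /subtree aS; apply: eq_bigr => i _; rewrite rcons_cat.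
Qed.

Lemma subtree_cat a u v : subtree a (u ++ v) = subtree (subtree a u) v.
Proof. by apply/funext => w; rewrite /subtree catA. Qed.

Lemma mass_sum a u n : is_mass a -> a u = \sum_(v : n.-tuple (letter b)) a (u ++ v).
Proof.
move=> am; elim: n => [|n IH]; first by rewrite (sum_tuple0 (fun v => a (u ++ v))) cats0.
rewrite IH (sum_tuple_rcons _ (fun v => a (u ++ v))); apply: eq_bigr => v _.
by rewrite am.2; apply: eq_bigr => i _; rewrite rcons_cat.
Qed.

Lemma mass_sum0 a n : is_mass a -> a [::] = \sum_(v : n.-tuple (letter b)) a v.
Proof. by move=> am; rewrite (mass_sum [::] n am). Qed.

Lemma mass_leq a u v : is_mass a -> a (u ++ v) <= a u.
Proof.
move=> am; rewrite (mass_sum u (size v) am) (bigD1 (in_tuple v))//=.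
by rewrite lerDl sumr_ge0// => i _; exact: am.1.
Qed.

Lemma mass_le0 a u : is_mass a -> a u <= a [::].
Proof. by move=> am; rewrite -[u]cat0s mass_leq. Qed.

Lemma is_mass_sumr (I : finType) (a : I -> seq (letter b) -> R) :
  (forall i, is_mass (a i)) -> is_mass (fun u => \sum_i a i u).
Proof.
move=> am; split=> [u|u]; first by rewrite sumr_ge0// => i _; exact: (am i).1.
rewrite exchange_big /=; apply: eq_bigr => i _; exact: (am i).2.
Qed.

End mass.

(** * Cylinders generate the topology and the Borel sets *)

Section topology.
Context {b : nat}.
Implicit Types (x y : seq_space b) (u v : seq (letter b)).

Lemma cvg_seq_space (y : nat -> seq_space b) x :
  (forall i, \forall n \near \oo, y n i = x i) -> y n @[n --> \oo] --> x.
Proof.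
move=> yx; apply/cvg_sup => i A [B [[C oC <-] /= Cx BA]].
change (\forall n \near \oo, A (y n)); apply: filterS (yx i) => n yn.
by apply: BA; rewrite /= yn.
Qed.

Lemma open_coord i (j : letter b) : open [set x : seq_space b | x i = j].
Proof.
have ci : continuous ((fun x => x i) : seq_space b -> discrete_topology (letter b)).
  exact: (@proj_continuous nat (fun=> discrete_topology (letter b)) i).
by move/continuousP : ci => /(_ [set j]); apply; exact: discrete_open.
Qed.

Lemma open_cylinder u : open (cylinder u).
Proof.
elim/last_ind: u => [|u i IH]; first by rewrite cylinder_nil; exact: openT.
have -> : cylinder (rcons u i) = cylinder u `&` [set x | x (size u) = i].
  by apply/seteqP; split => x /cylinder_rcons.
by apply: openI => //; exact: open_coord.
Qed.

(** Otherwise each cylinder around [x] contains a point outside [A]; these points converge to [x]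
    coordinatewise, against openness. *)
Lemma open_cylinder_nbhs (A : set (seq_space b)) x : open A -> A x ->
  exists k, cylinder (restr x k) `<=` A.
Proof.
move=> oA Ax; apply: contrapT => /forallNP H.
have /choice[y yP] : forall k, exists y, restr y k = restr x k /\ ~ A y.
  move=> k; have /existsNP[y /not_implyP[yk nAy]] := H k.
  by exists y; split=> //; rewrite /cylinder /= size_restr in yk.
have /(_ A) : y n @[n --> \oo] --> x.
  apply: cvg_seq_space => i; near=> n.
  by have /restrP := (yP n).1; apply; near: n; exact: nbhs_infty_gt.
move=> /(_ (open_nbhs_nbhs (conj oA Ax))) [N _ /(_ N (leqnn N))].
exact: (yP N).2.
Unshelve. all: by end_near.
Qed.

Lemma measurable_cylinder u : measurable (cylinder u).
Proof. by apply: sub_sigma_algebra; exact: open_cylinder. Qed.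

Lemma open_bigcup_cylinder (A : set (seq_space b)) : open A ->
  A = \bigcup_(u in [set u | cylinder u `<=` A]) cylinder u.
Proof.
move=> oA; apply/seteqP; split => [x Ax|x [u uA /uA//]].
by have [k kA] := open_cylinder_nbhs oA Ax; exists (restr x k) => //; exact: cylinder_restr.
Qed.

(** The empty set is included because cylinders of incomparable words are disjoint; this makes the
    family a pi-system. *)
Definition cylinders : set (set (seq_space b)) := range (@cylinder b) `|` [set set0].

Lemma cylinders_setI : setI_closed cylinders.
Proof.
move=> A B [[u _ <-]|->]; last by rewrite set0I; right.
move=> [[v _ <-]|->]; last by rewrite setI0; right.
wlog uv : u v / (size u <= size v)%N.
  by move=> H; case/orP: (leq_total (size u) (size v)) => /H//; rewrite setIC.
have [uE|uE] := eqVneq (take (size u) v) u; [left; exists v => //|right].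
  apply/seteqP; split => [x xv|x []//]; split => //; move: xv.
  by rewrite -{1}(cat_take_drop (size u) v) uE => /cylinder_cat.
apply/seteqP; split => // x [xu xv]; move/eqP: uE; apply.
by move: xu xv; rewrite /cylinder /= => <- <-; rewrite !size_restr take_restr.
Qed.

(** There are countably many words, so every open set is a countable union of cylinders. *)
Lemma measurable_cylinders : @measurable _ (seq_space b) = <<s cylinders >>.
Proof.
apply/seteqP; split.
  apply: smallest_sub; first exact: smallest_sigma_algebra.
  move=> A oA; rewrite (open_bigcup_cylinder oA) bigcup_mkcond.
  apply: (@countable_bigcupT_measurable _ (g_sigma_algebraType cylinders)) => //.
  move=> u; case: ifP => _; last exact: measurable0.
  by apply: sub_sigma_algebra; left; exists u.
apply: smallest_sub; first exact: sigma_algebra_measurable.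
by move=> A [[u _ <-]|->]; [exact: measurable_cylinder|exact: measurable0].
Qed.

Lemma eq_measure_cylinder {R : realType} (m1 m2 : {finite_measure set (seq_space b) -> \bar R}) :
  (forall u, m1 (cylinder u) = m2 (cylinder u)) ->
  forall A, measurable A -> m1 A = m2 A.
Proof.
move=> m12 A mA.
apply: (measure_unique cylinders (fun=> setT) measurable_cylinders) => //.
- exact: cylinders_setI.
- by move=> _; left; exists [::] => //; rewrite cylinder_nil.
- by rewrite bigcup_const//; exists 0%N.
- by move=> B [[u _ <-]|->]; [exact: m12|rewrite (measure0 m1) (measure0 m2)].
- by move=> _; rewrite fin_num_fun_lty //; exact: fin_num_measure.
Qed.

End topology.

Section mass_of.
Context {b : nat} {R : realType}.
Local Notation fmeasure := {finite_measure set (seq_space b) -> \bar R}.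
Implicit Types (M : fmeasure) (u : seq (letter b)) (x : seq_space b).

Definition mass_of M : seq (letter b) -> R := fun u => fine (M (cylinder u)).

Lemma mass_ofE M u : M (cylinder u) = (mass_of M u)%:E.
Proof.
by rewrite /mass_of fineK//; apply: fin_num_measure; exact: measurable_cylinder.
Qed.

Lemma is_mass_of M : is_mass (mass_of M).
Proof.
split=> [u|u]; first exact: fine_ge0.
apply: EFin_inj; rewrite -mass_ofE -sumEFin.
have -> : cylinder u = \big[setU/set0]_(i < b.-1.+1) cylinder (rcons u i).
  rewrite -bigcup_seq; apply/seteqP; split => [x xu|x [i _] /cylinder_rcons[]//].
  by exists (x (size u)); [rewrite /= mem_index_enum|exact/cylinder_rcons].
rewrite measure_bigsetU_ord//.
- by apply: eq_bigr => i _; exact: mass_ofE.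
- by move=> i; exact: measurable_cylinder.
- apply/trivIsetP => i j _ _ ij; apply/seteqP; split => // x [].
  by move=> /cylinder_rcons[_ xi] /cylinder_rcons[_ xj]; move/eqP: ij; apply; rewrite -xi.
Qed.

Lemma measurable_restr k (g : seq (letter b) -> R) :
  measurable_fun setT (fun x : seq_space b => g (restr x k)).
Proof.
have -> : (fun x : seq_space b => g (restr x k)) =
    (fun x => \sum_(u : k.-tuple (letter b)) g u * \1_(cylinder u) x).
  apply/funext => x; rewrite (bigD1 (restr_tuple k x))//= indicE mem_set ?mulr1; last first.
    exact: cylinder_restr.
  rewrite big1 ?addr0// => u ux; rewrite indicE memNset ?mulr0// => xu.
  move/eqP : ux; apply; apply/val_inj => /=.
  by apply: (cylinder_inj (x := x) _ xu); rewrite ?size_tuple ?size_restr//; exact: cylinder_restr.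
apply: measurable_sum => u; apply: measurable_funM => //.
by apply: measurable_indic; exact: measurable_cylinder.
Qed.

Lemma tuple_bounded k (g : seq (letter b) -> R) :
  exists C, 0 <= C /\ forall u, size u = k -> `|g u| <= C.
Proof.
exists (\sum_(u : k.-tuple (letter b)) `|g u|); split; first exact: sumr_ge0.
move=> u uk; have uk' : size u == k by exact/eqP.
by rewrite (bigD1 (Tuple uk'))//= lerDl sumr_ge0.
Qed.

Lemma intg_restr M k (g : seq (letter b) -> R) :
  M.-integrable setT (EFin \o (fun x : seq_space b => g (restr x k))).
Proof.
have [C [_ gC]] := tuple_bounded k g.
by apply: (@intg_bounded _ _ _ _ _ C); [exact: measurable_restr|move=> x; apply: gC; rewrite size_restr].
Qed.

Lemma Rint_restr M k (g : seq (letter b) -> R) :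
  \int[M]_x g (restr x k) = \sum_(u : k.-tuple (letter b)) g u * mass_of M u.
Proof.
transitivity (\int[M]_x \sum_(u : k.-tuple (letter b)) g u * \1_(cylinder u) x).
  apply: eq_Rintegral => x _.
  rewrite (bigD1 (restr_tuple k x))//= indicE mem_set ?mulr1; last exact: cylinder_restr.
  rewrite big1 ?addr0// => u ux; rewrite indicE memNset ?mulr0// => xu.
  move/eqP : ux; apply; apply/val_inj => /=.
  by apply: (cylinder_inj (x := x) _ xu); rewrite ?size_tuple ?size_restr//; exact: cylinder_restr.
have ind u : M.-integrable setT (EFin \o \1_(@cylinder b u)).
  apply: (@intg_bounded _ _ _ _ _ 1).
    by apply: measurable_indic; exact: measurable_cylinder.
  by move=> x; rewrite indicE; case: (_ \in _); rewrite ?normr0 ?normr1.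
rewrite Rint_sum; last by move=> u _; exact: intgZ.
apply: eq_bigr => u _; rewrite RintegralZl//; congr (_ * _).
rewrite /Rintegral integral_indic//; last exact: measurable_cylinder.
by rewrite setIT.
Qed.

Lemma Rint_cst1 M (c : R) : \int[M]_x c = c * mass_of M [::].
Proof. by rewrite Rintegral_cst// /mass_of cylinder_nil. Qed.

Section continuous.
Variable f : seq_space b -> R.
Hypothesis cf : continuous f.

Lemma measurable_continuous : measurable_fun setT f.
Proof.
apply: (measurability _ (RGenOpens.measurableE R)) => _ [_ [a [c ->] <-]].
rewrite setTI; apply: sub_sigma_algebra.
by apply: open_comp => //; move=> x _; exact: cf.
Qed.

Let good (e : R) u := exists k, forall x y, cylinder u x -> cylinder u y ->
  restr x k = restr y k -> `|f x - f y| <= e.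

Let good_rcons e u : (forall i, good e (rcons u i)) -> good e u.
Proof.
(* The depth exceeds the length of [u], so that [x] and [y] continue [u] by the same letter and lie
   in a common child. *)
move=> /choice[K KP]; exists (maxn (size u).+1 (\max_i K i)) => x y xu yu xy.
have xyu : x (size u) = y (size u) by move/restrP : xy; apply; rewrite leq_max leqnn.
apply: (KP (x (size u))); [exact/cylinder_rcons|exact/cylinder_rcons|].
by apply: restr_leq xy; rewrite leq_max leq_bigmax orbT.
Qed.

(** König's lemma in place of compactness: a bad word has a bad child, so a bad root yields an
    infinite branch of bad words, and [f] would be discontinuous at its end. *)
Let good_nil e : 0 < e -> good e [::].
Proof.
move=> e0; apply: contrapT => badn.
have step u : exists i, ~ good e u -> ~ good e (rcons u i).
  have [g|g] := pselect (good e u); first by exists ord0.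
  have /existsNP[i bi] : ~ forall i, good e (rcons u i) by move=> /good_rcons.
  by exists i.
have [nx nxP] := choice step.
pose w := fix w n := if n is n'.+1 then rcons (w n') (nx (w n')) else [::].
pose x : seq_space b := fun n => nx (w n).
have xw n : restr x n = w n by elim: n => //= n IH; rewrite restrS IH.
have bad n : ~ good e (w n) by elim: n => //= n IH; exact: nxP.
have oB : open (f @^-1` ball (f x) (e / 2)).
  by apply: open_comp; [move=> y _; exact: cf|exact: ball_open].
have e20 : 0 < e / 2 by rewrite divr_gt0.
have [k kB] := open_cylinder_nbhs oB (ballxx (f x) e20).
(* On this cylinder [f] already varies by at most [e], so depth 0 is enough. *)
apply: (bad k); exists 0%N => y z; rewrite -xw => /kB /= yB /kB /= zB _.
rewrite /ball /= in yB zB.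
have -> : f y - f z = - (f x - f y) + (f x - f z) by ring.
rewrite (le_trans (ler_normD _ _))// normrN [leRHS](splitr e).
by apply: lerD; exact: ltW.
Qed.

Lemma continuous_approx e : 0 < e -> exists k0, forall k x y, (k0 <= k)%N ->
  restr x k = restr y k -> `|f x - f y| <= e.
Proof.
move=> e0; have [k kP] := good_nil e0; exists k => n x y kn xy.
by apply: kP => //; exact: restr_leq xy.
Qed.

Lemma continuous_approx_pad e : 0 < e -> exists k0, forall k x, (k0 <= k)%N ->
  `|f x - f (pad (restr x k))| <= e.
Proof.
move=> e0; have [k0 H] := continuous_approx e0; exists k0 => k x kk.
by apply: (H k) => //; have := restr_pad (restr x k); rewrite size_restr => ->.
Qed.

Lemma continuous_bounded : exists C, 0 <= C /\ forall x, `|f x| <= C.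
Proof.
have [k H] := continuous_approx_pad ltr01.
have [C [C0 HC]] := tuple_bounded k (f \o pad).
exists (1 + C); split; first by rewrite addr_ge0.
move=> x; rewrite -[f x](subrK (f (pad (restr x k)))).
rewrite (le_trans (ler_normD _ _))// lerD ?H//.
by apply: HC; rewrite size_restr.
Qed.

Lemma intg_continuous M : M.-integrable setT (EFin \o f).
Proof.
have [C [_ fC]] := continuous_bounded.
exact: (@intg_bounded _ _ _ M f C measurable_continuous fC).
Qed.

(** Riemann sums: integrals of continuous functions are recovered from cylinder masses. *)
Lemma cvg_Rint_continuous M :
  \sum_(u : k.-tuple (letter b)) f (pad u) * mass_of M u @[k --> \oo]
    --> \int[M]_x f x.
Proof.
have -> : (fun k => \sum_(u : k.-tuple (letter b)) f (pad u) * mass_of M u) =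
    (fun k => \int[M]_x f (pad (restr x k))).
  by apply/funext => k; rewrite -(Rint_restr M k (f \o pad)).
have [C [C0 fC]] := continuous_bounded.
apply: (@Rint_DCT _ _ _ _ _ _ (fun=> C)) => //.
- by move=> n; exact: (measurable_restr n (f \o pad)).
- exact: measurable_continuous.
- exact: intg_cst.
- apply: aeW => x; apply/cvgrPdist_le => e e0.
  have [k0 H] := continuous_approx_pad e0.
  by exists k0 => // k /= kk; exact: H.
Qed.

End continuous.

Lemma continuous_restr k (g : seq (letter b) -> R) :
  continuous (fun x : seq_space b => g (restr x k)).
Proof.
move=> x A Ag.
have H : nbhs x (cylinder (restr x k)).
  apply: open_nbhs_nbhs; split; [exact: open_cylinder|exact: cylinder_restr].
apply: filterS H => y; rewrite /cylinder /= size_restr => ->.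
exact: nbhs_singleton.
Qed.

End mass_of.

Section image_measure.
Context d1 d2 (T1 : measurableType d1) (T2 : measurableType d2) (R : realType).
Variables (m : {finite_measure set T1 -> \bar R}) (f : T1 -> T2).
Hypothesis mf : measurable_fun [set: T1] f.

(** The measurability proof is an argument, so that the structure of finite measure can be inferred
    from the term alone. *)
Definition image_measure of measurable_fun [set: T1] f := pushforward m f.

Let image0 : image_measure mf set0 = 0%E.
Proof. by rewrite /image_measure /pushforward preimage_set0 measure0. Qed.

Let image_ge0 A : (0 <= image_measure mf A)%E.
Proof. exact: measure_ge0. Qed.

Let image_sigma_additive : semi_sigma_additive (image_measure mf).
Proof.
move=> F mF tF mUF; rewrite /image_measure /pushforward preimage_bigcup.
apply: measure_semi_sigma_additive.
- by move=> n; rewrite -[X in measurable X]setTI; exact: mf.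
- apply/trivIsetP => /= i j _ _ ij; rewrite -preimage_setI.
  by move/trivIsetP : tF => /(_ _ _ _ _ ij) ->//; rewrite preimage_set0.
- by rewrite -preimage_bigcup -[X in measurable X]setTI; exact: mf.
Qed.

HB.instance Definition _ := isMeasure.Build _ _ _ (image_measure mf)
  image0 image_ge0 image_sigma_additive.

Let image_fin : fin_num_fun (image_measure mf).
Proof.
move=> A mA; apply: fin_num_measure; rewrite -[X in measurable X]setTI; exact: mf.
Qed.

HB.instance Definition _ := Measure_isFinite.Build _ _ _ (image_measure mf) image_fin.

Lemma ge0_integral_image (g : T2 -> \bar R) : measurable_fun setT g ->
  (forall y, 0 <= g y)%E ->
  (\int[image_measure mf]_y g y = \int[m]_x g (f x))%E.
Proof.
by move=> mg g0; rewrite /image_measure ge0_integral_pushforward// preimage_setT.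
Qed.

End image_measure.

(** * Measures with prescribed cylinder masses *)

Section extension.
Context {b : nat} {R : realType}.
Variable a : seq (letter b) -> R.
Hypothesis am : is_mass a.
Implicit Types (u : seq (letter b)) (t : R).

(** The measure is an image of Lebesgue measure. Each word [u] receives a half-open interval [I u]
    of length [a u], cut into the intervals of its children in the order of the letters; [S u k] is
    the offset of child [k] inside [I u]. A real [t] is sent to the sequence whose prefixes are the
    words with [t] in their interval. *)
Let S u (k : nat) : R := \sum_(j : letter b | (j < k)%N) a (rcons u j).

Let S0 u : S u 0 = 0.
Proof. by rewrite /S big_pred0. Qed.

Let SS u (i : letter b) : S u i.+1 = S u i + a (rcons u i).
Proof.
rewrite /S (bigD1 i)//= addrC; congr (_ + _); apply: eq_bigl => j.
by rewrite ltnS ltn_neqAle andbC.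
Qed.

Let S_le u k k' : (k <= k')%N -> S u k <= S u k'.
Proof.
move=> kk; rewrite /S [leRHS](bigID (fun j : letter b => (j < k)%N))/=.
under [X in _ <= X + _]eq_bigl => j.
  rewrite (_ : _ && _ = (j < k)%N); last by case: (ltnP j k) => jk; rewrite ?andbF ?andbT// (leq_trans jk kk).
  over.
by rewrite lerDl sumr_ge0// => i _; exact: am.1.
Qed.

Let Smax u : S u b.-1.+1 = a u.
Proof. by rewrite am.2 /S; apply: eq_bigl => j; rewrite ltn_ord. Qed.

(** The left end of the interval of [p ++ u], measured from that of [p]. *)
Let Fixpoint loP (p u : seq (letter b)) : R :=
  if u is i :: v then S p i + loP (rcons p i) v else 0.

Let lo u := loP [::] u.

Let lo_rcons u (i : letter b) : lo (rcons u i) = lo u + S u i.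
Proof.
rewrite /lo -{3}[u]cat0s; elim: u [::] => [|j u IH] p /=.
  by rewrite cats0 addr0 add0r.
by rewrite IH addrA cat_rcons.
Qed.

Let I u : set R := [set` `[lo u, lo u + a u[].

Let I_rcons u (i : letter b) t :
  I (rcons u i) t <-> lo u + S u i <= t < lo u + S u i.+1.
Proof. by rewrite /I /= in_itv /= lo_rcons SS addrA. Qed.

Let IE u t : I u t <-> lo u + S u 0 <= t < lo u + S u b.-1.+1.
Proof. by rewrite /I /= in_itv /= S0 Smax addr0. Qed.

Let I_sub u i t : I (rcons u i) t -> I u t.
Proof.
move=> /I_rcons/andP[it ti]; apply/IE; apply/andP; split.
  by apply: le_trans it; rewrite lerD2l S_le.
by apply: lt_le_trans ti _; rewrite lerD2l S_le// ltn_ord.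
Qed.

Let I_inj u i j t : I (rcons u i) t -> I (rcons u j) t -> i = j.
Proof.
wlog ij : i j / (i <= j)%N => [H Ii Ij|].
  by case/orP: (leq_total i j) => ij; [exact: H|apply/esym; exact: H].
move=> /I_rcons/andP[_ ti] /I_rcons/andP[tj _].
apply/val_inj/eqP; rewrite eqn_leq ij /= leqNgt; apply/negP => ltij.
by move: (lt_le_trans ti (le_trans (lerD (lexx _) (S_le u ltij)) tj)); rewrite ltxx.
Qed.

Let I_ex u t : I u t -> exists i, I (rcons u i) t.
Proof.
move=> /IE/andP[t0 tb].
have ex : exists k, t < lo u + S u k by exists b.-1.+1.
(* The least [k] whose offset lies beyond [t] is positive, and the child containing [t] is its
   predecessor. *)
have [k tk kmin] := ex_minnP ex.
case: k tk kmin => [|k] tk kmin; first by move: (le_lt_trans t0 tk); rewrite ltxx.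
have kb : (k < b.-1.+1)%N by exact: kmin.
exists (Ordinal kb); apply/I_rcons; rewrite tk andbT leNgt; apply/negP => /kmin.
by rewrite ltnn.
Qed.

Let digit u t : letter b := xget ord0 [set i | I (rcons u i) t].

Let Fixpoint word t n := if n is n'.+1 then rcons (word t n') (digit (word t n') t) else [::].

Let point_of t : seq_space b := fun n => digit (word t n) t.

Let restr_point t n : restr (point_of t) n = word t n.
Proof. by elim: n => //= n IH; rewrite restrS IH. Qed.

Let I_digit u t : I u t -> I (rcons u (digit u t)) t.
Proof. by move=> /I_ex[i ui]; apply: (xgetPex ord0 (P := [set i | I (rcons u i) t])); exists i. Qed.

Let I_word t n : I [::] t -> I (word t n) t.
Proof. by move=> t0; elim: n => //= n; exact: I_digit. Qed.

Let word_unique u t : I u t -> word t (size u) = u.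
Proof.
elim/last_ind: u => // u i IH uit; rewrite size_rcons /= IH; last exact: I_sub uit.
by congr rcons; apply: (I_inj _ uit); apply: I_digit; exact: I_sub uit.
Qed.

Let I_nil u t : I u t -> I [::] t.
Proof. by elim/last_ind: u => // u i IH /I_sub. Qed.

(** Outside the root interval an arbitrary point is taken; Lebesgue measure is restricted to that
    interval. *)
Let phi t : seq_space b := if `[< I [::] t >] then point_of t else pad [::].

Let phi_cylinder u t : I [::] t -> cylinder u (phi t) <-> I u t.
Proof.
move=> t0; rewrite /phi asboolT// /cylinder /= restr_point; split=> [<-|].
  exact: I_word.
exact: word_unique.
Qed.

Let mI u : measurable (I u). Proof. exact: measurable_itv. Qed.

Let mphi : measurable_fun setT phi.
Proof.
apply: (measurability _ measurable_cylinders) => _ [A [[u _ <-]|->] <-]; last first.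
  by rewrite preimage_set0 setI0; exact: measurable0.
rewrite setTI.
have -> : phi @^-1` cylinder u =
    I u `|` (~` I [::] `&` [set t | cylinder u (@pad b [::])]).
  apply/seteqP; split => [t|t [ut|[t0]]].
  - have [t0 /(phi_cylinder u t0)|t0] := pselect (I [::] t); first by left.
    by rewrite /= /phi asboolF//; right.
  - by apply/phi_cylinder => //; exact: I_nil ut.
  - by rewrite /= /phi asboolF.
apply: measurableU; first exact: mI.
apply: measurableI; first by apply: measurableC; exact: mI.
have [pu|pu] := pselect (cylinder u (@pad b [::])).
  by rewrite (_ : [set t | _] = setT); [exact: measurableT|apply/seteqP; split].
by rewrite (_ : [set t | _] = set0); [exact: measurable0|apply/seteqP; split].
Qed.

Let leb_fin : fin_num_fun (mrestr (@lebesgue_measure R) (mI [::])).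
Proof.
apply: lty_fin_num_fun.
rewrite /= /mrestr setTI lebesgue_measure_itv /=.
by case: ifP => // _; rewrite -EFinB ltry.
Qed.

Lemma mass_extension : exists M : {finite_measure set (seq_space b) -> \bar R},
  forall u, M (cylinder u) = (a u)%:E.
Proof.
pose m : {finite_measure set (measurableTypeR R) -> \bar R} :=
  HB.pack (mrestr (@lebesgue_measure R) (mI [::]))
    (Measure_isFinite.Build _ _ _ (mrestr (@lebesgue_measure R) (mI [::])) leb_fin).
exists (image_measure m mphi) => u.
rewrite /= /image_measure /pushforward /= /mrestr.
have -> : phi @^-1` cylinder u `&` I [::] = I u.
  apply/seteqP; split => [t [/= ut t0]|t ut]; first exact/phi_cylinder.
  by split; [apply/phi_cylinder; [exact: I_nil ut|]|exact: I_nil ut].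
rewrite lebesgue_measure_itv /= lte_fin ltrDl; have := am.1 u.
(* A word of mass 0 has an empty interval, for which the length formula has a separate case. *)
rewrite le_eqVlt => /predU1P[<-|->]; first by rewrite ltxx.
by rewrite -EFinB addrC addKr.
Qed.

End extension.

(** * Families of independent variables *)

(* [D] is a phantom argument: it selects the sigma-field generated by the coordinates in [D]. *)
Definition env (I : Type) (R : realType) (D : set I) : Type := I -> R.

Definition env_gen (I : Type) (R : realType) (D : set I) : set (set (I -> R)) :=
  [set A | exists i, D i /\ exists2 B, measurable B & A = [set om | B (om i)]].

HB.instance Definition _ (I : Type) (R : realType) (D : set I) :=
  isPointed.Build (env R D) (fun=> 0).
HB.instance Definition _ (I : Type) (R : realType) (D : set I) :=
  Measurable.copy (env R D) (g_sigma_algebraType (@env_gen I R D : set (set (env R D)))).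

Section env.
Context {I : eqType} {R : realType}.
Implicit Types (D : set I).

Lemma measurable_coord D i : D i -> measurable_fun setT (fun om : env R D => om i).
Proof.
move=> Di _ B mB; rewrite setTI; apply: sub_sigma_algebra.
by exists i; split => //; exists B.
Qed.

Lemma measurable_to_env D d (T : measurableType d) (f : T -> env R D) :
  (forall i, D i -> measurable_fun setT (fun x => f x i)) -> measurable_fun setT f.
Proof.
move=> mf; apply: (measurability _ (erefl : @measurable _ (env R D) = <<s @env_gen I R D >>)) => _ [_ [i [Di [B mB ->]]] <-].
by rewrite setTI -[X in measurable X]setTI; exact: mf.
Qed.

(** Finite-dimensional boxes: a pi-system on which independence expresses the law of a family by its
    marginals. *)
Definition env_pi D : set (set (env R D)) := [set A | exists s (B : I -> set R),
  [/\ uniq s, [set` s] `<=` D, forall i, measurable (B i) &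
      A = \bigcap_(i in [set` s]) [set om | B i (om i)]]].

Arguments env_pi D : clear implicits.

Lemma env_piI D : setI_closed (env_pi D).
Proof.
move=> _ _ [s1 [B1 [u1 sD1 mB1 ->]]] [s2 [B2 [u2 sD2 mB2 ->]]].
pose B i := (if i \in s1 then B1 i else setT) `&` (if i \in s2 then B2 i else setT).
exists (undup (s1 ++ s2)), B; split.
- exact: undup_uniq.
- by move=> i /=; rewrite mem_undup mem_cat => /orP[/sD1|/sD2].
- by move=> i; apply: measurableI; case: ifP.
apply/seteqP; split => [om [H1 H2] i _ /=|om H].
  by split; case: ifPn => // iS; [exact: H1|exact: H2].
split => i /= iS; have := H i; rewrite /= mem_undup mem_cat iS ?orbT => /(_ isT)[].
  by rewrite iS.
by rewrite iS.
Qed.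

Lemma env_pi_measurable D A : env_pi D A -> measurable A.
Proof.
move=> [s [B [us sD mB ->]]]; apply: fin_bigcap_measurable => // i /sD Di.
by rewrite -[X in measurable X]setTI; exact: measurable_coord.
Qed.

Lemma eq_measure_env D (m1 m2 : {finite_measure set (env R D) -> \bar R}) :
  (forall A, env_pi D A -> m1 A = m2 A) -> forall A, measurable A -> m1 A = m2 A.
Proof.
move=> m12 A mA.
have piE : @measurable _ (env R D) = <<s env_pi D >>.
  apply/seteqP; split; apply: smallest_sub.
  - exact: smallest_sigma_algebra.
  - move=> _ [i [Di [B mB ->]]]; apply: sub_sigma_algebra.
    exists [:: i], (fun=> B); split => //; first by move=> j; rewrite /= inE => /eqP ->.
    apply/seteqP; split => [om H j|om H]; first by rewrite /= inE => /eqP ->.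
    by apply: (H i); rewrite /= inE.
  - exact: sigma_algebra_measurable.
  - exact: env_pi_measurable.
apply: (measure_unique (env_pi D) (fun=> setT) piE) => //.
- exact: env_piI.
- by move=> _; exists [::], (fun=> setT); split => //; apply/seteqP; split => // om _ i.
- by rewrite bigcup_const//; exists 0%N.
- by move=> _; rewrite fin_num_fun_lty//; exact: fin_num_measure.
Qed.

Section family.
Context d (T : measurableType d) (P : probability T R) (X : I -> T -> R).
Hypothesis mX : forall i, measurable_fun setT (X i).

Definition path D (w : T) : env R D := fun i => X i w.
Arguments path D w : clear implicits.

Lemma measurable_path D : measurable_fun setT (path D).
Proof. by apply: measurable_to_env => i _; exact: mX. Qed.

Lemma measurable_pathP D A : measurable A -> measurable (path D @^-1` A).
Proof. by move=> mA; rewrite -[X in measurable X]setTI; exact: measurable_path. Qed.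

Lemma path_pi D (s : seq I) (B : I -> set R) : path D @^-1` (\bigcap_(i in [set` s]) [set om | B i (om i)]) =
  \bigcap_(i in [set` s]) X i @^-1` B i.
Proof. by []. Qed.

Section independence.
Variables (D D1 D2 : set I).
Hypothesis indX : mutually_independent P D X.
Hypotheses (D1D : D1 `<=` D) (D2D : D2 `<=` D) (D12 : D1 `&` D2 = set0).

Let indep_pi A1 A2 : env_pi D1 A1 -> env_pi D2 A2 ->
  P (path D1 @^-1` A1 `&` path D2 @^-1` A2) = (P (path D1 @^-1` A1) * P (path D2 @^-1` A2))%E.
Proof.
move=> [s1 [B1 [u1 sD1 mB1 ->]]] [s2 [B2 [u2 sD2 mB2 ->]]].
rewrite !path_pi.
have s12 i : i \in s1 -> i \in s2 -> False.
  move=> /sD1 i1 /sD2 i2; have : (D1 `&` D2) i by [].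
  by rewrite D12.
pose B i := if i \in s1 then B1 i else B2 i.
have us : uniq (s1 ++ s2).
  rewrite cat_uniq u1 u2 andbT/=; apply/hasPn => i i2; apply/negP => i1.
  exact: s12 i1 i2.
have -> : \bigcap_(i in [set` s1]) X i @^-1` B1 i `&` \bigcap_(i in [set` s2]) X i @^-1` B2 i =
    \bigcap_(i in [set` s1 ++ s2]) X i @^-1` B i.
  apply/seteqP; split => [w [H1 H2] i /=|w H].
    rewrite mem_cat /B; case: ifPn => /= [i1 _|_ i2]; [exact: H1|exact: H2].
  split => i /= iS; have := H i; rewrite /= mem_cat iS ?orbT /B => /(_ isT).
    by rewrite iS.
  by rewrite ifN//; apply/negP => /s12; exact.
rewrite !indX//.
- rewrite big_cat/=; congr (_ * _)%E; rewrite !big_seq; apply: eq_bigr => i iS.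
    by rewrite /B iS.
  by rewrite /B ifN//; apply/negP => /s12; exact.
- by move=> i /= /sD2 /D2D.
- by move=> i /= /sD1 /D1D.
- by move=> i /=; rewrite mem_cat => /orP[/sD1 /D1D|/sD2 /D2D].
- by move=> i; rewrite /B; case: ifP.
Qed.

(** For fixed [C] both sides are finite measures in [A] that agree on boxes. Applied twice, once to
    each factor, it extends independence from boxes to the generated sigma-fields. *)
Let indep_step (D' : set I) (C : set T) : measurable C ->
  (forall A, env_pi D' A -> P (path D' @^-1` A `&` C) = (P (path D' @^-1` A) * P C)%E) ->
  forall A, measurable A -> P (path D' @^-1` A `&` C) = (P (path D' @^-1` A) * P C)%E.
Proof.
move=> mC H A mA.
have PC : P C = (fine (P C))%:E by rewrite fineK//; exact: fin_num_measure.
pose r : {nonneg R} := NngNum (fine_ge0 (measure_ge0 P C)).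
have := @eq_measure_env D' (image_measure (mrestr P mC) (@measurable_path D'))
  (mscale r (image_measure P (@measurable_path D'))).
move=> /(_ _ A mA); rewrite /= /mscale /= /image_measure /pushforward /mrestr /= -PC.
move=> mAE; rewrite [RHS]muleC; apply: mAE => B piB.
by rewrite [RHS]muleC; exact: H.
Qed.

Lemma path_indep A1 A2 : measurable A1 -> measurable A2 ->
  P (path D1 @^-1` A1 `&` path D2 @^-1` A2) = (P (path D1 @^-1` A1) * P (path D2 @^-1` A2))%E.
Proof.
move=> mA1 mA2; rewrite (indep_step (D' := D1))//; first exact: measurable_pathP.
move=> A piA; rewrite setIC muleC; apply: (indep_step (D' := D2)) => //.
  by apply: measurable_pathP; exact: env_pi_measurable.
by move=> B piB; rewrite setIC muleC; exact: indep_pi.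
Qed.

(** By independence the joint law of the two paths is a product measure, and Tonelli's theorem
    factors the integral. *)
Let path_indep_integral0 (F : env R D1 -> \bar R) (G : env R D2 -> \bar R) :
  measurable_fun setT F -> measurable_fun setT G ->
  (forall om, 0 <= F om)%E -> (forall om, 0 <= G om)%E ->
  (\int[P]_w (F (path D1 w) * G (path D2 w)) =
   \int[P]_w F (path D1 w) * \int[P]_w G (path D2 w))%E.
Proof.
move=> mF mG F0 G0.
pose m1 : {finite_measure set (env R D1) -> \bar R} := image_measure P (@measurable_path D1).
pose m2 : {finite_measure set (env R D2) -> \bar R} := image_measure P (@measurable_path D2).
have mp : measurable_fun setT (fun w => (path D1 w, path D2 w)).
  by apply: measurable_fun_pair; exact: measurable_path.
pose m : {finite_measure set (env R D1 * env R D2)%type -> \bar R} := image_measure P mp.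
have mE A : measurable A -> (m1 \x m2)%E A = m A.
  apply: product_measure_unique => B C mB mC.
  by rewrite /m /m1 /m2 /= /image_measure /pushforward /= -path_indep.
have mFG : measurable_fun setT (fun p : env R D1 * env R D2 => (F p.1 * G p.2)%E).
  by apply: emeasurable_funM; apply: measurableT_comp.
have -> : (\int[P]_w (F (path D1 w) * G (path D2 w)) = \int[m]_p (F p.1 * G p.2))%E.
  by rewrite ge0_integral_image// => p; exact: mule_ge0.
rewrite (eq_measure_integral (m1 \x m2)%E); last by move=> A mA _; exact/esym/mE.
rewrite fubini_tonelli1//; last by move=> p; exact: mule_ge0.
rewrite /fubini_F /=.
under eq_integral do rewrite ge0_integralZl//.
rewrite ge0_integralZr//; last exact: integral_ge0.
by rewrite !ge0_integral_image.
Qed.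

Lemma path_indep_integral (F : env R D1 -> \bar R) (G : env R D2 -> \bar R) :
  measurable_fun setT F -> measurable_fun setT G ->
  (forall w, 0 <= F (X^~ w))%E -> (forall w, 0 <= G (X^~ w))%E ->
  (\int[P]_w (F (X^~ w) * G (X^~ w)) = \int[P]_w F (X^~ w) * \int[P]_w G (X^~ w))%E.
Proof.
move=> mF mG F0 G0.
(* [F] and [G] are nonnegative along the paths of [X] only, not in every environment; absolute
   values repair this without changing the integrals. *)
have := @path_indep_integral0 (fun om => `|F om|%E) (fun om => `|G om|%E).
have mF' : measurable_fun setT (fun om : env R D1 => `|F om|%E) by exact: measurableT_comp.
have mG' : measurable_fun setT (fun om : env R D2 => `|G om|%E) by exact: measurableT_comp.
move=> /(_ mF' mG' (fun=> abse_ge0 _) (fun=> abse_ge0 _)).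
under eq_integral do rewrite (gee0_abs (F0 _)) (gee0_abs (G0 _)).
under [X in _ = (X * _)%E -> _]eq_integral do rewrite (gee0_abs (F0 _)).
by under [X in _ = (_ * X)%E -> _]eq_integral do rewrite (gee0_abs (G0 _)).
Qed.

End independence.
End family.

Section same_law.
Variable D : set I.
Context d (T : measurableType d) (P : probability T R) (X : I -> T -> R).
Context d' (T' : measurableType d') (P' : probability T' R) (X' : I -> T' -> R).
Hypotheses (mX : forall i, measurable_fun setT (X i))
  (mX' : forall i, measurable_fun setT (X' i)).
Hypotheses (indX : mutually_independent P D X) (indX' : mutually_independent P' D X').
Hypothesis lawX : forall i A, D i -> measurable A -> P (X i @^-1` A) = P' (X' i @^-1` A).

Let path_same_integral0 (G : env R D -> \bar R) :
  measurable_fun setT G -> (forall om, 0 <= G om)%E ->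
  (\int[P]_w G (path X D w) = \int[P']_w G (path X' D w))%E.
Proof.
move=> mG G0.
rewrite -(ge0_integral_image P (measurable_path mX (D:=D)))//.
rewrite -(ge0_integral_image P' (measurable_path mX' (D:=D)))//.
apply: eq_measure_integral => A mA _.
apply: eq_measure_env => // _ [s [B [us sD mB ->]]].
rewrite /= /image_measure /pushforward !path_pi indX// indX'// !big_seq.
by apply: eq_bigr => i /sD Di; exact: lawX.
Qed.

Lemma path_same_integral (G : env R D -> \bar R) : measurable_fun setT G ->
  (forall w, 0 <= G (X^~ w))%E -> (forall w, 0 <= G (X'^~ w))%E ->
  (\int[P]_w G (X^~ w) = \int[P']_w G (X'^~ w))%E.
Proof.
move=> mG G0 G0'.
have := @path_same_integral0 (fun om => `|G om|%E).
have mG' : measurable_fun setT (fun om : env R D => `|G om|%E) by exact: measurableT_comp.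
move=> /(_ mG' (fun=> abse_ge0 _)).
under eq_integral do rewrite (gee0_abs (G0 _)).
by under [X in _ = X -> _]eq_integral do rewrite (gee0_abs (G0' _)).
Qed.

End same_law.
End env.

(** * Convergence of nonnegative martingales *)

Section martingale.
Context {I : eqType} {R : realType} d (T : measurableType d) (P : probability T R).
Variable X : I -> T -> R.
Hypothesis mX : forall i, measurable_fun setT (X i).
Variable Dn : nat -> set I.
Hypothesis Dn_le : forall n m, (n <= m)%N -> Dn n `<=` Dn m.
Local Notation intg f := (P.-integrable [set: T] (EFin \o f)).
Local Notation om w := (X^~ w).

Definition adapted n (F : (I -> R) -> R) := measurable_fun setT (F : env R (Dn n) -> R).

Lemma measurable_env_sub (D1 D2 : set I) (F : (I -> R) -> R) : D1 `<=` D2 ->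
  measurable_fun setT (F : env R D1 -> R) -> measurable_fun setT (F : env R D2 -> R).
Proof.
move=> D12 mF.
apply: (@measurableT_comp _ _ _ _ _ _ (F : env R D1 -> R) setT (fun x : env R D2 => x : env R D1) mF).
by apply: measurable_to_env => i /D12 Di; exact: measurable_coord.
Qed.

Lemma adapted_le n m F : (n <= m)%N -> adapted n F -> adapted m F.
Proof. by move=> /Dn_le; exact: measurable_env_sub. Qed.

Lemma adapted_meas n F : adapted n F -> measurable_fun setT (fun w => F (om w)).
Proof.
move=> mF; apply: (@measurableT_comp _ _ _ _ _ _ (F : env R (Dn n) -> R) setT (path X (Dn n)) mF).
exact: measurable_path.
Qed.

Variable Y : nat -> (I -> R) -> R.
Hypothesis Yad : forall n, adapted n (Y n).
Hypothesis Y0 : forall n w, 0 <= Y n (om w).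
Hypothesis iY : forall n, intg (fun w => Y n (om w)).
(** The martingale property in integrated form, tested on bounded adapted functions instead of being
    stated by conditional expectations. *)
Hypothesis martY : forall n m F C, (n <= m)%N -> adapted n F -> (forall x, 0 <= F x <= C) ->
  \int[P]_w (F (om w) * Y m (om w)) = \int[P]_w (F (om w) * Y n (om w)).

(* As y |-> 1 / (1 + y) is convex, [Z] is a bounded submartingale, hence Cauchy in L2 and, by the
   maximal inequality, almost surely. *)
Let Z n x := (1 + `|Y n x|)^-1.

Let Z_gt0 n x : 0 < Z n x.
Proof. by rewrite invr_gt0 ltr_wpDr. Qed.

Let Z_le1 n x : Z n x <= 1.
Proof. by rewrite invf_le1 ?lerDl// ltr_wpDr. Qed.

Let Z_norm n x : `|Z n x| <= 1.
Proof. by rewrite ger0_norm// ltW. Qed.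

Let Zad n : adapted n (Z n).
Proof.
apply: (@measurableT_comp _ _ _ _ _ _ (fun y : R => (1 + `|y|)^-1)); last exact: Yad.
apply: continuous_measurable_fun => y; apply: cvgV.
  by rewrite gt_eqF// ltr_wpDr.
by apply: cvgD; [exact: cvg_cst|apply: cvg_norm].
Qed.

Let intgZ' n : intg (fun w => Z n (om w)).
Proof. by apply: (@intg_bounded _ _ _ _ _ 1) => //; apply: (adapted_meas (@Zad n)). Qed.

Lemma adaptedM n F G : adapted n F -> adapted n G -> adapted n (fun x => F x * G x).
Proof. exact: measurable_funM. Qed.

Lemma intg_adapted n F C : adapted n F -> (forall x, `|F x| <= C) -> intg (fun w => F (om w)).
Proof. by move=> Fa FC; apply: (@intg_bounded _ _ _ _ _ C) => //; exact: adapted_meas Fa. Qed.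

Lemma intgM_bounded (f g : T -> R) C : measurable_fun setT f -> (forall w, `|f w| <= C) ->
  intg g -> intg (fun w => f w * g w).
Proof.
move=> mf fC ig; apply: (@intg_le _ _ _ _ _ (fun w => C * g w)).
- by apply: measurable_funM => //; exact: intg_meas ig.
- by move=> w; rewrite !normrM ler_wpM2r// (le_trans (fC w))// ler_norm.
- exact: intgZ.
Qed.

Let tangent (s t : R) : 0 <= s -> 0 <= t ->
  (1 + s)^-1 - (1 + s)^-1 ^+ 2 * (t - s) <= (1 + t)^-1.
Proof.
move=> s0 t0; rewrite -subr_ge0.
have s1 : 1 + s != 0 by rewrite gt_eqF// ltr_wpDr.
have t1 : 1 + t != 0 by rewrite gt_eqF// ltr_wpDr.
have -> : (1 + t)^-1 - ((1 + s)^-1 - (1 + s)^-1 ^+ 2 * (t - s)) =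
  (t - s) ^+ 2 * (1 + s)^-1 ^+ 2 * (1 + t)^-1 by field; apply/andP.
apply: mulr_ge0; first by apply: mulr_ge0; exact: sqr_ge0.
by rewrite invr_ge0 addr_ge0.
Qed.

Let submart n m F C : (n <= m)%N -> adapted n F -> (forall x, 0 <= F x <= C) ->
  \int[P]_w (F (om w) * Z n (om w)) <= \int[P]_w (F (om w) * Z m (om w)).
Proof.
move=> nm Fa FC.
have FC' x : `|F x| <= C by have /andP[F0 FxC] := FC x; rewrite ger0_norm.
have C0 : 0 <= C by apply: le_trans (FC' (fun=> 0)).
have Fm := adapted_meas Fa.
(* [- Z n ^+ 2] is the slope of the tangent at [Y n]. As [G] is bounded and adapted, the martingale
   property cancels the linear term of the tangent inequality. *)
pose G x := F x * Z n x ^+ 2.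
have Ga : adapted n G by apply: adaptedM => //; apply: adaptedM.
have GC x : `|G x| <= C.
  rewrite normrM -[C]mulr1 ler_pM//.
  by rewrite normrX exprn_ile1.
have Gb x : 0 <= G x <= C.
  by rewrite (le_trans (ler_norm _) (GC x)) andbT mulr_ge0 ?sqr_ge0//; have /andP[] := FC x.
have Gm := adapted_meas Ga.
have iGm k : intg (fun w => G (om w) * Y k (om w)) by exact: intgM_bounded.
have iFZ k : intg (fun w => F (om w) * Z k (om w)) by exact: intgM_bounded.
have H : \int[P]_w (F (om w) * Z n (om w) - (G (om w) * Y m (om w) - G (om w) * Y n (om w))) <=
     \int[P]_w (F (om w) * Z m (om w)).
  apply: Rint_le => //; first by apply: intgB => //; exact: intgB.
  move=> w; have := tangent (Y0 n w) (Y0 m w).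
  have /andP[F0 _] := FC (om w).
  move/(ler_wpM2l F0); rewrite /G /Z !ger0_norm//.
  by apply: le_trans; rewrite le_eqVlt; apply/orP; left; apply/eqP; ring.
apply: le_trans H.
rewrite RintegralB//; last exact: intgB.
by rewrite RintegralB// (martY nm Ga Gb) subrr subr0.
Qed.

Let s n := \int[P]_w (Z n (om w) ^+ 2).

Let Z2_norm n x : `|Z n x ^+ 2| <= 1.
Proof. by rewrite normrX exprn_ile1. Qed.

Let intgZ2 n : intg (fun w => Z n (om w) ^+ 2).
Proof. by apply: (@intg_adapted n (fun x => Z n x ^+ 2) 1) => //; apply: adaptedM. Qed.

Let V2 n m : (n <= m)%N ->
  \int[P]_w ((Z m (om w) - Z n (om w)) ^+ 2) <= s m - s n.
Proof.
move=> nm.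
have iZZ k : intg (fun w => Z n (om w) * Z k (om w)).
  by apply: (@intgM_bounded _ _ 1) => //; exact: adapted_meas.
have -> : \int[P]_w ((Z m (om w) - Z n (om w)) ^+ 2) =
    \int[P]_w (Z m (om w) ^+ 2 + Z n (om w) ^+ 2 - 2 * (Z n (om w) * Z m (om w))).
  by apply: eq_Rintegral => w _; ring.
rewrite RintegralB ?RintegralD ?RintegralZl//; [|exact: intgD|exact: intgZ].
(* [submart] with [F = Z n] bounds the cross term of the square from below by [s n]. *)
have Zb x : 0 <= Z n x <= 1 by rewrite Z_le1 ltW.
have := submart nm (@Zad n) Zb.
have -> : \int[P]_w (Z n (om w) * Z n (om w)) = s n.
  by apply: eq_Rintegral => w _; rewrite expr2.
rewrite /s; lra.
Qed.

Let s_cauchy e : 0 < e -> exists n, forall m, (n <= m)%N -> s m - s n <= e.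
Proof.
move=> e0.
have s_nd : nondecreasing_seq s.
  move=> n m nm; rewrite -subr_ge0; apply: le_trans (V2 nm).
  by apply: Rintegral_ge0 => w _; exact: sqr_ge0.
have s_ub : has_ubound (range s).
  exists 1 => _ [n _ <-]; rewrite -[leRHS](Rint_prob_cst P).
  apply: Rint_le => //; first exact: intg_cst.
  by move=> w; exact: le_trans (ler_norm _) (Z2_norm n _).
have /cvgrPdist_le/(_ _ e0)[n _ sn] := nondecreasing_cvgn s_nd s_ub.
exists n => m nm.
have := sn n (leqnn n); rewrite ler_norml => /andP[_ sne].
apply: le_trans sne; rewrite lerD2r; apply: ub_le_sup => //; by exists m.
Qed.

Section maximal.
Variables (n : nat) (e : R) (hit : nat -> (I -> R) -> bool).
Hypothesis e0 : 0 < e.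
Hypothesis hitad : forall m, adapted (maxn n m) (fun x => (hit m x)%:R).

Let V m x : R := Z m x - Z n x.
(** The indicator that no hit occurred from [n] to [k]; it plays the part of a stopping time. The
    predicate [hit] is later [e <= V] or [V <= - e]. *)
Let J k x : R := \prod_(n <= j < k.+1) (1 - (hit j x)%:R).

Let J01 k x : J k x = 1 \/ J k x = 0.
Proof.
rewrite /J; apply: (big_ind (fun y => y = 1 \/ y = 0)) => [|y z|j _]; first by left.
  by move=> [->|->] [->|->]; rewrite ?mulr1 ?mul0r ?mulr0; auto.
by case: (hit j x); rewrite ?subrr ?subr0; auto.
Qed.

Let J_ge0 k x : 0 <= J k x <= 1.
Proof. by case: (J01 k x) => ->; rewrite ?lexx ?ler01. Qed.

Let cJ_ge0 k x : 0 <= 1 - J k x <= 1.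
Proof. by case: (J01 k x) => ->; rewrite ?subrr ?subr0 ?lexx ?ler01. Qed.

Let Jad k : (n <= k)%N -> adapted k (J k).
Proof.
move=> nk; apply: measurable_prod => j; rewrite mem_index_iota ltnS => /andP[nj jk].
apply: measurable_funB => //; have := @hitad j; rewrite (maxn_idPr nj).
exact: adapted_le.
Qed.

Let cJad k : (n <= k)%N -> adapted k (fun x => 1 - J k x).
Proof. by move=> nk; apply: measurable_funB => //; exact: Jad. Qed.

Let JS k x : (n <= k)%N -> J k.+1 x = J k x * (1 - (hit k.+1 x)%:R).
Proof. by move=> nk; rewrite /J big_nat_recr//= (leq_trans nk). Qed.

Let bounded01 (F : (I -> R) -> R) : (forall x, 0 <= F x <= 1) -> forall x, `|F x| <= 1.
Proof. by move=> F01 x; have /andP[? ?] := F01 x; rewrite ger0_norm. Qed.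

Let V_norm m x : `|V m x| <= 1.
Proof.
have := Z_gt0 m x; have := Z_gt0 n x; have := Z_le1 m x; have := Z_le1 n x.
by move=> *; rewrite /V ler_norml; apply/andP; split; lra.
Qed.

Let Vad m : (n <= m)%N -> adapted m (V m).
Proof. by move=> nm; apply: measurable_funB; [exact: Zad|apply: (adapted_le nm); exact: Zad]. Qed.

Let iVF m k F : (n <= m)%N -> adapted k F -> (forall x, 0 <= F x <= 1) ->
  intg (fun w => V m (om w) * F (om w)).
Proof.
move=> nm Fa F01; apply: (@intgM_bounded _ _ 1) => //.
  exact: adapted_meas (Vad nm).
by apply: (intg_adapted Fa (C := 1)); exact: bounded01.
Qed.

Let submartV k F : (n <= k)%N -> adapted k F -> (forall x, 0 <= F x <= 1) ->
  \int[P]_w (V k (om w) * F (om w)) <= \int[P]_w (V k.+1 (om w) * F (om w)).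
Proof.
move=> nk Fa F01.
have iFZ m : intg (fun w => F (om w) * Z m (om w)).
  apply: (@intgM_bounded _ _ 1) => //; first exact: adapted_meas Fa.
  by move=> w; exact: bounded01.
have E m : \int[P]_w (V m (om w) * F (om w)) =
    \int[P]_w (F (om w) * Z m (om w)) - \int[P]_w (F (om w) * Z n (om w)).
  by rewrite -RintegralB//; apply: eq_Rintegral => w _; rewrite /V; ring.
by rewrite !E lerD2r; apply: submart F01.
Qed.

Let i1 k F : adapted k F -> (forall x, 0 <= F x <= 1) -> intg (fun w => F (om w)).
Proof. by move=> Fa F01; apply: (intg_adapted Fa (C := 1)); exact: bounded01. Qed.

Let hit01 m x : 0 <= ((hit m x)%:R : R) <= 1.
Proof. by case: (hit m x); rewrite lexx ler01. Qed.

Let JH k : (n <= k)%N -> adapted k.+1 (fun x => J k x * (hit k.+1 x)%:R).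
Proof.
move=> nk; apply: adaptedM; first by apply: (adapted_le (leqnSn k)); exact: Jad.
by have := @hitad k.+1; rewrite (maxn_idPr (leqW nk)).
Qed.

Let JH01 k x : 0 <= J k x * (hit k.+1 x)%:R <= 1.
Proof. by case: (J01 k x) => ->; rewrite ?mul0r ?mul1r ?lexx ?ler01. Qed.

(** Doob's inequality through the mean of [V] on the event already hit: a new hit adds at least [e]
    times its probability, and on old hits the mean of a submartingale does not decrease. *)
Lemma maximal_upper p : (forall m x, hit m x -> e <= V m x) ->
  e * \int[P]_w (1 - J (n + p) (om w)) <= \int[P]_w `|V (n + p) (om w)|.
Proof.
move=> hV; apply: (@le_trans _ _ (\int[P]_w (V (n + p) (om w) * (1 - J (n + p) (om w))))); last first.
  have nk := leq_addr p n; apply: Rint_le => //.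
  - by apply: (iVF nk (@cJad _ nk)); exact: cJ_ge0.
  - apply: intg_abs; apply: (intg_adapted (@Vad _ nk) (C := 1)); exact: V_norm.
  - move=> w; case: (J01 (n + p) (om w)) => ->; rewrite ?subrr ?subr0 ?mulr1 ?ler_norm//.
    by rewrite mulr0.
elim: p => [|p IH].
  rewrite addn0 -RintegralZl//; last by apply: (i1 (@cJad n _)).
  apply: Rint_le.
  - by apply: intgZ; apply: (i1 (@cJad n _)).
  - by apply: (iVF _ (@cJad n _)).
  - move=> w; rewrite /J big_nat1 subKr; case: (boolP (hit n (om w))) => [/hV|_].
      by rewrite !mulr1.
    by rewrite !mulr0.
rewrite addnS; have nk := leq_addr p n; set k := (n + p)%N in nk IH *.
have JE x : 1 - J k.+1 x = (1 - J k x) + J k x * (hit k.+1 x)%:R by rewrite JS//; ring.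
have iJ : intg (fun w => 1 - J k (om w)) by exact: (i1 (@cJad k nk)).
have iJH : intg (fun w => J k (om w) * (hit k.+1 (om w))%:R) by exact: (i1 (@JH k nk)).
have iV1 : intg (fun w => V k.+1 (om w) * (1 - J k (om w))).
  exact: (iVF (leqW nk) (@cJad k nk) (cJ_ge0 k)).
have iV2 : intg (fun w => V k.+1 (om w) * (J k (om w) * (hit k.+1 (om w))%:R)).
  exact: (iVF (leqW nk) (@JH k nk) (JH01 k)).
under eq_Rintegral do rewrite JE.
rewrite RintegralD// mulrDr.
under [leRHS]eq_Rintegral do rewrite JE mulrDr.
rewrite [leRHS]RintegralD// lerD//.
  by apply: le_trans IH _; exact: submartV (@cJad k nk) (cJ_ge0 k).
rewrite -RintegralZl//; apply: Rint_le => //; first exact: intgZ.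
move=> w; case: (boolP (hit k.+1 (om w))) => [/hV|_]; last by rewrite !mulr0.
by rewrite !mulr1; case: (J01 k (om w)) => ->; rewrite ?mulr0 ?mulr1.
Qed.

(** For low values the mean of [V] on the event not yet hit is followed instead: removing a new hit,
    where [V <= - e], raises that mean by at least [e] times its probability. *)
Lemma maximal_lower p : (forall m x, hit m x -> V m x <= - e) ->
  e * \int[P]_w (1 - J (n + p) (om w)) <= \int[P]_w `|V (n + p) (om w)|.
Proof.
move=> hV; apply: (@le_trans _ _ (\int[P]_w (V (n + p) (om w) * J (n + p) (om w)))); last first.
  have nk := leq_addr p n; apply: Rint_le => //.
  - by apply: (iVF nk (@Jad _ nk)); exact: J_ge0.
  - apply: intg_abs; apply: (intg_adapted (@Vad _ nk) (C := 1)); exact: V_norm.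
  - by move=> w; case: (J01 (n + p) (om w)) => ->; rewrite ?mulr1 ?ler_norm// mulr0.
elim: p => [|p IH].
  rewrite addn0 -RintegralZl//; last by apply: (i1 (@cJad n _)).
  apply: Rint_le.
  - by apply: intgZ; apply: (i1 (@cJad n _)).
  - by apply: (iVF _ (@Jad n _)).
  - move=> w; rewrite /J big_nat1 subKr; case: (boolP (hit n (om w))) => [/hV|_].
      by rewrite /V subrr oppr_ge0 leNgt e0.
    by rewrite !mulr0 /V subrr mul0r.
rewrite addnS; have nk := leq_addr p n; set k := (n + p)%N in nk IH *.
have JE x : 1 - J k.+1 x = (1 - J k x) + J k x * (hit k.+1 x)%:R by rewrite JS//; ring.
have JE' x : J k.+1 x = J k x - J k x * (hit k.+1 x)%:R by rewrite JS//; ring.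
have iJ : intg (fun w => 1 - J k (om w)) by exact: (i1 (@cJad k nk)).
have iJH : intg (fun w => J k (om w) * (hit k.+1 (om w))%:R) by exact: (i1 (@JH k nk)).
have iV1 : intg (fun w => V k.+1 (om w) * J k (om w)).
  exact: (iVF (leqW nk) (@Jad k nk) (J_ge0 k)).
have iV2 : intg (fun w => V k.+1 (om w) * (J k (om w) * (hit k.+1 (om w))%:R)).
  exact: (iVF (leqW nk) (@JH k nk) (JH01 k)).
under eq_Rintegral do rewrite JE.
rewrite RintegralD// mulrDr.
under [leRHS]eq_Rintegral do rewrite JE' mulrBr.
rewrite [leRHS]RintegralB// lerD//.
  by apply: le_trans IH _; exact: submartV (@Jad k nk) (J_ge0 k).
rewrite -RintegralZl// lerNr -Rint_opp; last exact: intgZ.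
apply: Rint_le => //; first by apply: intgN; exact: intgZ.
move=> w; case: (boolP (hit k.+1 (om w))) => [/hV|_]; last by rewrite !mulr0 oppr0.
by rewrite !mulr1; case: (J01 k (om w)) => ->; rewrite ?mulr0 ?mulr1 ?oppr0// lerNr.
Qed.

Lemma maximal_set g : 0 <= g ->
  (forall p, e * \int[P]_w (1 - J (n + p) (om w)) <= g) ->
  (P [set w | exists p, hit (n + p) (om w)] <= (g / e)%:E)%E.
Proof.
move=> g0 H; pose B p := [set w | J (n + p) (om w) = 0].
have mB p : measurable (B p).
  have mJ := adapted_meas (@Jad _ (leq_addr p n)).
  by rewrite -[B p]setTI; exact: (mJ measurableT _ (measurable_set1 0)).
have JSp p x : J (n + p.+1) x = J (n + p) x * (1 - (hit (n + p.+1) x)%:R).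
  by rewrite addnS JS ?leq_addr.
have ndB : nondecreasing_seq B.
  apply/nondecreasing_seqP => p; apply/subsetPset => w.
  by rewrite /B /= JSp => ->; rewrite mul0r.
have BE : [set w | exists p, hit (n + p) (om w)] = \bigcup_p B p.
  apply/seteqP; split => [w [[|p] hp]|w [p _]].
  - by exists 0%N => //; move: hp; rewrite /B /= addn0 /J big_nat1 => ->; rewrite subrr.
  - by exists p.+1 => //; rewrite /B /= JSp hp subrr mulr0.
  - elim: p => [|p IH]; rewrite /B /=.
      rewrite addn0 /J big_nat1; case: (boolP (hit n (om w))) => [hn _|_].
        by exists 0%N; rewrite addn0.
      by rewrite subr0 => /eqP; rewrite oner_eq0.
    rewrite JSp; case: (boolP (hit (n + p.+1) (om w))) => [hn _|_]; first by exists p.+1.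
    by rewrite subr0 mulr1; exact: IH.
rewrite BE; have cB := nondecreasing_cvg_mu mB (bigcupT_measurable _ mB) ndB.
apply: (cvge_to_le (cB _ P)); apply: nearW => p.
change (P (B p) <= (g / e)%:E)%E.
have -> : P (B p) = (\int[P]_w (1 - J (n + p) (om w)))%:E.
  have iJ := i1 (@cJad _ (leq_addr p n)) (cJ_ge0 (n + p)).
  rewrite -Rint_EFin// -(setIT (B p)) -integral_indic//.
  apply: eq_integral => w _; congr EFin; rewrite indicE.
  case: (J01 (n + p) (om w)) => Jw; rewrite Jw ?subrr ?subr0.
    by rewrite memNset//= /B /= Jw => /eqP; rewrite oner_eq0.
  by rewrite mem_set.
by rewrite lee_fin ler_pdivlMr// mulrC; exact: H.
Qed.

Lemma maximal_meas : measurable [set w | exists p, hit (n + p) (om w)].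
Proof.
have -> : [set w | exists p, hit (n + p) (om w)] = \bigcup_p [set w | hit (n + p) (om w)].
  by apply/seteqP; split => w [p]; [exists p|move=> _ ?; exists p].
apply: bigcupT_measurable => p.
have := adapted_meas (@hitad (n + p)) measurableT (measurable_set1 1).
rewrite setTI; congr (measurable _); apply/seteqP; split => w /=.
  by case: (hit _ _) => // /esym/eqP; rewrite oner_eq0.
by move=> ->.
Qed.

End maximal.

Lemma adapted_ge n F (e : R) : adapted n F -> adapted n (fun x => (e <= F x)%R%:R).
Proof. exact: measurable_ler_nat.
Qed.

Let cauchyZ (e g : R) : 0 < e -> 0 < g -> exists n,
  (P [set w | exists p, (e <= `|Z (n + p)%N (om w) - Z n (om w)|)%R] <= g%:E)%E.
Proof.
(* Each one-sided maximal inequality costs [h / e], that is half of [g]. *)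
move=> e0 g0; pose h := e * g / 2.
have h0 : 0 < h by rewrite divr_gt0// mulr_gt0.
have [n sn] := s_cauchy (mulr_gt0 (divr_gt0 h0 (ltr0n R 2)) (divr_gt0 h0 (ltr0n R 2))).
exists n.
pose V m x := Z m x - Z n x.
have Vm m : measurable_fun setT (fun w => V m (om w)).
  by apply: measurable_funB; apply: adapted_meas; exact: Zad.
have Vad m : adapted (maxn n m) (V m).
  by apply: measurable_funB; [apply: (adapted_le (leq_maxr n m))|apply: (adapted_le (leq_maxl n m))]; exact: Zad.
have V_norm m x : `|V m x| <= 1.
  have := Z_gt0 m x; have := Z_gt0 n x; have := Z_le1 m x; have := Z_le1 n x.
  by move=> *; rewrite /V ler_norml; apply/andP; split; lra.
have H p : \int[P]_w `|V (n + p)%N (om w)| <= h.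
  (* The inequality v <= h/2 + v^2/(2h) passes from L2 to L1. The second moment is at most (h/2)^2,
     so the total is h/2 + h/8. *)
  apply: (@le_trans _ _ (\int[P]_w (h / 2 + (2 * h)^-1 * V (n + p)%N (om w) ^+ 2))).
    apply: Rint_le.
    - apply: intg_abs; apply: (@intg_bounded _ _ _ _ _ 1) => // w; exact: V_norm.
    - apply: intgD; first exact: intg_cst.
      apply: intgZ; apply: (@intg_bounded _ _ _ _ _ 1); first exact: measurable_funX.
      by move=> w; rewrite normrX exprn_ile1.
    - move=> w; rewrite -[X in _ + _ * X]real_normK ?num_real//.
      set v := `|V _ _|; rewrite -subr_ge0.
      have -> : h / 2 + (2 * h)^-1 * v ^+ 2 - v = (2 * h)^-1 * (h - v) ^+ 2.
        by field; rewrite gt_eqF.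
      by rewrite mulr_ge0 ?sqr_ge0// invr_ge0 mulr_ge0// ltW.
  have iV2 : intg (fun w => V (n + p)%N (om w) ^+ 2).
    apply: (@intg_bounded _ _ _ _ _ 1); first exact: measurable_funX.
    by move=> w; rewrite normrX exprn_ile1.
  rewrite RintegralD//; [|exact: intg_cst|exact: intgZ].
  rewrite Rint_prob_cst RintegralZl//.
  have /(le_trans (V2 (leq_addr p n))) := sn _ (leq_addr p n).
  move/(ler_wpM2l (_ : 0 <= (2 * h)^-1)) => /(_ _) H.
  have : (2 * h)^-1 * \int[P]_w V (n + p)%N (om w) ^+ 2 <= (2 * h)^-1 * (h / 2 * (h / 2)).
    by apply: H; rewrite invr_ge0 mulr_ge0// ltW.
  have -> : (2 * h)^-1 * (h / 2 * (h / 2)) = h / 8 by field; rewrite gt_eqF.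
  lra.
have hitU : forall m, adapted (maxn n m) (fun x => (e <= V m x)%R%:R).
  by move=> m; apply: adapted_ge; exact: Vad.
have hitL : forall m, adapted (maxn n m) (fun x => (V m x <= - e)%R%:R).
  move=> m; under eq_fun do rewrite lerNr; apply: adapted_ge.
  by apply: measurableT_comp => //; exact: Vad.
have -> : [set w | exists p, e <= `|Z (n + p)%N (om w) - Z n (om w)|] =
    [set w | exists p, e <= V (n + p)%N (om w)] `|` [set w | exists p, V (n + p)%N (om w) <= - e].
  apply/seteqP; split => [w [p]|w [[p hp]|[p hp]]].
  - by rewrite ler_normr => /orP[hp|hp]; [left|right]; exists p => //; rewrite /V lerNr.
  - by exists p; rewrite ler_normr hp.
  - by exists p; rewrite ler_normr lerNr hp orbT.
apply: (le_trans (measureU2 _ _ _)); [exact: (maximal_meas hitU)|exact: (maximal_meas hitL)|].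
have -> : g = h / e + h / e by rewrite /h; field; rewrite gt_eqF.
rewrite EFinD; apply: leeD.
- apply: (maximal_set e0 hitU) => [|p]; first exact: ltW.
  by apply: le_trans (H p); exact: (maximal_upper hitU).
- apply: (maximal_set e0 hitL) => [|p]; first exact: ltW.
  by apply: le_trans (H p); exact: (maximal_lower e0 hitL).
Qed.

(** [Z] converges almost surely by [cauchyZ]. Its limit is not 0, for then [Y] would tend to
    infinity, whereas its lower limit is almost surely finite by Fatou; so [Y = Z^-1 - 1] converges
    too. *)
Lemma martingale_cvg :
  {ae P, forall w, cvgn (fun n => Y n (om w))}.
Proof.
pose B (q n : nat) := [set w | exists p, (q.+1%:R^-1 <= `|Z (n + p)%N (om w) - Z n (om w)|)%R].
have mZ k : measurable_fun setT (fun w => Z k (om w)) by apply: adapted_meas; exact: Zad.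
have mB q n : measurable (B q n).
  have -> : B q n = \bigcup_p [set w | q.+1%:R^-1 <= `|Z (n + p)%N (om w) - Z n (om w)|].
    by apply/seteqP; split => w [p]; [exists p|move=> _ ?; exists p].
  apply: bigcupT_measurable => p.
  rewrite -[X in measurable X]setTI; apply: measurable_fun_le => //.
  by apply: measurableT_comp => //; exact: measurable_funB.
have B0 q : P (\bigcap_n B q n) = 0%E.
  apply/eqP; rewrite eq_le measure_ge0 andbT; apply/lee_addgt0Pr => g g0; rewrite add0e.
  have [n Bn] := @cauchyZ (q.+1%:R^-1) g (ltac:(by rewrite invr_gt0)) g0.
  apply: le_trans Bn; apply: le_measure; rewrite ?inE//.
  - exact: bigcapT_measurable.
  - exact: (mB q n).
  - by move=> w; exact.
have cZ : {ae P, forall w, cvgn (fun n => Z n (om w))}.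
  have : {ae P, forall w, forall q, exists n, ~ B q n w}.
    apply/ae_foralln => q; exists (\bigcap_n B q n); split; [exact: bigcapT_measurable|exact: B0|].
    by move=> w /= /forallNP H n _; exact: contrapT (H n).
  apply: filterS => w H; apply/cauchy_cvgP; apply: cauchy_exP => e e0.
  have [q _ qe] := near_infty_natSinv_lt (PosNum e0).
  have [n nB] := H q; exists (Z n (om w)); exists n => // m /= nm.
  rewrite /ball /= distrC; apply: lt_le_trans (ltW (qe q (leqnn q))).
  by rewrite ltNge; apply/negP => Hm; apply: nB; exists (m - n)%N; rewrite subnKC.
have mY k : measurable_fun setT (fun w => (Y k (om w))%:E).
  by apply/measurable_EFinP; apply: adapted_meas; exact: Yad.
have mlim : measurable_fun setT (fun w => limn_einf (fun n => (Y n (om w))%:E)).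
  exact: measurable_limn_einf.
have lim0 w : (0 <= limn_einf (fun n => (Y n (om w))%:E))%E.
  by apply: limn_einf_ge0 => n; rewrite lee_fin.
have EY n : (\int[P]_w (Y n (om w))%:E = (\int[P]_w Y 0%N (om w))%:E)%E.
  rewrite Rint_EFin//; congr EFin.
  have := @martY 0%N n (fun=> 1) 1 (leq0n n) (@measurable_cst _ _ _ _ _ _) (fun=> _).
  rewrite ler01 lexx => /(_ (fun=> isT)).
  by under eq_Rintegral do rewrite mul1r; under [RHS]eq_Rintegral do rewrite mul1r.
have flim : {ae P, forall w, limn_einf (fun n => (Y n (om w))%:E) \is a fin_num}.
  have ilim : P.-integrable setT (fun w => limn_einf (fun n => (Y n (om w))%:E)).
    apply/integrableP; split => //.
    under eq_integral do rewrite gee0_abs//.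
    apply: (le_lt_trans (fatou _ measurableT mY _)) => [n w _|]; first by rewrite lee_fin.
    rewrite (_ : (fun n => _) = (fun=> (\int[P]_w Y 0%N (om w))%:E)); last by apply/funext.
    by rewrite (cvg_limn_einf (@cvg_cst _ _ _ _ _)) ltry.
  by apply: filterS (integrable_ae measurableT ilim) => w; exact.
apply: filterS2 cZ flim => w cZw; rewrite ge0_fin_numE// => limw.
have [z0|z0] := eqVneq (limn (fun n => Z n (om w))) 0.
  exfalso; move: limw; rewrite (@cvg_limn_einf _ _ +oo%E) ?ltxx//.
  apply/cvgeyPge => A; pose B' := `|A| + 1.
  have B0' : 0 < B' by rewrite ltr_wpDl.
  have : Z n (om w) @[n --> \oo] --> (0 : R) by rewrite -z0.
  move/cvgrPdist_lt/(_ B'^-1 (_ : _)) => /(_ _)[|N _ NP]; first by rewrite invr_gt0.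
  exists N => // n nN; have := NP n nN; rewrite /= sub0r normrN (ger0_norm (ltW (Z_gt0 n (om w)))).
  have Yp : 0 < 1 + `|Y n (om w)| by rewrite ltr_wpDr.
  rewrite /Z (ltf_pV2 Yp B0') ger0_norm// lee_fin /B' addrC ltrD2l => AY.
  by apply: ltW; apply: le_lt_trans AY; exact: ler_norm.
have -> : (fun n => Y n (om w)) = (fun n => (Z n (om w))^-1 - 1).
  by apply/funext => n; rewrite /Z invrK ger0_norm// addrC addKr.
by apply: is_cvgB; [exact: is_cvgV|exact: is_cvg_cst].
Qed.

End martingale.

(** * The cascade acting on a mass *)

Section cascade_sums.
Context {b : nat} {R : realType}.
Local Notation W := (seq (letter b)).
Implicit Types (om a : W -> R) (u v : W).

(** The value of the cascade density on the cylinder of [u] (see [cascade_densityE]). The recursion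
    removes the first letter, so that the environment below it appears as a subtree. *)
Fixpoint weight om u : R :=
  if u is i :: v then om [:: i] * weight (subtree om [:: i]) v else 1.

Lemma weight_cat om u v : weight om (u ++ v) = weight om u * weight (subtree om u) v.
Proof.
elim: u om => [|i u IH] om /=; first by rewrite mul1r.
by rewrite IH mulrA -subtree_cat.
Qed.

Lemma weight_rcons om u i : weight om (rcons u i) = weight om u * om (rcons u i).
Proof. by rewrite -cats1 weight_cat /= mulr1 /subtree. Qed.

Lemma weight_ge0 om u : (forall v, 0 <= om v) -> 0 <= weight om u.
Proof.
move=> om0; elim: u om om0 => [|i u IH] om om0 //=.
by rewrite mulr_ge0// IH// => v; exact: om0.
Qed.

Definition cascade_mass a om n : R :=
  \sum_(u : n.-tuple (letter b)) a u * weight om u.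

Lemma cascade_massS a om n : cascade_mass a om n.+1 =
  \sum_(u : n.-tuple (letter b)) \sum_i a (rcons u i) * (weight om u * om (rcons u i)).
Proof.
rewrite /cascade_mass (sum_tuple_rcons _ (fun u => a u * weight om u)).
by apply: eq_bigr => u _; apply: eq_bigr => i _; rewrite weight_rcons.
Qed.

Lemma cascade_mass_cat a om m n : cascade_mass a om (m + n) =
  \sum_(u : m.-tuple (letter b)) weight om u * cascade_mass (subtree a u) (subtree om u) n.
Proof.
rewrite /cascade_mass (sum_tuple_cat _ _ (fun u => a u * weight om u)).
apply: eq_bigr => u _; rewrite mulr_sumr; apply: eq_bigr => v _.
by rewrite weight_cat mulrCA.
Qed.

Lemma cascade_mass1 a om n : cascade_mass a om n.+1 =
  \sum_i om [:: i] * cascade_mass (subtree a [:: i]) (subtree om [:: i]) n.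
Proof.
rewrite -add1n cascade_mass_cat (sum_tuple1 (fun u => weight om u *
  cascade_mass (subtree a u) (subtree om u) n)).
by apply: eq_bigr => i _; rewrite /= mulr1.
Qed.

Lemma cascade_mass_ge0 a om n : is_mass a -> (forall v, 0 <= om v) -> 0 <= cascade_mass a om n.
Proof.
by move=> am om0; apply: sumr_ge0 => u _; rewrite mulr_ge0 ?am.1 ?weight_ge0.
Qed.

Lemma cascade_mass0 a om : cascade_mass a om 0 = a [::].
Proof. by rewrite /cascade_mass (sum_tuple0 (fun u => a u * weight om u)) mulr1. Qed.

Lemma cascade_mass_sum (I : finType) (a : I -> W -> R) om n :
  cascade_mass (fun u => \sum_i a i u) om n = \sum_i cascade_mass (a i) om n.
Proof.
rewrite /cascade_mass exchange_big /=; apply: eq_bigr => u _.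
by rewrite mulr_suml.
Qed.

Definition nonroot : set W := [set u | u != [::]].
Definition below n : set W := [set u | u != [::] /\ (size u <= n)%N].

Lemma below_le n m : (n <= m)%N -> below n `<=` below m.
Proof. by move=> nm u [u0 un]; split => //; exact: leq_trans nm. Qed.

Lemma below_nonroot n : below n `<=` nonroot.
Proof. by move=> u []. Qed.

Lemma measurable_weight (D : set W) u :
  (forall v, v != [::] -> prefix v u -> D v) ->
  measurable_fun setT (weight^~ u : env R D -> R).
Proof.
elim/last_ind: u => [|u i IH] Du; first exact: measurable_cst.
apply: (eq_measurable_fun (fun om : env R D => weight om u * om (rcons u i))).
  by move=> om _; rewrite weight_rcons.
apply: measurable_funM; last by apply: measurable_coord; apply: Du; rewrite ?prefix_refl//; case: (u).
by apply: IH => v v0 vu; apply: Du => //; apply: prefix_trans vu _; exact: prefix_rcons.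
Qed.

Lemma measurable_cascade_mass a n :
  measurable_fun setT ((fun om => cascade_mass a om n) : env R (below n) -> R).
Proof.
apply: measurable_sum => u; apply: measurable_funM => //.
apply: measurable_weight => v v0 vu; split => //=.
by have /prefixP[s us] := vu; rewrite -(size_tuple u) us size_cat leq_addr.
Qed.

Lemma measurable_subtree (D D' : set W) u : (forall v, D v -> D' (u ++ v)) ->
  measurable_fun setT (fun om : env R D' => subtree om u : env R D).
Proof.
move=> DD'; apply: measurable_to_env => v /DD' Dv.
exact: (measurable_coord Dv).
Qed.

(* A lower limit, hence defined in every environment; almost surely it is a limit. *)
Definition limit_mass a om : \bar R := limn_einf (fun n => (cascade_mass a om n)%:E).

Lemma measurable_limit_mass a :
  measurable_fun setT (limit_mass a : env R nonroot -> \bar R).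
Proof.
apply: measurable_limn_einf => n; apply/measurable_EFinP.
exact: (measurable_env_sub (@below_nonroot n) (@measurable_cascade_mass a n)).
Qed.

Lemma limit_mass_ge0 a om : is_mass a -> (forall v, 0 <= om v) -> (0 <= limit_mass a om)%E.
Proof.
by move=> am om0; apply: limn_einf_ge0 => n; rewrite lee_fin cascade_mass_ge0.
Qed.

End cascade_sums.

Section cascade_family.
Context {b : nat} {R : realType} d0 (T0 : measurableType d0) (P0 : probability T0 R).
Variable X0 : {RV P0 >-> R}.
Local Notation W := (seq (letter b)).

(** Nonnegativity is required at every point and not just almost surely, so that sums and lower
    limits can be handled everywhere. *)
Definition cascade_family d (T : measurableType d) (P : probability T R)
    (X : W -> T -> R) : Prop :=
  [/\ forall u, measurable_fun setT (X u), forall u w, 0 <= X u w,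
      mutually_independent P nonroot X &
      forall u A, u != [::] -> measurable A -> P (X u @^-1` A) = P0 (X0 @^-1` A)].

Lemma cascade_family_subtree d (T : measurableType d) (P : probability T R)
    (X : W -> T -> R) u : cascade_family P X -> cascade_family P (fun v => X (u ++ v)).
Proof.
move=> [mX X_ge0 indX lawX]; split=> //; last first.
  by move=> v A v0 mA; apply: lawX => //; case: (u) v0.
move=> s A us sD mA.
pose A' v := A (drop (size u) v).
have := @indX (map (cat u) s) A'; rewrite map_inj_uniq; last first.
  by move=> v v' /eqP; rewrite eqseq_cat// eqxx => /eqP.
move=> /(_ us); have sub : [set` map (cat u) s] `<=` nonroot.
  by move=> _ /= /mapP[v /sD v0 ->]; rewrite /nonroot /=; case: (u).
move=> /(_ sub (fun=> mA _)); rewrite big_map.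
have -> : \bigcap_(i in [set` map (cat u) s]) X i @^-1` A' i =
    \bigcap_(i in [set` s]) X (u ++ i) @^-1` A i.
  apply/seteqP; split => [w H v /= vs|w H _ /= /mapP[v vs ->]].
    by have := H (u ++ v); rewrite /= map_f// /A' drop_size_cat//; exact.
  by rewrite /A' drop_size_cat//; exact: H.
by move=> ->; apply: eq_bigr => v _; rewrite /A' drop_size_cat.
Qed.

Section family.
Context d (T : measurableType d) (P : probability T R) (X : W -> T -> R).
Hypothesis famX : cascade_family P X.
Local Notation om w := (X^~ w).

Lemma family_meas u : measurable_fun setT (X u). Proof. by case: famX. Qed.

Lemma family_ge0 w u : 0 <= X u w. Proof. by case: famX. Qed.

Lemma family_indep : mutually_independent P nonroot X. Proof. by case: famX. Qed.

Lemma measurable_env_path (D : set W) d' (U : measurableType d') (F : env R D -> U) :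
  measurable_fun setT F -> measurable_fun setT (fun w => F (om w)).
Proof.
move=> mF; apply: (@measurableT_comp _ _ _ _ _ _ F setT (path X D) mF).
by apply: measurable_path; exact: family_meas.
Qed.

Lemma family_integral u (g : R -> \bar R) : u != [::] -> measurable_fun setT g ->
  (forall x, 0 <= g x)%E -> (\int[P]_w g (X u w) = \int[P0]_w g (X0 w))%E.
Proof.
move=> u0 mg g0.
rewrite -(ge0_integral_image P (family_meas u))//.
rewrite -(ge0_integral_image P0 (measurable_funPT X0))//.
apply: eq_measure_integral => A mA _; case: famX => _ _ _ lawX.
exact: lawX.
Qed.

Hypothesis X0_ge0 : forall w, 0 <= X0 w.
Hypothesis X0_mean : ('E_P0[X0] = 1)%E.

Lemma family_mean u : u != [::] -> (\int[P]_w (X u w)%:E = 1)%E.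
Proof.
move=> u0; rewrite -X0_mean unlock.
transitivity (\int[P]_w `|(X u w)%:E|)%E.
  by apply: eq_integral => w _; rewrite gee0_abs// lee_fin family_ge0.
rewrite (family_integral (g := fun x => `|x%:E|%E))//.
  by apply: eq_integral => w _; rewrite gee0_abs// lee_fin.
by apply: measurableT_comp => //; exact: measurable_EFin.
Qed.

Lemma indep_integral (D1 D2 : set W) (F : env R D1 -> \bar R) (G : env R D2 -> \bar R) :
  D1 `<=` nonroot -> D2 `<=` nonroot -> D1 `&` D2 = set0 ->
  measurable_fun setT F -> measurable_fun setT G ->
  (forall w, 0 <= F (om w))%E -> (forall w, 0 <= G (om w))%E ->
  (\int[P]_w (F (om w) * G (om w)) = \int[P]_w F (om w) * \int[P]_w G (om w))%E.
Proof.
move=> D1r D2r D12 mF mG F0 G0.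
exact: (path_indep_integral family_meas family_indep D1r D2r D12 mF mG F0 G0).
Qed.

Lemma integral_mul_new (D : set W) (F : (W -> R) -> R) v : D `<=` nonroot -> v != [::] ->
  ~ D v -> measurable_fun setT (F : env R D -> R) -> (forall w, 0 <= F (om w)) ->
  (\int[P]_w (F (om w) * X v w)%:E = \int[P]_w (F (om w))%:E)%E.
Proof.
move=> Dr v0 nDv mF F0.
have := @indep_integral D [set v] (fun om => (F om)%:E) (fun om => (om v)%:E) Dr.
under eq_integral do rewrite -EFinM.
move=> -> //.
- by rewrite family_mean// mule1.
- by move=> _ ->.
- by apply/seteqP; split => // u [Du /= uv]; apply: nDv; rewrite -uv.
- exact/measurable_EFinP.
- by apply/measurable_EFinP; exact: measurable_coord.
- by move=> w; rewrite lee_fin family_ge0.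
Qed.

Section mass.
Variable a : W -> R.
Hypothesis am : is_mass a.

Lemma mass_path_ge0 n w : 0 <= cascade_mass a (om w) n.
Proof. by apply: cascade_mass_ge0 => // v; exact: family_ge0. Qed.

Lemma measurable_weight_below (u : W) : measurable_fun setT (weight^~ u : env R (below (size u)) -> R).
Proof.
apply: measurable_weight => v v0 /prefixP[s us]; split => //=.
by rewrite us size_cat leq_addr.
Qed.

(** The variables of generation [n.+1] are new and have mean 1, and the children of [u] share out
    [a u]. The computation is in [0, +oo], so that integrability of the masses can be deduced from
    it. *)
Lemma integral_mass_step n (F : (W -> R) -> R) :
  measurable_fun setT (F : env R (below n) -> R) -> (forall w, 0 <= F (om w)) ->
  (\int[P]_w (F (om w) * cascade_mass a (om w) n.+1)%:E =
   \int[P]_w (F (om w) * cascade_mass a (om w) n)%:E)%E.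
Proof.
move=> mF F0.
have F1 (u : n.-tuple (letter b)) :
    measurable_fun setT ((fun om => F om * weight om u) : env R (below n) -> R).
  apply: measurable_funM => //; have := @measurable_weight_below u.
  by rewrite size_tuple.
have F1p (u : n.-tuple (letter b)) : measurable_fun setT (fun w => F (om w) * weight (om w) u).
  apply: measurable_funM; first exact: (measurable_env_path mF).
  exact: (measurable_env_path (@measurable_weight_below u)).
have W0 (u : W) w : 0 <= weight (om w) u by apply: weight_ge0 => v; exact: family_ge0.
have mX u : measurable_fun setT (X u) := family_meas u.
under eq_integral do rewrite cascade_massS mulr_sumr.
rewrite ge0_integral_sumr; last 2 first.
- move=> u; apply: measurable_funM; first exact: (measurable_env_path mF).
  apply: measurable_sum => i; apply: measurable_funM => //; apply: measurable_funM => //.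
  exact: (measurable_env_path (@measurable_weight_below u)).
- move=> u w; apply: mulr_ge0 => //; apply: sumr_ge0 => i _.
  by rewrite mulr_ge0 ?am.1// mulr_ge0// family_ge0.
under [RHS]eq_integral do rewrite /cascade_mass mulr_sumr.
rewrite ge0_integral_sumr; last 2 first.
- move=> u; apply: measurable_funM; first exact: (measurable_env_path mF).
  apply: measurable_funM => //.
  exact: (measurable_env_path (@measurable_weight_below u)).
- by move=> u w; rewrite !mulr_ge0 ?am.1.
apply: eq_bigr => u _.
transitivity (\int[P]_w (\sum_i a (rcons u i) * ((F (om w) * weight (om w) u) * X (rcons u i) w))%:E)%E.
  apply: eq_integral => w _; congr EFin; rewrite mulr_sumr; apply: eq_bigr => i _; ring.
rewrite ge0_integral_sumr; last 2 first.
- by move=> i; apply: measurable_funM => //; apply: measurable_funM.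
- by move=> i w; rewrite !mulr_ge0 ?am.1// family_ge0.
transitivity (\sum_i (a (rcons u i))%:E * \int[P]_w (F (om w) * weight (om w) u)%:E)%E.
  apply: eq_bigr => i _; rewrite ge0_integralZr_EFin ?am.1//; last 2 first.
  - exact: measurable_funM.
  - by move=> w; rewrite !mulr_ge0// family_ge0.
  congr (_ * _)%E.
  apply: (@integral_mul_new (below n) (fun om => F om * weight om u)) => //.
  - exact: below_nonroot.
  - by rewrite -size_eq0 size_rcons.
  - by move=> [_]; rewrite size_rcons size_tuple ltnn.
  - by move=> w; rewrite mulr_ge0.
rewrite -ge0_sume_distrl; last by move=> i _; rewrite lee_fin am.1.
rewrite sumEFin -am.2 -ge0_integralZr_EFin ?am.1//; last by move=> w; rewrite mulr_ge0.
by apply: eq_integral => w _; congr EFin; ring.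
Qed.

Lemma integral_mass n m (F : (W -> R) -> R) : (n <= m)%N ->
  measurable_fun setT (F : env R (below n) -> R) -> (forall w, 0 <= F (om w)) ->
  (\int[P]_w (F (om w) * cascade_mass a (om w) m)%:E =
   \int[P]_w (F (om w) * cascade_mass a (om w) n)%:E)%E.
Proof.
move=> /subnK <- mF F0; elim: (m - n)%N => [//|k IH].
rewrite addSn integral_mass_step//.
by apply: (measurable_env_sub _ mF); apply: below_le; exact: leq_addl.
Qed.

Lemma integral_cascade_mass n : (\int[P]_w (cascade_mass a (om w) n)%:E = (a [::])%:E)%E.
Proof.
have := @integral_mass 0 n (fun=> 1) (leq0n n) (@measurable_cst _ _ _ _ _ _) (fun=> ler01).
under eq_integral do rewrite mul1r.
move=> ->; under eq_integral do rewrite mul1r cascade_mass0.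
by rewrite integral_prob_cst.
Qed.

Lemma measurable_mass_path n : measurable_fun setT (fun w => cascade_mass a (om w) n).
Proof. exact: (measurable_env_path (@measurable_cascade_mass _ _ a n)). Qed.

Lemma intg_cascade_mass n :
  P.-integrable setT (EFin \o (fun w => cascade_mass a (om w) n)).
Proof.
apply/integrableP; split; first by apply/measurable_EFinP; exact: measurable_mass_path.
under eq_integral do rewrite /= ger0_norm ?mass_path_ge0//.
by rewrite integral_cascade_mass ltry.
Qed.

Lemma cascade_mass_cvg : {ae P, forall w, cvgn (cascade_mass a (om w))}.
Proof.
apply: (@martingale_cvg _ _ _ _ P X family_meas below (@below_le b) (fun n om => cascade_mass a om n)).
- by move=> n; exact: measurable_cascade_mass.
- by move=> n w; exact: mass_path_ge0.
- exact: intg_cascade_mass.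
- move=> n m F C nm mF FC.
  have F0 w : 0 <= F (om w) by have /andP[] := FC (om w).
  by rewrite /Rintegral; congr fine; exact: integral_mass.
Qed.

Lemma limit_mass_cvg : {ae P, forall w, limit_mass a (om w) \is a fin_num /\
  cascade_mass a (om w) n @[n --> \oo] --> fine (limit_mass a (om w))}.
Proof.
apply: filterS cascade_mass_cvg => w cw.
have E : limit_mass a (om w) = (limn (cascade_mass a (om w)))%:E.
  by apply: cvg_limn_einf; apply: cvg_EFin; [exact: nearW|exact: cw].
by rewrite E.
Qed.

Lemma measurable_limit_path : measurable_fun setT (fun w => limit_mass a (om w)).
Proof. exact: (measurable_env_path (@measurable_limit_mass _ _ a)). Qed.

Lemma limit_path_ge0 w : (0 <= limit_mass a (om w))%E.
Proof. by apply: limit_mass_ge0 => // v; exact: family_ge0. Qed.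

Definition mean_limit : \bar R := (\int[P]_w limit_mass a (om w))%E.

Lemma mean_limit_le : (mean_limit <= (a [::])%:E)%E.
Proof.
apply: (le_trans (fatou _ measurableT _ _)).
- by move=> n; apply/measurable_EFinP; exact: measurable_mass_path.
- by move=> n w _; rewrite lee_fin mass_path_ge0.
under eq_fun do rewrite integral_cascade_mass.
by rewrite (cvg_limn_einf (@cvg_cst _ _ _ _ _)).
Qed.

End mass.
End family.
End cascade_family.

(** * The limit cascade as a mass on words *)

Section limits.
Context {b : nat} {R : realType}.
Local Notation W := (seq (letter b)).
Implicit Types (a om : W -> R) (u v : W).

(** The event on which Q.a is defined: convergence below all words at once makes the limiting
    cylinder masses additive. *)
Definition good_env a om := forall u,
  limit_mass (subtree a u) (subtree om u) \is a fin_num /\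
  cascade_mass (subtree a u) (subtree om u) n @[n --> \oo]
    --> fine (limit_mass (subtree a u) (subtree om u)).

(** The mass that Q.a gives to the cylinder of [u]: the weight down to [u] times the limit of the
    cascade below [u], which is independent of that weight. *)
Definition limit_of a om u : R := weight om u * fine (limit_mass (subtree a u) (subtree om u)).

Lemma subtree_nil (f : W -> R) : subtree f [::] = f.
Proof. by apply/funext. Qed.

Lemma limit_of_nil a om : limit_of a om [::] = fine (limit_mass a om).
Proof. by rewrite /limit_of /= mul1r !subtree_nil. Qed.

Lemma good_env_subtree a om v : good_env a om -> good_env (subtree a v) (subtree om v).
Proof. by move=> H u; have := H (v ++ u); rewrite !subtree_cat. Qed.

Lemma limit_mass_unique a om (l : R) :
  cascade_mass a om n @[n --> \oo] --> l -> limit_mass a om = l%:E.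
Proof.
by move=> cl; apply: cvg_limn_einf; apply: cvg_EFin => //; exact: nearW.
Qed.

Lemma cvg_limit_of a om u : good_env a om ->
  weight om u * cascade_mass (subtree a u) (subtree om u) n @[n --> \oo] --> limit_of a om u.
Proof. by move=> /(_ u)[_ cu]; apply: cvgM => //; exact: cvg_cst. Qed.

Lemma limit_mass_split a om n : good_env a om ->
  limit_mass a om = (\sum_(u : n.-tuple (letter b)) limit_of a om u)%:E.
Proof.
move=> H; apply: limit_mass_unique; rewrite -(cvg_shiftn n) /=.
have -> : (fun k => cascade_mass a om (k + n)) = (fun k =>
    \sum_(u : n.-tuple (letter b)) weight om u * cascade_mass (subtree a u) (subtree om u) k).
  by apply/funext => k; rewrite addnC cascade_mass_cat.
by apply: cvg_sumr => u; exact: cvg_limit_of.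
Qed.

Lemma limit_of_cat a om u v :
  limit_of a om (u ++ v) = weight om u * limit_of (subtree a u) (subtree om u) v.
Proof. by rewrite /limit_of weight_cat !subtree_cat mulrA. Qed.

Lemma limit_of_ge0 a om u : is_mass a -> (forall v, 0 <= om v) -> 0 <= limit_of a om u.
Proof.
move=> am om0; rewrite mulr_ge0//; first exact: weight_ge0.
apply: fine_ge0; apply: limit_mass_ge0; first exact: is_mass_subtree.
by move=> v; exact: om0.
Qed.

Lemma is_mass_limit_of a om : is_mass a -> (forall v, 0 <= om v) -> good_env a om ->
  is_mass (limit_of a om).
Proof.
move=> am om0 H; split=> [u|u]; first exact: limit_of_ge0.
rewrite {1}/limit_of (limit_mass_split 1); last exact: good_env_subtree.
rewrite /= (sum_tuple1 (limit_of (subtree a u) (subtree om u))) mulr_sumr.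
by apply: eq_bigr => i _; rewrite -cats1 limit_of_cat.
Qed.

Lemma limit_mass_sum (I : finType) (a : I -> W -> R) om :
  (forall i, good_env (a i) om) ->
  limit_mass (fun u => \sum_i a i u) om = (\sum_i limit_mass (a i) om)%E.
Proof.
move=> H.
have Hi i : limit_mass (a i) om \is a fin_num /\
    cascade_mass (a i) om n @[n --> \oo] --> fine (limit_mass (a i) om).
  by have := H i [::]; rewrite !subtree_nil.
under eq_bigr => i _ do rewrite -(fineK (Hi i).1).
rewrite sumEFin; apply: limit_mass_unique.
under eq_fun do rewrite cascade_mass_sum.
by apply: cvg_sumr => i; have [] := Hi i.
Qed.

End limits.

Section mean_limit.
Context {b : nat} {R : realType} d0 (T0 : measurableType d0) (P0 : probability T0 R).
Variable X0 : {RV P0 >-> R}.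
Hypothesis X0_ge0 : forall w, 0 <= X0 w.
Hypothesis X0_mean : ('E_P0[X0] = 1)%E.
Local Notation W := (seq (letter b)).
Context d (T : measurableType d) (P : probability T R) (X : W -> T -> R).
Hypothesis famX : cascade_family X0 P X.
Local Notation om w := (X^~ w).
Implicit Types (a : W -> R) (u : W).

Lemma good_env_ae a : is_mass a -> {ae P, forall w, good_env a (om w)}.
Proof.
move=> am; apply: ae_forall_count => u.
exact: (limit_mass_cvg (cascade_family_subtree u famX) X0_ge0 X0_mean (is_mass_subtree u am)).
Qed.

Lemma integral_subtree u (G : env R nonroot -> \bar R) : measurable_fun setT G ->
  (forall x : W -> R, (forall v, 0 <= x v) -> (0 <= G x)%E) ->
  (\int[P]_w G (subtree (om w) u) = \int[P]_w G (om w))%E.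
Proof.
move=> mG G0; have famXu := cascade_family_subtree u famX.
apply: (path_same_integral (family_meas famXu) (family_meas famX) (family_indep famXu)
   (family_indep famX) _ mG).
- move=> v A v0 mA; transitivity (P0 (X0 @^-1` A)).
    by case: famXu => _ _ _; exact.
  by case: famX => _ _ _ H; rewrite H.
- by move=> w; apply: G0 => v; exact: (family_ge0 famXu).
- by move=> w; apply: G0 => v; exact: (family_ge0 famX).
Qed.

Lemma integral_mul_subtree u (D : set W) (F : env R D -> \bar R) (G : env R nonroot -> \bar R) :
  D `<=` nonroot -> (forall v, v != [::] -> ~ D (u ++ v)) ->
  measurable_fun setT F -> measurable_fun setT G ->
  (forall w, 0 <= F (om w))%E -> (forall x : W -> R, (forall v, 0 <= x v) -> (0 <= G x)%E) ->
  (\int[P]_w (F (om w) * G (subtree (om w) u)) = \int[P]_w F (om w) * \int[P]_w G (om w))%E.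
Proof.
move=> Dr Du mF mG F0 G0.
pose D2 : set W := [set v | exists v', v' != [::] /\ v = u ++ v'].
have mG' : measurable_fun setT ((fun om => G (subtree om u)) : env R D2 -> \bar R).
  apply: (@measurableT_comp _ _ _ _ _ _ G setT
     (fun om : env R D2 => subtree om u : env R nonroot)) => //.
  by apply: measurable_subtree => v v0; exists v.
rewrite (indep_integral famX (D1 := D) (D2 := D2) _ _ _ mF mG')//.
- by rewrite integral_subtree.
- by move=> _ [v' [v0 ->]]; rewrite /nonroot /= -size_eq0 size_cat addn_eq0 negb_and orbC size_eq0 v0.
- by apply/seteqP; split => // v [Dv [v' [v0 vE]]]; apply: (Du v') => //; rewrite -vE.
- by move=> w; apply: G0 => v; exact: (family_ge0 famX).
Qed.

(** The mean of [limit_of a] at [u]: the factor [weight] has mean 1 and is independent of the limit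
    below [u], hence its absence. *)
Definition ell a u : R := fine (mean_limit P X (subtree a u)).

Lemma mean_limit_ge0 a : is_mass a -> (0 <= mean_limit P X a)%E.
Proof. by move=> am; apply: integral_ge0 => w _; exact: (limit_path_ge0 famX am). Qed.

Lemma mean_limit_fin a : is_mass a -> mean_limit P X a \is a fin_num.
Proof.
move=> am; rewrite ge0_fin_numE ?mean_limit_ge0//.
by apply: le_lt_trans (mean_limit_le famX X0_ge0 X0_mean am) _; exact: ltry.
Qed.

Lemma ellE a u : is_mass a -> mean_limit P X (subtree a u) = (ell a u)%:E.
Proof. by move=> am; rewrite fineK// mean_limit_fin//; exact: is_mass_subtree. Qed.

Lemma ell_ge0 a u : is_mass a -> 0 <= ell a u.
Proof. by move=> am; apply: fine_ge0; apply: mean_limit_ge0; exact: is_mass_subtree. Qed.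

Lemma ell_le a u : is_mass a -> ell a u <= a u.
Proof.
move=> am; rewrite -lee_fin -ellE// -[u in a u]cats0.
exact: (mean_limit_le famX X0_ge0 X0_mean (is_mass_subtree u am)).
Qed.

(** Conditioning on the first [n] generations in integrated form: split the limit at generation [n]
    and use that the cascades below are independent of it. *)
Lemma integral_mul_limit a n (F : (W -> R) -> R) : is_mass a ->
  measurable_fun setT (F : env R (below n) -> R) -> (forall w, 0 <= F (om w)) ->
  (\int[P]_w ((F (om w))%:E * limit_mass a (om w)) =
   \sum_(u : n.-tuple (letter b)) \int[P]_w (F (om w) * weight (om w) u)%:E * (ell a u)%:E)%E.
Proof.
move=> am mF F0.
transitivity (\int[P]_w (\sum_(u : n.-tuple (letter b))
    (F (om w) * weight (om w) u)%:E * limit_mass (subtree a u) (subtree (om w) u)))%E.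
  apply: ae_eq_integral => //.
  - apply: emeasurable_funM; last exact: (measurable_limit_path famX a).
    by apply/measurable_EFinP; exact: (measurable_env_path famX mF).
  - apply: emeasurable_sum => u; apply: emeasurable_funM.
      apply/measurable_EFinP; apply: measurable_funM; first exact: (measurable_env_path famX mF).
      exact: (measurable_env_path famX (@measurable_weight_below _ _ u)).
    exact: (measurable_limit_path (cascade_family_subtree u famX) (subtree a u)).
  - apply: filterS (good_env_ae am) => w H _.
    rewrite (limit_mass_split n H) -EFinM mulr_sumr -sumEFin.
    apply: eq_bigr => u _; rewrite /limit_of mulrA EFinM; congr (_ * _)%E.
    by rewrite fineK//; have [] := H u.
have W0 (u : W) w : 0 <= weight (om w) u by apply: weight_ge0 => v; exact: (family_ge0 famX).
have mFW (u : n.-tuple (letter b)) :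
    measurable_fun setT ((fun om => F om * weight om u) : env R (below n) -> R).
  apply: measurable_funM => //; have := @measurable_weight_below b R u.
  by rewrite size_tuple.
have L0 u w : (0 <= limit_mass (subtree a u) (subtree (om w) u))%E.
  exact: (limit_path_ge0 (cascade_family_subtree u famX) (is_mass_subtree u am)).
rewrite ge0_integral_sum//; last 2 first.
- move=> u; apply: emeasurable_funM.
    apply/measurable_EFinP; exact: (measurable_env_path famX (mFW u)).
  exact: (measurable_limit_path (cascade_family_subtree u famX) (subtree a u)).
- by move=> u w _; rewrite mule_ge0// lee_fin mulr_ge0.
apply: eq_bigr => u _.
have au := is_mass_subtree u am.
rewrite (integral_mul_subtree (D := below n) (F := fun om => (F om * weight om u)%:E)
  (G := limit_mass (subtree a u)))//.
- by rewrite -ellE.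
- exact: below_nonroot.
- move=> v v0 [_]; rewrite size_cat size_tuple -{2}[n]addn0 leq_add2l leqn0 size_eq0.
  by rewrite (negbTE v0).
- exact/measurable_EFinP.
- exact: measurable_limit_mass.
- by move=> w; rewrite lee_fin mulr_ge0.
- by move=> x x0; exact: limit_mass_ge0.
Qed.

Lemma is_mass_ell a : is_mass a -> is_mass (ell a).
Proof.
move=> am; split=> [u|u]; first exact: ell_ge0.
apply: EFin_inj; rewrite -ellE//.
have amu := is_mass_subtree u am.
have := @integral_mul_limit (subtree a u) 1 (fun=> 1) amu (@measurable_cst _ _ _ _ _ _) (fun=> ler01).
under eq_integral do rewrite mul1e.
rewrite /mean_limit => ->; rewrite (sum_tuple1 (fun v =>
  \int[P]_w (1 * weight (om w) v)%:E * (ell (subtree a u) v)%:E)%E) -sumEFin.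
apply: eq_bigr => i _.
under eq_integral do rewrite mul1r /= mulr1.
rewrite (family_mean famX)// mul1e; congr EFin.
by rewrite /ell -subtree_cat cats1.
Qed.

Lemma ell_sum (I : finType) (a : I -> W -> R) u : (forall i, is_mass (a i)) ->
  ell (fun v => \sum_i a i v) u = \sum_i ell (a i) u.
Proof.
move=> am; apply: EFin_inj.
have aum i : is_mass (subtree (a i) u) by exact: is_mass_subtree.
rewrite -ellE; last exact: is_mass_sumr.
rewrite -sumEFin; under [RHS]eq_bigr do rewrite -ellE//.
rewrite /mean_limit -ge0_integral_sum//; last 2 first.
- by move=> i; exact: (measurable_limit_path famX).
- by move=> i w _; exact: (limit_path_ge0 famX).
apply: ae_eq_integral => //.
- exact: (measurable_limit_path famX).
- by apply: emeasurable_sum => i; exact: (measurable_limit_path famX).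
have : {ae P, forall w, forall i, good_env (subtree (a i) u) (om w)}.
  by apply: ae_forall_count => i; exact: good_env_ae.
apply: filterS => w H _.
by rewrite -limit_mass_sum.
Qed.

End mean_limit.

(** * The shift and ergodic measures *)

Section birkhoff.
Context {b : nat} {R : realType}.
Local Notation fmeasure := {finite_measure set (seq_space b) -> \bar R}.
Implicit Types (x : seq_space b) (F f : seq_space b -> R).

Lemma cylinder_cons (i : letter b) u x :
  cylinder (i :: u) x <-> x 0%N = i /\ cylinder u (shift x).
Proof.
by rewrite /cylinder /= restr_cons; split => [[-> ->]|[-> ->]].
Qed.

Lemma shift_preimage_cylinder u :
  @shift b @^-1` cylinder u = \big[setU/set0]_(i < b.-1.+1) cylinder ((i : letter b) :: u).
Proof.
rewrite -bigcup_seq; apply/seteqP; split => [x xu|x [i _] /cylinder_cons[]//].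
by exists (x 0%N); [rewrite /= mem_index_enum|exact/cylinder_cons].
Qed.

Lemma measurable_shift : measurable_fun setT (@shift b).
Proof.
apply: (measurability _ measurable_cylinders) => _ [A [[u _ <-]|->] <-]; last first.
  by rewrite preimage_set0 setI0; exact: measurable0.
rewrite setTI shift_preimage_cylinder; apply: bigsetU_measurable => i _.
exact: measurable_cylinder.
Qed.

Definition invariant (M : fmeasure) := forall A, measurable A ->
  M (@shift b @^-1` A) = M A.

Lemma mass_of_shift (M : fmeasure) u :
  M (@shift b @^-1` cylinder u) = (\sum_(i : letter b) mass_of M (i :: u))%:E.
Proof.
rewrite shift_preimage_cylinder measure_bigsetU_ord//.
- by rewrite -sumEFin; apply: eq_bigr => i _; exact: mass_ofE.
- by move=> i; exact: measurable_cylinder.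
- apply/trivIsetP => i j _ _ ij; apply/seteqP; split => // x [].
  by move=> /cylinder_cons[xi _] /cylinder_cons[xj _]; move/eqP: ij; apply; rewrite -xi.
Qed.

Lemma invariant_mass (M : fmeasure) : invariant M ->
  forall u, mass_of M u = \sum_(i : letter b) mass_of M (i :: u).
Proof.
move=> Minv u; apply: EFin_inj; rewrite -mass_of_shift Minv ?mass_ofE//.
exact: measurable_cylinder.
Qed.

Lemma mass_invariant (M : fmeasure) :
  (forall u, mass_of M u = \sum_(i : letter b) mass_of M (i :: u)) -> invariant M.
Proof.
move=> MS A mA.
apply: (@eq_measure_cylinder b R (image_measure M measurable_shift) M) => // u.
by rewrite /= /image_measure /pushforward mass_of_shift -MS mass_ofE.
Qed.

Section sums.
Variables (F : seq_space b -> R) (C : R).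
Hypothesis mF : measurable_fun setT F.
Hypothesis FC : forall x, `|F x| <= C.

Fixpoint birkhoff_sum n x : R :=
  if n is n'.+1 then F x + birkhoff_sum n' (shift x) else 0.

(** The maximum of the Birkhoff sums of orders 0 to [n], in the recursive form that Garsia's
    argument uses. *)
Fixpoint birkhoff_max n x : R :=
  if n is n'.+1 then Num.max 0 (F x + birkhoff_max n' (shift x)) else 0.

Let S := birkhoff_sum.
Let M := birkhoff_max.

Let mS n : measurable_fun setT (S n).
Proof.
elim: n => [|n IH] /=; first exact: measurable_cst.
by apply: measurable_funD => //; apply: measurableT_comp => //; exact: measurable_shift.
Qed.

Let mM n : measurable_fun setT (M n).
Proof.
elim: n => [|n IH] /=; first exact: measurable_cst.
apply: measurable_maxr => //; apply: measurable_funD => //.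
by apply: measurableT_comp => //; exact: measurable_shift.
Qed.

Let C0 : 0 <= C. Proof. exact: le_trans (FC (fun=> ord0)). Qed.

Let M0 n x : 0 <= M n x.
Proof. by case: n => [|n] //=; rewrite le_max lexx. Qed.

Let SM n x : S n x <= M n x.
Proof.
elim: n x => [|n IH] x //=; rewrite le_max; apply/orP; right.
by rewrite lerD2l; exact: IH.
Qed.

Let MS n x : M n x <= M n.+1 x.
Proof.
elim: n x => [|n IH] x /=; first by rewrite le_max lexx.
by rewrite ge_max le_max lexx /= le_max lerD2l [X in _ || X]IH orbT.
Qed.

Let M_nd m n x : (m <= n)%N -> M m x <= M n x.
Proof. by move=> /subnK <-; elim: (n - m)%N => // k IH; apply: le_trans IH _; exact: MS. Qed.

Let MC n x : `|M n x| <= n%:R * C.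
Proof.
rewrite ger0_norm//; elim: n x => [|n IH] x /=; first by rewrite mul0r.
rewrite ge_max mulr_ge0//= -natr1 mulrDl mul1r addrC lerD//.
exact: le_trans (ler_norm _) (FC x).
Qed.

Let SC n x : `|S n x| <= n%:R * C.
Proof.
elim: n x => [|n IH] x /=; first by rewrite normr0 mul0r.
by rewrite (le_trans (ler_normD _ _))// -natr1 mulrDl mul1r addrC lerD.
Qed.

Variable mu : fmeasure.
Hypothesis mu_inv : invariant mu.

Local Notation intg f := (mu.-integrable [set: seq_space b] (EFin \o f)).

Lemma invariant_Rint f D : measurable_fun setT f -> (forall x, `|f x| <= D) ->
  \int[mu]_x f (shift x) = \int[mu]_x f x.
Proof.
move=> mf fD.
have D0 : 0 <= D by exact: le_trans (fD (fun=> ord0)).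
have if1 : intg f by exact: (@intg_bounded _ _ _ _ _ D).
have mfs : measurable_fun setT (f \o @shift b).
  by apply: measurableT_comp => //; exact: measurable_shift.
have if2 : intg (fun x => f (shift x)) by exact: (@intg_bounded _ _ _ _ _ D).
have ic : intg (fun=> D) by exact: intg_cst.
(* Adding the bound [D] makes the integrand nonnegative, as the image formula demands. *)
apply: (addIr (\int[mu]_x D)); rewrite -!RintegralD//.
rewrite /Rintegral; congr fine.
have g0 x : (0 <= (f x + D)%:E)%E.
  by rewrite lee_fin -lerBlDr sub0r; have := fD x; rewrite ler_norml => /andP[].
have mg : measurable_fun setT (fun x => (f x + D)%:E).
  by apply/measurable_EFinP; exact: measurable_funD.
rewrite -(ge0_integral_image mu measurable_shift mg g0).
by apply: eq_measure_integral => A mA _; exact: mu_inv.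
Qed.

Lemma Rint_birkhoff_sum n : \int[mu]_x S n x = n%:R * \int[mu]_x F x.
Proof.
have iF : intg F by exact: (@intg_bounded _ _ _ mu _ C).
elim: n => [|n IH] /=; first by rewrite Rint_cst1 !mul0r.
have iS : intg (S n) by exact: (@intg_bounded _ _ _ mu _ (n%:R * C)).
have iSs : intg (fun x => S n (shift x)).
  apply: (@intg_bounded _ _ _ _ _ (n%:R * C)) => //.
  by apply: measurableT_comp => //; exact: measurable_shift.
by rewrite RintegralD// (@invariant_Rint (S n) (n%:R * C))// IH -natr1 mulrDl mul1r addrC.
Qed.

(** The positive parts of the averages of [S] tend to 0 boundedly, while each average has the
    integral of [F]. Ergodicity is not assumed, so this applies to any invariant measure below an
    ergodic one. *)
Lemma birkhoff_le0 : {ae mu, forall x, exists K, forall n, S n x <= K} ->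
  \int[mu]_x F x <= 0.
Proof.
move=> H; pose g n x := Num.max 0 (S n.+1 x) / n.+1%:R.
have mg n : measurable_fun setT (g n).
  by apply: measurable_funM => //; apply: measurable_maxr.
have gC n x : `|g n x| <= C.
  rewrite /g normrM normfV normr_nat ler_pdivrMr// mulrC.
  rewrite ger0_norm ?le_max ?lexx// ge_max; apply/andP; split; first exact: mulr_ge0.
  exact: le_trans (ler_norm _) (SC _ _).
have cg : \int[mu]_x g n x @[n --> \oo] --> \int[mu]_x (0 : R).
  apply: (@Rint_DCT _ _ _ mu g (fun=> 0) (fun=> C)) => //; first exact: intg_cst.
  apply: filterS H => x [K SK]; pose K' := Num.max 0 K.
  have K0 : 0 <= K' by rewrite le_max lexx.
  apply: (@squeeze_cvgr _ _ _ R (fun=> 0) (fun n => K' / n.+1%:R) (g^~ x)).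
  - apply: nearW => n; rewrite /g divr_ge0 ?le_max ?lexx// ler_pM2r ?invr_gt0//.
    by rewrite ge_max K0 /K' le_max SK orbT.
  - exact: cvg_cst.
  - by rewrite -[X in _ --> X](mulr0 K'); apply: cvgM; [exact: cvg_cst|exact: cvg_harmonic].
rewrite Rint_cst1 mul0r in cg.
apply: (ler_cvg_to_const cg) => n.
have E : \int[mu]_x F x = \int[mu]_x (n.+1%:R^-1 * S n.+1 x).
  rewrite RintegralZl//; last by exact: (@intg_bounded _ _ _ mu _ (n.+1%:R * C) (@mS n.+1) (SC n.+1)).
  by rewrite Rint_birkhoff_sum mulrA mulVf ?mul1r.
rewrite E; apply: Rint_le.
- by apply: intgZ; exact: (@intg_bounded _ _ _ mu _ (n.+1%:R * C) (@mS n.+1) (SC n.+1)).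
- exact: (@intg_bounded _ _ _ mu _ C).
- by move=> x; rewrite /g mulrC ler_pM2r ?invr_gt0// le_max lexx orbT.
Qed.

Let mFM n : measurable_fun setT (fun x => F x * (0 < M n x)%R%:R).
Proof.
by apply: measurable_funM => //; exact: measurable_ltr_nat.
Qed.

Let FMC n x : `|F x * (0 < M n x)%R%:R| <= C.
Proof. by case: (0 < M n x); rewrite ?mulr1// mulr0 normr0; exact: C0. Qed.

(* Garsia's argument for the maximal ergodic inequality. *)
Let maximal n : 0 <= \int[mu]_x (F x * (0 < M n x)%R%:R).
Proof.
have [->|/prednK <-] := posnP n.
  by apply: Rintegral_ge0 => x _ /=; rewrite ltxx mulr0.
move: n.-1 => {}n.
have iM : intg (M n.+1) by exact: (@intg_bounded _ _ _ mu _ (n.+1%:R * C)).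
have mMs : measurable_fun setT (fun x => M n.+1 (shift x)).
  by apply: measurableT_comp => //; exact: measurable_shift.
have iMs : intg (fun x => M n.+1 (shift x)) by exact: (@intg_bounded _ _ _ mu _ (n.+1%:R * C)).
rewrite -[leLHS](subrr (\int[mu]_x M n.+1 x)) -{2}(@invariant_Rint (M n.+1) (n.+1%:R * C))//.
rewrite -RintegralB//; apply: Rint_le; first exact: intgB.
- exact: (@intg_bounded _ _ _ mu _ C (@mFM n.+1) (FMC n.+1)).
- move=> x; have [M1|M1] := ltP 0 (M n.+1 x); last first.
    by rewrite mulr0 subr_le0 (le_trans M1).
  have h : F x + M n (shift x) <= F x + M n.+1 (shift x) by rewrite lerD2l MS.
  rewrite mulr1 lerBlDr; move: M1; rewrite {1 2}/M /= lt_max ltxx /= => M1.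
  by rewrite ge_max h andbT (le_trans _ h)// ltW.
Qed.

(** The set where the maxima are unbounded is invariant because [F] is bounded. If it had full
    measure, the positivity sets in Garsia's inequality would fill the space and force the integral
    of [F] to be nonnegative. *)
Lemma birkhoff_bounded : (forall A, measurable A -> @shift b @^-1` A = A ->
    mu A = 0%E \/ mu A = mu setT) ->
  \int[mu]_x F x < 0 -> {ae mu, forall x, exists K, forall n, S n x <= K}.
Proof.
move=> erg F0.
pose A := [set x | forall K : nat, exists n, K%:R <= M n x].
have mA : measurable A.
  have -> : A = \bigcap_(K : nat) \bigcup_n [set x | K%:R <= M n x].
    by apply/seteqP; split => [x Ax K _|x Ax K]; have [] := Ax K => // n; exists n.
  apply: bigcapT_measurable => K; apply: bigcupT_measurable => n.
  by rewrite -[X in measurable X]setTI; apply: measurable_fun_le.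
have iA : @shift b @^-1` A = A.
  (* One step of the shift changes a Birkhoff sum by at most [N], so level [K + N] on one side gives
     level [K] on the other. *)
  have [N CN] : exists N : nat, C <= N%:R.
    exists (Num.truncn C).+1; exact/ltW/truncnS_gt.
  apply/seteqP; split => x Ax K.
  - have [n Kn] := Ax (K + N)%N; exists n.+1; rewrite /M /= le_max; apply/orP; right.
    have := FC x; rewrite ler_norml => /andP[Fl _].
    by move: Kn; rewrite natrD /M; move: CN Fl; lra.
  - have [n] := Ax (K + N)%N; case: n => [|n].
      rewrite /M /= natrD => Kn; exists 0%N; rewrite /M /=.
      by have := ler0n R N; have := ler0n R K; lra.
    move=> Kn; exists n; move: Kn; rewrite /M /= le_max => /orP[Kn|].
      apply: (le_trans _ (M0 n _)); move: Kn; rewrite natrD.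
      by have := ler0n R N; lra.
    by rewrite natrD; have := le_trans (ler_norm _) (FC x); rewrite -/M; lra.
have [A0|A1] := erg A mA iA.
  exists A; split => // x /= H; rewrite /A /= => K.
  apply: contrapT => /forallNP HK; apply: H; exists K%:R => n.
  by apply: le_trans (SM n x) _; rewrite ltW// ltNge; apply/negP; exact: HK.
exfalso; move: F0; apply/negP; rewrite -leNgt.
have aeA : {ae mu, forall x, A x}.
  exists (~` A); split; [exact: measurableC| |by []].
  have muT : (mu setT < +oo)%E by rewrite fin_num_fun_lty//; exact: fin_num_measure.
  have E : mu (setT `\` A) = (mu setT - mu (setT `&` A))%E by exact: measureD.
  rewrite -setTD E setTI A1 subee//.
  by apply: fin_num_measure.
have cM : \int[mu]_x (F x * (0 < M n x)%R%:R) @[n --> \oo] --> \int[mu]_x F x.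
  apply: (@Rint_DCT _ _ _ mu _ _ (fun=> C)) => //.
  - exact: intg_cst.
  apply: filterS aeA => x Ax; have [n Kn] := Ax 1%N.
  apply: cvg_near_cst; exists n => // m /= nm.
  rewrite (lt_le_trans _ (le_trans Kn (M_nd x nm))) ?mulr1//.
by apply: (ler_cvg_to_const cM) => n; exact: maximal.
Qed.

Lemma birkhoff_lln (e : R) : (forall A, measurable A -> @shift b @^-1` A = A ->
    mu A = 0%E \/ mu A = mu setT) ->
  \int[mu]_x F x < 0 -> 0 < e ->
  \int[mu]_x (n%:R * e <= S n x)%R%:R @[n --> \oo] --> (0 : R).
Proof.
move=> erg F0 e0.
have -> : (0 : R) = \int[mu]_x 0 by rewrite Rint_cst1 mul0r.
apply: (@Rint_DCT _ _ _ mu _ _ (fun=> 1)) => //.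
- by move=> n; exact: measurable_ler_nat.
- exact: intg_cst.
- by move=> n x; case: (n%:R * e <= S n x)%R; rewrite ?normr1 ?normr0.
apply: filterS (birkhoff_bounded erg F0) => x [K SK].
have [N KN] : exists N : nat, K / e < N%:R.
  by exists (Num.truncn (K / e)).+1; exact: truncnS_gt.
apply: cvg_near_cst; exists N => // n /= Nn; rewrite leNgt (le_lt_trans (SK n))//.
by rewrite -ltr_pdivrMr// (lt_le_trans KN)// ler_nat.
Qed.

End sums.
End birkhoff.

(** * Extremality of ergodic measures *)

Section extremal.
Context {b : nat} {R : realType}.
Variable nu : ergodic_measure b R.
Local Notation W := (seq (letter b)).

Lemma mass_of_nil_prob : mass_of nu [::] = 1.
Proof.
rewrite /mass_of cylinder_nil; transitivity (fine (erg_prob nu setT)) => //.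
by rewrite probability_setT.
Qed.

Lemma ergodic_invariant : invariant nu.
Proof. by move=> A mA; exact: erg_invariant. Qed.

Lemma ergodic_zero_total A : measurable A -> @shift b @^-1` A = A ->
  nu A = 0%E \/ nu A = nu setT.
Proof.
have nu1 : nu setT = 1%E by exact: probability_setT.
by rewrite nu1; exact: erg_ergodic.
Qed.

Let eqw (u w : W) : R := (w == u)%:R.

Lemma Rint_eqw (M : {finite_measure set (seq_space b) -> \bar R}) u :
  \int[M]_x eqw u (restr x (size u)) = mass_of M u.
Proof.
rewrite Rint_restr (bigD1 (in_tuple u))//= /eqw eqxx mul1r big1 ?addr0// => v vu.
case: eqP => [vE|]; last by rewrite mul0r.
by move/eqP : vu => []; apply/val_inj.
Qed.

(** Write c for the total mass of [m]. If m(u) < c nu(u), choose t strictly between m(u)/c and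
    nu(u). Then t - 1_[u] has negative nu-mean, so its Birkhoff sums are bounded above nu-almost
    everywhere, hence almost everywhere for the measure of [m], and [birkhoff_le0] gives t c <=
    m(u), a contradiction. So [m] dominates c nu, and equal totals force equality. *)
Lemma ergodic_extremal (m : W -> R) : is_mass m -> (forall u, m u <= mass_of nu u) ->
  (forall u, m u = \sum_(i : letter b) m (i :: u)) ->
  forall u, m u = m [::] * mass_of nu u.
Proof.
move=> mm mnu minv.
have nm := is_mass_of nu.
have [M ME] := mass_extension mm.
have dm : is_mass (fun u => mass_of nu u - m u).
  split=> u; first by rewrite subr_ge0.
  by rewrite nm.2 mm.2 -sumrB.
have [M' ME'] := mass_extension dm.
have [N NE] := measure_sum_finite M M'.
have Mnu A : measurable A -> (M A <= nu A)%E.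
  move=> mA; rewrite -(@eq_measure_cylinder b R N nu) => [| |//]; first by rewrite NE leeDl.
  by move=> u; rewrite NE ME ME' -EFinD addrC subrK mass_ofE.
have MmE u : mass_of M u = m u by rewrite /mass_of ME.
have Minv : invariant M.
  by apply: mass_invariant => u; rewrite MmE minv; apply: eq_bigr => i _; rewrite MmE.
have ge u : m [::] * mass_of nu u <= m u.
  rewrite leNgt; apply/negP => lt.
  have c0 : 0 < m [::].
    rewrite lt_neqAle mm.1 andbT; apply/eqP => c0; move: lt.
    by rewrite -c0 mul0r ltNge mm.1.
  pose t := (m u / m [::] + mass_of nu u) / 2.
  have tlt : m u / m [::] < mass_of nu u by rewrite ltr_pdivrMr// mulrC.
  pose F (x : seq_space b) := t - eqw u (restr x (size u)).
  have mF : measurable_fun setT F.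
    by apply: measurable_funB => //; exact: (measurable_restr _ (eqw u)).
  have FC x : `|F x| <= `|t| + 1.
    rewrite (le_trans (ler_normB _ _))// lerD2l /eqw.
    by case: (_ == _); rewrite ?normr1 ?normr0.
  have RF (K : {finite_measure set (seq_space b) -> \bar R}) :
      \int[K]_x F x = t * mass_of K [::] - mass_of K u.
    rewrite RintegralB//; [|exact: intg_cst|exact: (intg_restr _ _ (eqw u))].
    by rewrite Rint_cst1 Rint_eqw.
  have Fnu : \int[nu]_x F x < 0.
    by rewrite RF mass_of_nil_prob mulr1 subr_lt0 /t; lra.
  have bd := birkhoff_bounded mF FC ergodic_invariant ergodic_zero_total Fnu.
  have bdM : {ae M, forall x, exists K, forall n, birkhoff_sum F n x <= K}.
    have [A [mA A0 sA]] := bd; exists A; split => //.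
    by apply/eqP; rewrite eq_le measure_ge0 andbT -A0; exact: Mnu.
  have := birkhoff_le0 mF FC Minv bdM.
  rewrite RF !MmE subr_le0 => tm.
  have : m u / m [::] < t by rewrite /t; lra.
  by rewrite ltr_pdivrMr// ltNge tm.
move=> u; have H : \sum_(v : (size u).-tuple (letter b)) (m v - m [::] * mass_of nu v) = 0.
  rewrite sumrB -mulr_sumr -!mass_sum0//.
  by rewrite mass_of_nil_prob mulr1 subrr.
have Hv (v : (size u).-tuple (letter b)) : true -> 0 <= m v - m [::] * mass_of nu v.
  by rewrite subr_ge0.
by have /eqP := psumr_eq0P Hv H (i := in_tuple u) isT; rewrite subr_eq0 => /eqP.
Qed.

End extremal.

(** * The zero-one law for the cascade of an ergodic measure *)

Section zero_one.
Context {b : nat} {R : realType} d0 (T0 : measurableType d0) (P0 : probability T0 R).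
Variable X0 : {RV P0 >-> R}.
Hypothesis X0_ge0 : forall w, 0 <= X0 w.
Hypothesis X0_mean : ('E_P0[X0] = 1)%E.
Local Notation W := (seq (letter b)).
Context d (T : measurableType d) (P : probability T R) (X : W -> T -> R).
Hypothesis famX : cascade_family X0 P X.
Local Notation om w := (X^~ w).
Variable nu : ergodic_measure b R.
Local Notation a := (mass_of nu).

Let am : is_mass a. Proof. exact: is_mass_of. Qed.

(* [ell] is an invariant mass below [a], so ergodicity makes it a multiple of [a]. *)
Lemma ell_ergodic u : ell P X a u = ell P X a [::] * a u.
Proof.
apply: ergodic_extremal.
- exact: (is_mass_ell X0_ge0 X0_mean famX am).
- by move=> v; exact: (ell_le X0_ge0 X0_mean famX _ am).
- move=> v.
  have E : a = (fun w => \sum_i subtree a [:: i] w).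
    by apply/funext => w; rewrite (invariant_mass (@ergodic_invariant _ _ nu)).
  rewrite {1}E (ell_sum X0_ge0 X0_mean famX); last by move=> i; exact: is_mass_subtree.
  by apply: eq_bigr => i _; rewrite /ell -subtree_cat.
Qed.

Lemma zero_one_law : {ae P, forall w, limit_mass a (om w) = 0%E} \/
  forall u, ell P X a u = a u.
Proof.
set c := ell P X a [::].
have [c1|c1] := eqVneq c 1; first by right => u; rewrite ell_ergodic -/c c1 mul1r.
left.
(* Both psi(y) and y psi(y) are bounded by 1 on y >= 0; the second bound lets psi(Y_n) Y_n converge
   in mean although Y_n itself may not. *)
pose psi (y : R) := (1 + `|y|)^-1.
have psi_gt0 y : 0 < psi y by rewrite invr_gt0 ltr_wpDr.
have psi_ge0 y : 0 <= psi y by rewrite ltW.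
have psi_le1 y : psi y <= 1 by rewrite invf_le1 ?lerDl// ltr_wpDr.
have cpsi : continuous psi.
  move=> y; apply: cvgV; first by rewrite gt_eqF// ltr_wpDr.
  by apply: cvgD; [exact: cvg_cst|apply: cvg_norm].
have mpsi : measurable_fun setT psi by exact: continuous_measurable_fun.
pose Y n w := cascade_mass a (om w) n.
pose L w := fine (limit_mass a (om w)).
have Y0 n w : 0 <= Y n w by exact: (mass_path_ge0 famX am).
have mY n : measurable_fun setT (Y n) by exact: (measurable_mass_path famX a n).
have mL : measurable_fun setT L.
  by apply: measurableT_comp => //; exact: (measurable_limit_path famX a).
have L0 w : 0 <= L w by apply: fine_ge0; exact: (limit_path_ge0 famX am).
have aeL : {ae P, forall w, limit_mass a (om w) = (L w)%:E}.
  apply: filterS (limit_mass_cvg famX X0_ge0 X0_mean am) => w [fin _].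
  by rewrite /L fineK.
have iL : P.-integrable setT (EFin \o L).
  apply/integrableP; split; first exact/measurable_EFinP.
  apply: (@le_lt_trans _ _ (mean_limit P X a)); last first.
    by apply: le_lt_trans (mean_limit_le famX X0_ge0 X0_mean am) _; exact: ltry.
  rewrite le_eqVlt; apply/orP; left; apply/eqP; apply: ae_eq_integral => //.
  - by apply: measurableT_comp => //; exact/measurable_EFinP.
  - exact: (measurable_limit_path famX a).
  - by apply: filterS aeL => w -> _; rewrite /= ger0_norm.
have psiy y : 0 <= y -> `|psi y * y| <= 1.
  move=> y0; rewrite ger0_norm ?mulr_ge0// mulrC /psi (ger0_norm y0).
  by rewrite ler_pdivrMr ?mul1r ?lerDr// ltr_wpDr.
have ipsiY n : P.-integrable setT (EFin \o (fun w => psi (Y n w) * Y n w)).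
  apply: (@intg_bounded _ _ _ P _ 1) => [|w]; last exact: psiy.
  by apply: measurable_funM => //; exact: measurableT_comp.
(* [psi (Y n)] depends on the first [n] generations only, and given these the limit has mean
   [c * Y n]. Both sides then converge, to an integral I and to c I; as c differs from 1, I is 0. *)
have key n : \int[P]_w (psi (Y n w) * L w) = c * \int[P]_w (psi (Y n w) * Y n w).
  have mF : measurable_fun setT ((fun om => psi (cascade_mass a om n)) : env R (below n) -> R).
    apply: (@measurableT_comp _ _ _ _ _ _ psi setT) => //.
    exact: measurable_cascade_mass.
  have mpsiY : measurable_fun setT (fun w => psi (Y n w)) by exact: measurableT_comp.
  have W0 (u : W) w : 0 <= weight (om w) u by apply: weight_ge0 => v; exact: (family_ge0 famX).
  have mpW (u : W) : measurable_fun setT (fun w => psi (Y n w) * weight (om w) u).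
    apply: measurable_funM => //.
    exact: (measurable_env_path famX (@measurable_weight_below _ _ u)).
  have := integral_mul_limit X0_ge0 X0_mean famX am mF (fun w => ltW (psi_gt0 _)).
  under eq_bigr do rewrite ell_ergodic -/c.
  rewrite (_ : (\int[P]_w _)%E = \int[P]_w (psi (Y n w) * L w)%:E)%E; last first.
    apply: ae_eq_integral => //.
    - apply: emeasurable_funM; first exact/measurable_EFinP.
      exact: (measurable_limit_path famX a).
    - by apply/measurable_EFinP; exact: measurable_funM.
    - by apply: filterS aeL => w -> _; rewrite EFinM.
  rewrite (_ : \sum_u _ = c%:E * \int[P]_w (psi (Y n w) * Y n w)%:E)%E; last first.
    under [in RHS]eq_integral do rewrite /Y /cascade_mass mulr_sumr.
    rewrite ge0_integral_sumr; last 2 first.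
    - move=> u; apply: (eq_measurable_fun (fun w => a u * (psi (Y n w) * weight (om w) u))).
        by move=> w _; rewrite mulrCA.
      exact: measurable_funM.
    - by move=> u w; rewrite !mulr_ge0 ?am.1.
    rewrite ge0_sume_distrr; last first.
      by move=> u _; apply: integral_ge0 => w _; rewrite lee_fin !mulr_ge0 ?am.1.
    apply: eq_bigr => u _; rewrite EFinM muleCA; congr (_ * _)%E.
    rewrite muleC -ge0_integralZr_EFin ?am.1//; last by move=> w; rewrite mulr_ge0.
    by apply: eq_integral => w _; congr EFin; rewrite mulrCA.
  rewrite /Rintegral => ->; rewrite fineM//.
  exact: (integrable_fin_num measurableT (ipsiY n)).
have cY : {ae P, forall w, Y n w @[n --> \oo] --> L w}.
  by apply: filterS (limit_mass_cvg famX X0_ge0 X0_mean am) => w [].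
have c1' : \int[P]_w (psi (Y n w) * L w) @[n --> \oo] --> \int[P]_w (psi (L w) * L w).
  apply: (@Rint_DCT _ _ _ P _ _ L) => //.
  - by move=> n; apply: measurable_funM => //; exact: measurableT_comp.
  - by apply: measurable_funM => //; exact: measurableT_comp.
  - by move=> n w; rewrite ger0_norm ?mulr_ge0// ler_piMl.
  - by apply: filterS cY => w cw; apply: cvgM; [exact: (cvg_comp _ _ cw (cpsi _))|exact: cvg_cst].
have c2' : c * \int[P]_w (psi (Y n w) * Y n w) @[n --> \oo] --> c * \int[P]_w (psi (L w) * L w).
  apply: cvgM; first exact: cvg_cst.
  apply: (@Rint_DCT _ _ _ P _ _ (fun=> 1)) => //.
  - by move=> n; apply: measurable_funM => //; exact: measurableT_comp.
  - by apply: measurable_funM => //; exact: measurableT_comp.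
  - exact: intg_cst.
  - by move=> n w; exact: psiy.
  - by apply: filterS cY => w cw; apply: cvgM => //; exact: (cvg_comp _ _ cw (cpsi _)).
have E : \int[P]_w (psi (L w) * L w) = c * \int[P]_w (psi (L w) * L w).
  apply: (@cvg_unique R _ _ _ _ _ _ c2'); first exact: Rhausdorff.
  by move: c1'; under eq_fun do rewrite key.
have E0 : \int[P]_w (psi (L w) * L w) = 0.
  by apply/eqP; move/eqP: E; rewrite -subr_eq0 -{1}[X in X - _]mul1r -mulrBl mulf_eq0 subr_eq0 eq_sym (negbTE c1).
have ipsi : P.-integrable setT (EFin \o (fun w => psi (L w) * L w)).
  apply: (@intg_bounded _ _ _ P _ 1) => [|w]; last exact: psiy.
  by apply: measurable_funM => //; exact: measurableT_comp.
have mpL : measurable_fun setT (EFin \o (fun w => psi (L w) * L w)) by case/integrableP: ipsi.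
have : (\int[P]_w `|(psi (L w) * L w)%:E| = 0)%E.
  under eq_integral => w _ do rewrite gee0_abs ?lee_fin ?mulr_ge0//.
  by rewrite Rint_EFin// E0.
move/(ae_eq_integral_abs _ measurableT mpL).
apply: filterS2 aeL => w -> /(_ I) /= [/eqP].
by rewrite mulf_eq0 gt_eqF//= => /eqP ->.
Qed.

End zero_one.

(** * Entropy *)

Section log_inequalities.
Context {R : realType}.
Implicit Types (x y z p s t : R).

Lemma ln_le_subr1 x : 0 < x -> ln x <= x - 1.
Proof.
move=> x0; have := @le_ln1Dx R (x - 1).
by rewrite subrKC; apply; rewrite ltrBrDl subrr.
Qed.

(** The log-sum inequality before summation: over pieces (z, s) with totals (Z, S), the terms
    [s * Z / S - z] add up to 0. *)
Lemma ln_ratio_le z s Z S : 0 <= z -> z <= s -> z <= Z -> s <= S ->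
  z * (ln s - ln z) <= z * (ln S - ln Z) + s * Z / S - z.
Proof.
rewrite le_eqVlt => /predU1P[<-|z0] zs zZ sS.
  by rewrite !mul0r add0r subr0 divr_ge0 ?mulr_ge0// (le_trans zs).
have s0 : 0 < s by exact: lt_le_trans zs.
have Z0 : 0 < Z by exact: lt_le_trans zZ.
have S0 : 0 < S by exact: lt_le_trans sS.
have := @ln_le_subr1 (s * Z / (z * S)).
have -> : ln (s * Z / (z * S)) = (ln s - ln z) - (ln S - ln Z).
  rewrite ln_div ?posrE ?mulr_gt0//; rewrite !lnM ?posrE//; ring.
rewrite divr_gt0 ?mulr_gt0// => /(_ isT) H.
have := ler_wpM2l (ltW z0) H.
have -> : z * (s * Z / (z * S) - 1) = s * Z / S - z.
  by field; rewrite !gt_eqF.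
lra.
Qed.

End log_inequalities.

Section fekete.
Context {R : realType}.
Variable H : nat -> R.
Hypothesis H0 : forall n, 0 <= H n.
Hypothesis Hsub : forall m n, H (m + n) <= H m + H n.

Let Hmul k q : H (q * k) <= q%:R * H k + H 0.
Proof.
elim: q => [|q IH]; first by rewrite mul0n mul0r add0r.
rewrite mulSn (le_trans (Hsub _ _))// -natr1 mulrDl mul1r.
by move: IH; lra.
Qed.

(** Fekete's lemma: the limit is the infimum over k > 0. Writing n = q k + r, the remainder and the
    value [H 0], which may be positive, are absorbed by the constant [B]. *)
Lemma fekete : cvgn (fun n => n%:R^-1 * H n).
Proof.
pose u n := n%:R^-1 * H n.
pose L := inf [set u k | k in [set k | (0 < k)%N]].
have hinf : has_inf [set u k | k in [set k | (0 < k)%N]].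
  split; first by exists (u 1%N), 1%N.
  by exists 0 => _ [k _ <-]; rewrite /u mulr_ge0// invr_ge0.
apply/cvg_ex; exists L; apply/cvgrPdist_le => e e0.
have e20 : 0 < e / 2 by rewrite divr_gt0.
have [_ [k k0 <-] uk] := inf_adherent e20 hinf.
pose B := \sum_(r < k) H r + H 0.
have B0 : 0 <= B by rewrite addr_ge0// sumr_ge0.
have HB r : (r < k)%N -> H 0 + H r <= B.
  by move=> rk; rewrite addrC lerD2r (bigD1 (Ordinal rk))//= lerDl sumr_ge0.
have [N BN] : exists N : nat, B / (e / 2) < N%:R.
  by exists (Num.truncn (B / (e / 2))).+1; exact: truncnS_gt.
exists N.+1 => // n /= Nn.
have n0 : 0 < n%:R :> R by rewrite ltr0n (leq_trans _ Nn).
have Lu : L <= u n by apply: ge_inf hinf.2 _ _; exists n => //=; exact: leq_trans Nn.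
rewrite distrC ger0_norm ?subr_ge0// lerBlDl.
have k0' : 0 < k%:R :> R by rewrite ltr0n.
have Hn : H n <= n%:R * (L + e / 2) + B.
  rewrite {1}(divn_eq n k) (le_trans (Hsub _ _))//.
  apply: (@le_trans _ _ ((n %/ k)%:R * H k + (H 0 + H (n %% k)))).
    by rewrite addrA lerD2r; exact: Hmul.
  apply: lerD; last by apply: HB; rewrite ltn_mod.
  have -> : (n %/ k)%:R * H k = (n %/ k * k)%:R * u k.
    by rewrite /u natrM; field; rewrite gt_eqF.
  apply: ler_pM => //; first by rewrite mulr_ge0// invr_ge0.
    by rewrite ler_nat leq_trunc_div.
  exact: ltW.
rewrite /u mulrC ler_pdivrMr//; apply: le_trans Hn _.
rewrite (_ : (L + e) * n%:R = n%:R * (L + e / 2) + n%:R * (e / 2)); last by field.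
rewrite lerD2l mulrC -ler_pdivrMl// mulrC (le_trans (ltW BN))// ler_nat.
exact: ltnW.
Qed.

End fekete.

Section entropy.
Context {b : nat} {R : realType}.
Variable nu : ergodic_measure b R.
Local Notation W := (seq (letter b)).
Local Notation a := (mass_of nu).

Definition block_entropy (c : W -> R) n : R :=
  \sum_(u : n.-tuple (letter b)) - (c u * ln (c u)).

Lemma sum_mass_prefix m v : \sum_(u : m.-tuple (letter b)) a (u ++ v) = a v.
Proof.
elim: m => [|m IH]; first by rewrite (sum_tuple0 (fun u => a (u ++ v))).
rewrite (sum_tuple_cons _ (fun u => a (u ++ v))) exchange_big /= -{}IH.
apply: eq_bigr => u _.
by rewrite [RHS](invariant_mass (@ergodic_invariant _ _ nu)).
Qed.

Let am : is_mass a. Proof. exact: is_mass_of. Qed.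

Lemma mass_le1 u : a u <= 1.
Proof. by rewrite -(mass_of_nil_prob nu); exact: mass_le0. Qed.

Lemma block_entropy_ge0 n : 0 <= block_entropy a n.
Proof.
apply: sumr_ge0 => u _; rewrite oppr_ge0 mulr_ge0_le0 ?am.1//.
by apply: ln_le0; exact: mass_le1.
Qed.

Lemma block_entropyD m n : block_entropy a (m + n) <= block_entropy a m + block_entropy a n.
Proof.
have E : block_entropy a m + block_entropy a n =
    \sum_(u : m.-tuple (letter b)) \sum_(v : n.-tuple (letter b))
      - (a (u ++ v) * (ln (a u) + ln (a v))).
  have -> : block_entropy a m = \sum_(u : m.-tuple (letter b)) \sum_(v : n.-tuple (letter b))
      - (a (u ++ v) * ln (a u)).
    apply: eq_bigr => u _; rewrite {1}(mass_sum u n am) mulr_suml sumrN//.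
  have -> : block_entropy a n = \sum_(u : m.-tuple (letter b)) \sum_(v : n.-tuple (letter b))
      - (a (u ++ v) * ln (a v)).
    rewrite exchange_big /=; apply: eq_bigr => v _.
    by rewrite -{1}(sum_mass_prefix m v) mulr_suml sumrN.
  rewrite -big_split; apply: eq_bigr => u _; rewrite -big_split; apply: eq_bigr => v _ /=.
  by ring.
rewrite E /block_entropy (sum_tuple_cat _ _ (fun u => - (a u * ln (a u)))) -subr_ge0 -sumrB.
(* Each pair (u, v) contributes at least a(uv) - a(u) a(v) to the defect of subadditivity, by
   [ln_ratio_le] with S = 1. *)
have F : 0 = \sum_(u : m.-tuple (letter b)) \sum_(v : n.-tuple (letter b)) (a (u ++ v) - a u * a v).
  under eq_bigr do rewrite sumrB -mass_sum// -mulr_sumr -mass_sum0//.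
  by rewrite mass_of_nil_prob; under eq_bigr do rewrite mulr1 subrr; rewrite big1.
rewrite [leLHS]F; apply: ler_sum => u _; rewrite -sumrB; apply: ler_sum => v _.
have auv : a (u ++ v) <= a u by exact: mass_leq.
have avu : a (u ++ v) <= a v.
  rewrite -[leRHS](sum_mass_prefix m v) (bigD1 u)//= lerDl.
  by apply: sumr_ge0 => i _; exact: am.1.
have := ln_ratio_le (am.1 (u ++ v)) avu auv (mass_le1 v).
rewrite ln1 divr1; lra.
Qed.

Lemma entropy_cvg : n%:R^-1 * block_entropy a n @[n --> \oo] --> entropy nu.
Proof. exact: (fekete block_entropy_ge0 block_entropyD). Qed.

Lemma entropy_lt_block (q : R) : entropy nu < q ->
  exists2 k, (0 < k)%N & block_entropy a k < k%:R * q.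
Proof.
move=> hq; have /cvgrPdist_lt/(_ (q - entropy nu)) := entropy_cvg.
rewrite subr_gt0 hq => /(_ isT)[N _ NP].
exists N.+1 => //; have := NP N.+1 (leqnSn N).
rewrite /= distrC => /(le_lt_trans (ler_norm _)); rewrite ltrD2r.
by rewrite ltr_pdivrMl.
Qed.

Lemma entropy_le_block (h : R) (r : nat -> R) :
  (forall n, block_entropy a n <= n%:R * h + \sum_(0 <= k < n) r k) ->
  r n @[n --> \oo] --> 0 -> entropy nu <= h.
Proof.
move=> H r0.
have c1 : n.+1%:R^-1 * block_entropy a n.+1 @[n --> \oo] --> entropy nu.
  have := entropy_cvg; rewrite -(cvg_shiftn 1) /=.
  by under eq_fun do rewrite addn1.
have c2 : h + arithmetic_mean r n @[n --> \oo] --> h + 0.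
  by apply: cvgD; [exact: cvg_cst|exact: cesaro].
rewrite addr0 in c2; apply: (ler_cvg_to c1 c2); apply: nearW => n.
rewrite ler_pdivrMl// (le_trans (H _))// mulrDr lerD2l /arithmetic_mean /=.
by rewrite /series /= mulrA mulfV ?mul1r.
Qed.

End entropy.

(** * Entropy of the cascade masses along the tree *)

Section entropy_functionals.
Context {b : nat} {R : realType}.
Local Notation W := (seq (letter b)).
Implicit Types (a om : W -> R) (x y z s t : R).

Lemma mul_lnM x y : 0 <= x -> 0 <= y ->
  x * y * ln (x * y) = x * (y * ln y) + y * (x * ln x).
Proof.
rewrite le_eqVlt => /predU1P[<- _|x0]; first by rewrite !mul0r mulr0 addr0.
rewrite le_eqVlt => /predU1P[<-|y0]; first by rewrite !(mulr0, mul0r) addr0.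
by rewrite lnM ?posrE//; ring.
Qed.

Lemma mul_ln_ge t : 0 <= t -> t - 1 <= t * ln t.
Proof.
rewrite le_eqVlt => /predU1P[<-|t0]; first by rewrite mul0r sub0r oppr_le0.
have tV : 0 < t^-1 by rewrite invr_gt0.
have := ler_wpM2l (ltW t0) (ln_le_subr1 tV).
by rewrite lnV ?posrE// mulrN mulrBr mulfV ?gt_eqF// mulr1; lra.
Qed.

(** With p = z/s this is s times -p ln p: the share of a part [z] in the unnormalised entropy of a
    splitting of [s]. *)
Definition kappa z s := z * (ln s - ln z).

Lemma kappa_ge0 z s : 0 <= z -> z <= s -> 0 <= kappa z s.
Proof.
rewrite le_eqVlt => /predU1P[<- _|z0 zs]; first by rewrite /kappa mul0r.
apply: mulr_ge0; first exact: ltW.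
by rewrite subr_ge0 ler_ln ?posrE//; exact: lt_le_trans zs.
Qed.

(** [kappa z (1 + z)]: bounded by 1 and vanishing as z tends to 0, hence fit for dominated
    convergence. *)
Definition beta z := z * (ln (1 + z) - ln z).

(* A tangent line in [s], so that the correction is linear in [s - z]; in the application [z] and
   [s - z] are independent. *)
Lemma kappa_beta z s : 0 <= z -> z <= s ->
  kappa z s + z / (1 + z) <= beta z + z / (1 + z) * (s - z).
Proof.
move=> z0 zs.
have s0 : 0 <= s by exact: le_trans zs.
have z1 : 0 < 1 + z by rewrite ltr_wpDr.
have [->|zn0] := eqVneq z 0; first by rewrite /kappa /beta !mul0r !addr0.
have zp : 0 < z by rewrite lt_neqAle eq_sym zn0.
have sp : 0 < s by exact: lt_le_trans zs.
have := @ln_le_subr1 _ (s / (1 + z)); rewrite divr_gt0// => /(_ isT).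
rewrite ln_div ?posrE// => H.
have := ler_wpM2l z0 H.
have -> : z * (s / (1 + z) - 1) = z / (1 + z) * (s - z) - z / (1 + z).
  by field; rewrite gt_eqF.
by rewrite /kappa /beta; lra.
Qed.

Lemma beta_ge0 z : 0 <= z -> 0 <= beta z.
Proof. by move=> z0; apply: kappa_ge0 => //; rewrite lerDr. Qed.

Lemma beta_le1 z : 0 <= z -> beta z <= 1.
Proof.
rewrite le_eqVlt => /predU1P[<-|z0]; first by rewrite /beta mul0r.
have z1 : 0 < 1 + z by rewrite ltr_wpDr// ltW.
have := @ln_le_subr1 _ ((1 + z) / z); rewrite divr_gt0// => /(_ isT).
rewrite ln_div ?posrE// => /(ler_wpM2l (ltW z0)) H.
apply: le_trans H _; rewrite mulrBr mulr1 mulrCA mulfV ?gt_eqF// mulr1.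
by rewrite addrK.
Qed.

(** An explicit bound that vanishes at 0, from ln x = 2 ln(sqrt x) and ln y <= y - 1. *)
Lemma beta_sqrt z : 0 <= z -> beta z <= 2 * Num.sqrt (z * (1 + z)).
Proof.
rewrite le_eqVlt => /predU1P[<-|z0]; first by rewrite /beta !mul0r sqrtr0 mulr0.
have z1 : 0 < 1 + z by rewrite ltr_wpDr// ltW.
have r0 : 0 < (1 + z) / z by rewrite divr_gt0.
have sr0 : 0 < Num.sqrt ((1 + z) / z) by rewrite sqrtr_gt0.
rewrite /beta -ln_div ?posrE//.
have -> : ln ((1 + z) / z) = 2 * ln (Num.sqrt ((1 + z) / z)).
  by rewrite -{1}(sqr_sqrtr (ltW r0)) lnXn// mulr_natl.
rewrite mulrCA ler_pM2l//.
have -> : Num.sqrt (z * (1 + z)) = z * Num.sqrt ((1 + z) / z).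
  rewrite (_ : z * (1 + z) = z ^+ 2 * ((1 + z) / z)); last by field; rewrite gt_eqF.
  by rewrite sqrtrM ?sqr_ge0// sqrtr_sqr gtr0_norm.
rewrite ler_pM2l//; apply: le_trans (ln_le_subr1 sr0) _.
by rewrite gerBl.
Qed.

Definition branch a om m (i : letter b) : R :=
  om [:: i] * cascade_mass (subtree a [:: i]) (subtree om [:: i]) m.

(* The unnormalised entropy of the first letter under the cascade measure of generation [m.+1]. *)
Definition split_info a om m : R :=
  \sum_i kappa (branch a om m i) (cascade_mass a om m.+1).

(** The chain rule: [split_info] summed over the words of length below [n], each weighted and taken
    with the generations that remain below it. *)
Fixpoint total_info n a om : R :=
  if n is n'.+1 then split_info a om n' +
    \sum_i om [:: i] * total_info n' (subtree a [:: i]) (subtree om [:: i])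
  else 0.

Section deterministic.
Variable om : W -> R.
Hypothesis om0 : forall v, 0 <= om v.

Lemma branch_ge0 a m i : is_mass a -> 0 <= branch a om m i.
Proof.
move=> am; rewrite mulr_ge0// cascade_mass_ge0//; first exact: is_mass_subtree.
by move=> v; exact: om0.
Qed.

Lemma branch_le a m i : is_mass a -> branch a om m i <= cascade_mass a om m.+1.
Proof.
move=> am; rewrite cascade_mass1 (bigD1 i)//= lerDl sumr_ge0// => j _.
exact: branch_ge0.
Qed.

Lemma split_info_ge0 a m : is_mass a -> 0 <= split_info a om m.
Proof.
by move=> am; apply: sumr_ge0 => i _; apply: kappa_ge0; [exact: branch_ge0|exact: branch_le].
Qed.

(** Concavity of entropy: [ln_ratio_le] summed over the components, letter by letter. *)
Lemma split_info_super (I : finType) (a : I -> W -> R) m : (forall j, is_mass (a j)) ->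
  \sum_j split_info (a j) om m <= split_info (fun u => \sum_j a j u) om m.
Proof.
move=> am; rewrite /split_info exchange_big /=; apply: ler_sum => i _.
set Z := branch _ om m i; set S := cascade_mass _ om m.+1.
have ZE : Z = \sum_j branch (a j) om m i.
  by rewrite /Z /branch -mulr_sumr -cascade_mass_sum.
have SE : S = \sum_j cascade_mass (a j) om m.+1 by rewrite /S cascade_mass_sum.
have H j : kappa (branch (a j) om m i) (cascade_mass (a j) om m.+1) <=
    branch (a j) om m i * (ln S - ln Z) +
    cascade_mass (a j) om m.+1 * Z / S - branch (a j) om m i.
  apply: ln_ratio_le; [exact: branch_ge0|exact: branch_le| |].
    by rewrite ZE (bigD1 j)//= lerDl sumr_ge0// => k _; exact: branch_ge0.
  by rewrite SE (bigD1 j)//= lerDl sumr_ge0// => k _; exact: cascade_mass_ge0.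
apply: le_trans (ler_sum _ (fun j _ => H j)) _.
rewrite sumrB big_split /= -!mulr_suml -ZE -SE.
have [S0|S0] := eqVneq S 0.
  rewrite /kappa (_ : Z = 0) ?mulr0 ?mul0r ?subr0 ?addr0//.
  apply/eqP; rewrite eq_le; apply/andP; split.
    rewrite -S0 ZE SE; apply: ler_sum => j _; exact: branch_le.
  by rewrite ZE sumr_ge0// => j _; exact: branch_ge0.
by rewrite (_ : S * Z / S = Z) ?addrK//; field.
Qed.

End deterministic.

Lemma total_info_ge0 om n a : (forall v, 0 <= om v) -> is_mass a -> 0 <= total_info n a om.
Proof.
elim: n om a => [|n IH] om a om0 am //=.
rewrite addr_ge0 ?split_info_ge0// sumr_ge0// => i _; rewrite mulr_ge0// IH//.
  by move=> v; exact: om0.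
exact: is_mass_subtree.
Qed.

Lemma total_info_super om (I : finType) (a : I -> W -> R) n : (forall v, 0 <= om v) ->
  (forall j, is_mass (a j)) ->
  \sum_j total_info n (a j) om <= total_info n (fun u => \sum_j a j u) om.
Proof.
elim: n om a => [|n IH] om a om0 am /=; first by rewrite big1.
rewrite big_split /=; apply: lerD; first exact: split_info_super.
rewrite exchange_big /=; apply: ler_sum => i _; rewrite -mulr_sumr ler_wpM2l//.
apply: IH; first by move=> v; exact: om0.
by move=> j; exact: is_mass_subtree.
Qed.

Lemma sum_mul_ln om a n : (forall v, 0 <= om v) -> is_mass a ->
  \sum_(u : n.-tuple (letter b)) (a u * weight om u) * ln (a u * weight om u) =
  cascade_mass a om n * ln (cascade_mass a om n) - total_info n a om.
Proof.
elim: n om a => [|n IH] om a om0 am.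
  rewrite (sum_tuple0 (fun u => (a u * weight om u) * ln (a u * weight om u))) /=.
  by rewrite cascade_mass0 mulr1 subr0.
rewrite (sum_tuple_cons _ (fun u => (a u * weight om u) * ln (a u * weight om u))).
have om0' i v : 0 <= subtree om [:: i] v by exact: om0.
have E i : \sum_(u : n.-tuple (letter b))
    (a (i :: u) * weight om (i :: u)) * ln (a (i :: u) * weight om (i :: u)) =
    branch a om n i * ln (branch a om n i) -
    om [:: i] * total_info n (subtree a [:: i]) (subtree om [:: i]).
  pose q (u : W) := subtree a [:: i] u * weight (subtree om [:: i]) u.
  transitivity (\sum_(u : n.-tuple (letter b)) (om [:: i] * (q u * ln (q u)) +
      q u * (om [:: i] * ln (om [:: i])))).
    apply: eq_bigr => u _; rewrite -mul_lnM//; last by rewrite mulr_ge0 ?am.1 ?weight_ge0.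
    by rewrite /q /subtree /= mulrCA.
  rewrite big_split /= -mulr_sumr -mulr_suml IH//; last exact: is_mass_subtree.
  rewrite -/(cascade_mass _ _ _) /branch mul_lnM//; first by ring.
  by apply: cascade_mass_ge0 => //; exact: is_mass_subtree.
under eq_bigr do rewrite E; rewrite sumrB /= opprD addrA; congr (_ - _).
rewrite /split_info /kappa.
under [in RHS]eq_bigr do rewrite mulrBr.
by rewrite sumrB -mulr_suml -cascade_mass1 opprB addrC subrK.
Qed.

(** The ones make every term nonnegative, so that the inequality can be integrated term by term in
    [0, +oo]. *)
Lemma sum_mul_ln_ge om a n : (forall v, 0 <= om v) -> is_mass a ->
  \sum_(u : n.-tuple (letter b)) 1 + cascade_mass a om n <=
  \sum_(u : n.-tuple (letter b)) (1 + (a u * weight om u) * ln (a u * weight om u)) +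
  (1 + total_info n a om).
Proof.
move=> om0 am; rewrite big_split /= sum_mul_ln//.
by have := mul_ln_ge (cascade_mass_ge0 n am om0); lra.
Qed.

End entropy_functionals.

Section entropy_bound.
Context {b : nat} {R : realType} d0 (T0 : measurableType d0) (P0 : probability T0 R).
Variable X0 : {RV P0 >-> R}.
Hypothesis X0_ge0 : forall w, 0 <= X0 w.
Hypothesis X0_mean : ('E_P0[X0] = 1)%E.
Local Notation W := (seq (letter b)).
Context d (T : measurableType d) (P : probability T R) (X : W -> T -> R).
Hypothesis famX : cascade_family X0 P X.
Local Notation om w := (X^~ w).
Variable h : R.
Hypothesis hX : (\int[P0]_w (1 + X0 w * ln (X0 w))%:E = (1 + h)%:E)%E.
Implicit Types (a : W -> R) (u v : W).

Let W0 u w : 0 <= weight (om w) u.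
Proof. by apply: weight_ge0 => v; exact: (family_ge0 famX). Qed.

Let mW u : measurable_fun setT (fun w => weight (om w) u).
Proof. exact: (measurable_env_path famX (@measurable_weight_below _ _ u)). Qed.

Let mX v : measurable_fun setT (X v). Proof. exact: (family_meas famX). Qed.

Let mg : measurable_fun setT (fun t : R => 1 + t * ln t).
Proof. by apply: measurable_funD => //; apply: measurable_funM => //; exact: measurable_ln. Qed.

Let g_ge0 (t : R) : 0 <= t -> 0 <= 1 + t * ln t.
Proof. by move=> t0; have := mul_ln_ge t0; lra. Qed.

Lemma integral_weight u : (\int[P]_w (weight (om w) u)%:E = 1)%E.
Proof.
elim/last_ind: u => [|u i IH]; first by rewrite integral_prob_cst.
under eq_integral do rewrite weight_rcons.
rewrite (integral_mul_new famX X0_ge0 X0_mean (D := below (size u)) (F := weight^~ u))//.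
- exact: below_nonroot.
- by rewrite -size_eq0 size_rcons.
- by move=> [_]; rewrite size_rcons ltnn.
- exact: (@measurable_weight_below b R u).
Qed.

Let integral_g_X v : v != [::] -> (\int[P]_w (1 + X v w * ln (X v w))%:E = (1 + h)%:E)%E.
Proof.
move=> v0; rewrite -hX.
have E d' (T' : measurableType d') (P' : probability T' R) (f : T' -> R) : (forall w, 0 <= f w) ->
    (\int[P']_w (1 + f w * ln (f w))%:E = \int[P']_w `|(1 + f w * ln (f w))%:E|)%E.
  by move=> f0; apply: eq_integral => w _; rewrite gee0_abs// lee_fin g_ge0.
rewrite (E _ _ P (X v)); last by move=> w; exact: (family_ge0 famX).
rewrite (E _ _ P0 X0)//.
rewrite (family_integral famX (g := fun t => `|(1 + t * ln t)%:E|%E) v0)//.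
by apply: measurableT_comp => //; exact/measurable_EFinP.
Qed.

Lemma integral_weight_ln u :
  (\int[P]_w (1 + weight (om w) u * ln (weight (om w) u))%:E = (1 + (size u)%:R * h)%:E)%E.
Proof.
elim/last_ind: u => [|u i IH].
  under eq_integral do rewrite /= ln1 mulr0 addr0.
  by rewrite integral_prob_cst /= mul0r addr0.
set v := rcons u i; have v0 : v != [::] by rewrite -size_eq0 size_rcons.
pose g (t : R) := 1 + t * ln t.
have mgw : measurable_fun setT (fun w => g (weight (om w) u)) by exact: measurableT_comp.
have mgx : measurable_fun setT (fun w => g (X v w)) by exact: measurableT_comp.
have mgv : measurable_fun setT (fun w => g (weight (om w) v)).
  by apply: (@measurableT_comp _ _ _ _ _ _ g setT).
have gw0 w : 0 <= g (weight (om w) u) by exact: g_ge0.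
have gx0 w : 0 <= g (X v w) by apply: g_ge0; exact: (family_ge0 famX).
have gv0 w : 0 <= g (weight (om w) v) by exact: g_ge0.
have Xv0 w : 0 <= X v w by exact: (family_ge0 famX).
have nbv : ~ below (size u) v by move=> [_]; rewrite size_rcons ltnn.
have mb : measurable_fun setT (weight^~ u : env R (below (size u)) -> R).
  exact: (@measurable_weight_below b R u).
have E1 : (\int[P]_w (g (weight (om w) u) * X v w)%:E = (1 + (size u)%:R * h)%:E)%E.
  rewrite (integral_mul_new famX X0_ge0 X0_mean (D := below (size u)) (F := fun om => g (weight om u)))//.
  - exact: below_nonroot.
  - by apply: (@measurableT_comp _ _ _ _ _ _ g setT).
have E2 : (\int[P]_w (weight (om w) u * g (X v w))%:E = (1 + h)%:E)%E.
  under eq_integral do rewrite EFinM.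
  rewrite (indep_integral famX (D1 := below (size u)) (D2 := [set v])
    (F := fun om => (weight om u)%:E) (G := fun om => (g (om v))%:E))//.
  - by rewrite integral_weight mul1e integral_g_X.
  - exact: below_nonroot.
  - by move=> _ ->.
  - by apply/seteqP; split => // x [xb /= xv]; apply: nbv; rewrite -xv.
  - exact/measurable_EFinP.
  - apply/measurable_EFinP; apply: (@measurableT_comp _ _ _ _ _ _ g setT) => //.
    exact: measurable_coord.
  - by move=> w; rewrite lee_fin.
(* The identity g(xy) + x + y = 1 + g(x) y + x g(y) has nonnegative terms on both sides, and the
   products on the right are of independent factors. *)
have K : (\int[P]_w (g (weight (om w) v) + (weight (om w) u + X v w))%:E =
          \int[P]_w (1 + (g (weight (om w) u) * X v w + weight (om w) u * g (X v w)))%:E)%E.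
  apply: eq_integral => w _; congr EFin; rewrite {1}/g weight_rcons -/v mul_lnM// /g; ring.
have mA : measurable_fun setT (fun w => g (weight (om w) u) * X v w) by exact: measurable_funM.
have mB : measurable_fun setT (fun w => weight (om w) u * g (X v w)) by exact: measurable_funM.
have A0 w : 0 <= g (weight (om w) u) * X v w by exact: mulr_ge0.
have B0 w : 0 <= weight (om w) u * g (X v w) by exact: mulr_ge0.
have mAB := measurable_funD mA mB.
have AB0 w : 0 <= g (weight (om w) u) * X v w + weight (om w) u * g (X v w) by exact: addr_ge0.
have mWX := measurable_funD (@mW u) (@mX v).
have WX0 w : 0 <= weight (om w) u + X v w by exact: addr_ge0.
move: K; rewrite (ge0_integralD_EFin P mgv mWX)// (ge0_integralD_EFin P _ mAB)//.
rewrite (ge0_integralD_EFin P (@mW u) (@mX v))// (ge0_integralD_EFin P mA mB)//.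
rewrite E1 E2 integral_weight (family_mean famX X0_ge0 X0_mean v0) integral_prob_cst.
move=> K; have := congr1 (fun x => x - (1 + 1)%:E)%E K.
rewrite -EFinD addeK// => ->; rewrite -?EFinD -?EFinB; congr EFin.
by rewrite size_rcons -natr1; ring.
Qed.

Lemma integral_mass_weight_ln a u : 0 <= a u <= 1 ->
  (\int[P]_w (1 + (a u * weight (om w) u) * ln (a u * weight (om w) u))%:E =
   (1 + (a u * ((size u)%:R * h) + a u * ln (a u)))%:E)%E.
Proof.
move=> /andP[a0 a1]; pose g (t : R) := 1 + t * ln t.
pose c := - (a u * ln (a u)).
have c0 : 0 <= c by rewrite oppr_ge0 mulr_ge0_le0// ln_le0.
have mgw : measurable_fun setT (fun w => g (weight (om w) u)) by exact: measurableT_comp.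
have gw0 w : 0 <= g (weight (om w) u) by exact: g_ge0.
have maw : measurable_fun setT (fun w => a u * weight (om w) u) by exact: measurable_funM.
have mgaw : measurable_fun setT (fun w => g (a u * weight (om w) u)) by exact: measurableT_comp.
have gaw0 w : 0 <= g (a u * weight (om w) u) by apply: g_ge0; rewrite mulr_ge0.
(* The negative quantity a ln a is moved to the other side as [c], so that again only nonnegative
   functions are integrated. *)
have K : (\int[P]_w (g (a u * weight (om w) u) + (a u + c * weight (om w) u))%:E =
          \int[P]_w (1 + a u * g (weight (om w) u))%:E)%E.
  by apply: eq_integral => w _; congr EFin; rewrite {1}/g mul_lnM// /g /c; ring.
have mA : measurable_fun setT (fun w => a u * g (weight (om w) u)) by exact: measurable_funM.
have A0 w : 0 <= a u * g (weight (om w) u) by exact: mulr_ge0.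
have mB : measurable_fun setT (fun w => c * weight (om w) u) by exact: measurable_funM.
have B0 w : 0 <= c * weight (om w) u by exact: mulr_ge0.
have mC : measurable_fun setT (fun w => a u + c * weight (om w) u) by exact: measurable_funD.
have C0 w : 0 <= a u + c * weight (om w) u by exact: addr_ge0.
move: K; rewrite (ge0_integralD_EFin P mgaw mC)// (ge0_integralD_EFin P _ mA)//.
rewrite (ge0_integralD_EFin P _ mB)//.
rewrite !ge0_integralZr_EFin// integral_weight integral_weight_ln !integral_prob_cst mule1.
move=> K; have := congr1 (fun x => x - (a u + c)%:E)%E K.
rewrite -EFinD addeK// => ->; rewrite -EFinM -?EFinD -?EFinB; congr EFin.
by rewrite /c; ring.
Qed.

Lemma measurable_branch a m i (D : set W) : (forall v, D (i :: v)) ->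
  measurable_fun setT ((fun om => branch a om m i) : env R D -> R).
Proof.
move=> Di; apply: measurable_funM; first exact: measurable_coord.
have mY := measurable_env_sub (@below_nonroot b m) (@measurable_cascade_mass b R (subtree a [:: i]) m).
apply: (@measurableT_comp _ _ _ _ _ _ ((fun om => cascade_mass (subtree a [:: i]) om m) :
  env R nonroot -> R) setT (fun om : env R D => subtree om [:: i] : env R nonroot)) => //.
by apply: measurable_subtree => v _; exact: Di.
Qed.

Lemma measurable_kappa d' (U : measurableType d') (f g : U -> R) : measurable_fun setT f ->
  measurable_fun setT g -> measurable_fun setT (fun x => kappa (f x) (g x)).
Proof.
move=> mf mg'; apply: measurable_funM => //; apply: measurable_funB.
  by apply: measurableT_comp => //; exact: measurable_ln.
by apply: measurableT_comp => //; exact: measurable_ln.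
Qed.

Lemma measurable_split_info a m :
  measurable_fun setT ((fun om => split_info a om m) : env R nonroot -> R).
Proof.
apply: measurable_sum => i; apply: measurable_kappa.
  exact: measurable_branch.
exact: measurable_env_sub (@below_nonroot b m.+1) (@measurable_cascade_mass b R a m.+1).
Qed.

Lemma measurable_total_info a n :
  measurable_fun setT (total_info n a : env R nonroot -> R).
Proof.
elim: n a => [|n IH] a /=; first exact: measurable_cst.
apply: measurable_funD; first exact: measurable_split_info.
apply: measurable_sum => i; apply: measurable_funM; first exact: measurable_coord.
apply: (@measurableT_comp _ _ _ _ _ _ (total_info n (subtree a [:: i]) : env R nonroot -> R)
  setT (fun om : env R nonroot => subtree om [:: i] : env R nonroot)) => //.
exact: measurable_subtree.
Qed.

Let X_ge0 w v : 0 <= X v w. Proof. exact: (family_ge0 famX). Qed.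

Lemma integral_coord_subtree i (G : (W -> R) -> R) :
  measurable_fun setT (G : env R nonroot -> R) ->
  (forall x : W -> R, (forall v, 0 <= x v) -> 0 <= G x) ->
  (\int[P]_w (X [:: i] w * G (subtree (om w) [:: i]))%:E = \int[P]_w (G (om w))%:E)%E.
Proof.
move=> mG G0; under eq_integral do rewrite EFinM.
rewrite (integral_mul_subtree famX (u := [:: i]) (D := [set [:: i]])
  (F := fun om => (om [:: i])%:E) (G := fun om => (G om)%:E))//.
- by rewrite (family_mean famX X0_ge0 X0_mean)// mul1e.
- by move=> _ ->.
- by move=> v v0 /= [] /eqP; rewrite (negbTE v0).
- by apply/measurable_EFinP; exact: measurable_coord.
- exact/measurable_EFinP.
- by move=> w; rewrite lee_fin.
Qed.

Lemma integral_branch a m i : is_mass a ->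
  (\int[P]_w (branch a (om w) m i)%:E = (a [:: i])%:E)%E.
Proof.
move=> am; have ai := is_mass_subtree [:: i] am.
rewrite (@integral_coord_subtree i (fun x => cascade_mass (subtree a [:: i]) x m)).
- exact: (integral_cascade_mass famX X0_ge0 X0_mean ai).
- exact: measurable_env_sub (@below_nonroot b m) (@measurable_cascade_mass b R _ m).
- by move=> x x0; exact: cascade_mass_ge0.
Qed.

Definition mean_info n a : \bar R := (\int[P]_w (total_info n a (om w))%:E)%E.

Definition mean_split a m : \bar R := (\int[P]_w (split_info a (om w) m)%:E)%E.

Lemma mean_infoS n a : is_mass a ->
  mean_info n.+1 a = (mean_split a n + \sum_i mean_info n (subtree a [:: i]))%E.
Proof.
move=> am; rewrite /mean_info /=.
have mF i : measurable_fun setT (fun w =>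
    X [:: i] w * total_info n (subtree a [:: i]) (subtree (om w) [:: i])).
  apply: measurable_funM => //.
  apply: (@measurableT_comp _ _ _ _ _ _ (total_info n (subtree a [:: i]) : env R nonroot -> R)
    setT (fun w => subtree (om w) [:: i] : env R nonroot)); first exact: measurable_total_info.
  by apply: measurable_to_env => v _; exact: mX.
have F0 i w : 0 <= X [:: i] w * total_info n (subtree a [:: i]) (subtree (om w) [:: i]).
  rewrite mulr_ge0// total_info_ge0//; first by move=> v; exact: X_ge0.
  exact: is_mass_subtree.
rewrite ge0_integralD_EFin//; last 3 first.
- by apply: measurable_sum => i; exact: mF.
- by move=> w; apply: split_info_ge0.
- by move=> w; apply: sumr_ge0 => i _; exact: F0.
congr (_ + _)%E.
  rewrite ge0_integral_sumr//; apply: eq_bigr => i _.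
  apply: integral_coord_subtree; first exact: measurable_total_info.
  by move=> x x0; apply: total_info_ge0 => //; exact: is_mass_subtree.
exact: (measurable_env_path famX (@measurable_split_info a n)).
Qed.

Section invariant_mass.
Variable a : W -> R.
Hypothesis am : is_mass a.
Hypothesis ainv : forall u, a u = \sum_(i : letter b) a (i :: u).

Let ai i : is_mass (subtree a [:: i]). Proof. exact: is_mass_subtree. Qed.

(* [total_info] is superadditive in the mass, and by invariance the children of the root sum to [a]. *)
Lemma mean_info_le n : (mean_info n a <= \sum_(0 <= k < n) mean_split a k)%E.
Proof.
elim: n => [|n IH]; first by rewrite big_nil /mean_info /= integral_prob_cst.
rewrite mean_infoS// big_nat_recr//= addeC; apply: leeD => //.
apply: le_trans IH.
have mT c : measurable_fun setT (fun w => total_info n c (om w)).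
  exact: (measurable_env_path famX (@measurable_total_info c n)).
have T0' c w : is_mass c -> 0 <= total_info n c (om w) by move=> cm; apply: total_info_ge0.
rewrite -ge0_integral_sumr//; last by move=> i w; exact: T0'.
apply: ge0_le_integral => //.
- by move=> w _; rewrite lee_fin sumr_ge0// => i _; exact: T0'.
- by apply/measurable_EFinP; apply: measurable_sum => i; exact: mT.
- exact/measurable_EFinP.
- move=> w _; rewrite lee_fin.
  rewrite (_ : total_info n a (om w) = total_info n (fun u => \sum_i subtree a [:: i] u) (om w)).
    by apply: total_info_super.
  by congr total_info; apply/funext => u; rewrite ainv.
Qed.

End invariant_mass.

(** Integrate [kappa_beta] with z the branch of [i] and s - z the sum of the other branches. By
    independence the correction has mean at most E[z/(1+z)] times [a [::]], and as [a [::] <= 1] it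
    is compensated by the term z/(1+z) on the left, whose mean is finite. *)
Lemma mean_split_le a m : is_mass a -> a [::] <= 1 ->
  (mean_split a m <= \sum_i \int[P]_w (beta (branch a (om w) m i))%:E)%E.
Proof.
move=> am a1.
pose z i w := branch a (om w) m i.
pose s w := cascade_mass a (om w) m.+1.
(* Equal to y/(1+y) where it matters, and continuous on the whole line. *)
pose phi (y : R) := y / (1 + `|y|).
have cphi : continuous phi.
  move=> y; apply: cvgM => //; apply: cvgV; first by rewrite gt_eqF// ltr_wpDr.
  by apply: cvgD; [exact: cvg_cst|apply: cvg_norm].
have mphi : measurable_fun setT phi by exact: continuous_measurable_fun.
pose f i w := phi (z i w).
have z0 i w : 0 <= z i w by apply: branch_ge0.
have zs i w : z i w <= s w by apply: branch_le.
have fE i w : f i w = z i w / (1 + z i w) by rewrite /f /phi ger0_norm.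
have f0 i w : 0 <= f i w by rewrite fE divr_ge0// addr_ge0.
have f1 i w : f i w <= 1 by rewrite fE ler_pdivrMr ?ltr_wpDr// mul1r lerDr.
pose br (i : letter b) : set W := [set v | exists v', v = i :: v'].
have mbr i : measurable_fun setT ((fun om => branch a om m i) : env R (br i) -> R).
  by apply: measurable_branch => v; exists v.
have mz i : measurable_fun setT (z i) by exact: (measurable_env_path famX (mbr i)).
have mf i : measurable_fun setT (f i) by exact: measurableT_comp.
have mfz i j : measurable_fun setT (fun w => f i w * z j w) by exact: measurable_funM.
have fz0 i j w : 0 <= f i w * z j w by exact: mulr_ge0.
have mbeta i : measurable_fun setT (fun w => beta (z i w)).
  by apply: measurable_kappa => //; exact: measurable_funD.
have beta0 i w : 0 <= beta (z i w) by exact: beta_ge0.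
have msplit : measurable_fun setT (fun w => split_info a (om w) m).
  exact: (measurable_env_path famX (@measurable_split_info a m)).
have split0 w : 0 <= split_info a (om w) m by apply: split_info_ge0.
have Efz i j : i != j -> (\int[P]_w (f i w * z j w)%:E = \int[P]_w (f i w)%:E * (a [:: j])%:E)%E.
  move=> ij; under eq_integral do rewrite EFinM.
  rewrite (indep_integral famX (D1 := br i) (D2 := br j)
    (F := fun om => (phi (branch a om m i))%:E) (G := fun om => (branch a om m j)%:E))//.
  - by rewrite integral_branch.
  - by move=> _ [v ->].
  - by move=> _ [v ->].
  - apply/seteqP; split => // v [[v1 vi] [v2 vj]].
    by move/eqP : ij; apply; move: vj; rewrite vi => -[].
  - by apply/measurable_EFinP; apply: (@measurableT_comp _ _ _ _ _ _ phi setT).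
  - by apply/measurable_EFinP; exact: mbr.
  - by move=> w; rewrite lee_fin; exact: f0.
  - by move=> w; rewrite lee_fin; exact: z0.
have sum_f : (\sum_i \int[P]_w (f i w)%:E)%E \is a fin_num.
  apply/sum_fin_numP => i _ _; rewrite ge0_fin_numE; last first.
    by apply: integral_ge0 => w _; rewrite lee_fin.
  apply: (@le_lt_trans _ _ (\int[P]_w 1%:E)%E); last by rewrite integral_prob_cst ltry.
  by apply: ge0_le_integral => //; [move=> w _; rewrite lee_fin|exact/measurable_EFinP|move=> w _; rewrite lee_fin].
rewrite -(leeD2rE _ _ sum_f).
have mSf : measurable_fun setT (fun w => \sum_i f i w) by exact: measurable_sum.
have Sf0 w : 0 <= \sum_i f i w by exact: sumr_ge0.
have mSb : measurable_fun setT (fun w => \sum_i beta (z i w)) by exact: measurable_sum.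
have Sb0 w : 0 <= \sum_i beta (z i w) by exact: sumr_ge0.
have mSz i : measurable_fun setT (fun w => \sum_(j | j != i) f i w * z j w).
  under eq_fun do rewrite big_mkcond /=.
  by apply: measurable_sum => j; case: (j != i).
have Sz0 i w : 0 <= \sum_(j | j != i) f i w * z j w by exact: sumr_ge0.
have mSS : measurable_fun setT (fun w => \sum_i \sum_(j | j != i) f i w * z j w).
  exact: measurable_sum.
have SS0 w : 0 <= \sum_i \sum_(j | j != i) f i w * z j w by exact: sumr_ge0.
apply: (@le_trans _ _ (\int[P]_w (split_info a (om w) m + \sum_i f i w)%:E)%E).
  by rewrite -ge0_integral_sumr// -ge0_integralD_EFin.
apply: (@le_trans _ _ (\int[P]_w (\sum_i beta (z i w) + \sum_i \sum_(j | j != i) f i w * z j w)%:E)%E).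
  apply: ge0_le_integral => //.
  - by move=> w _; rewrite lee_fin addr_ge0.
  - by apply/measurable_EFinP; exact: measurable_funD.
  - by apply/measurable_EFinP; exact: measurable_funD.
  - move=> w _; rewrite lee_fin /split_info -!big_split /=; apply: ler_sum => i _.
    rewrite -mulr_sumr fE (_ : \sum_(j | j != i) z j w = s w - z i w); first exact: (kappa_beta (z0 i w) (zs i w)).
    apply/eqP; rewrite eq_sym subr_eq; apply/eqP.
    by rewrite /s cascade_mass1 [LHS](bigD1 i)//= addrC.
rewrite ge0_integralD_EFin// ge0_integral_sumr//; apply: leeD => //.
rewrite ge0_integral_sumr//; apply: lee_sum => i _.
have -> : (\int[P]_w (\sum_(j | j != i) f i w * z j w)%:E =
    \int[P]_w (f i w)%:E * (\sum_(j | j != i) a [:: j])%:E)%E.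
  under eq_integral do rewrite big_mkcond /=.
  rewrite ge0_integral_sumr//; last 2 first.
  - by move=> j; case: (j != i).
  - by move=> j w; case: (j != i).
  rewrite -sumEFin ge0_sume_distrr; last by move=> j _; rewrite lee_fin am.1.
  rewrite [RHS]big_mkcond; apply: eq_bigr => j _.
  by case: (eqVneq j i) => [_|ji]; rewrite ?integral0// Efz// eq_sym.
rewrite -[leRHS]mule1 lee_wpmul2l//; first by apply: integral_ge0 => w _; rewrite lee_fin.
rewrite lee_fin; apply: le_trans a1; rewrite [leRHS](mass_sum0 1 am) (sum_tuple1 a).
by rewrite [leRHS](bigD1 i)//= lerDr am.1.
Qed.

Lemma mean_split_fin a m : is_mass a -> a [::] <= 1 -> mean_split a m \is a fin_num.
Proof.
move=> am a1; rewrite ge0_fin_numE; last first.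
  by apply: integral_ge0 => w _; rewrite lee_fin split_info_ge0.
apply: (le_lt_trans (mean_split_le m am a1)); apply: lte_sum_pinfty => i _.
have b0 w : 0 <= beta (branch a (om w) m i) by apply: beta_ge0; apply: branch_ge0.
have mz : measurable_fun setT (fun w => branch a (om w) m i).
  have mb' : measurable_fun setT ((fun om => branch a om m i) : env R nonroot -> R).
    exact: measurable_branch.
  exact: (measurable_env_path famX mb').
apply: (@le_lt_trans _ _ (\int[P]_w 1%:E)%E); last by rewrite integral_prob_cst ltry.
apply: ge0_le_integral => //.
- by move=> w _; rewrite lee_fin.
- by apply/measurable_EFinP; apply: measurable_kappa => //; exact: measurable_funD.
- by move=> w _; rewrite lee_fin; apply: beta_le1; apply: branch_ge0.
Qed.

(** Every branch is at most the total mass, which tends to 0 almost surely; [beta] of it then tends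
    to 0 boundedly. *)
Lemma mean_split_cvg0 a : is_mass a -> a [::] <= 1 ->
  {ae P, forall w, limit_mass a (om w) = 0%E} ->
  fine (mean_split a m) @[m --> \oo] --> (0 : R).
Proof.
move=> am a1 L0.
have b0 m i w : 0 <= branch a (om w) m i by apply: branch_ge0.
have mz m i : measurable_fun setT (fun w => branch a (om w) m i).
  have mb' : measurable_fun setT ((fun om => branch a om m i) : env R nonroot -> R).
    exact: measurable_branch.
  exact: (measurable_env_path famX mb').
have mb m i : measurable_fun setT (fun w => beta (branch a (om w) m i)).
  by apply: measurable_kappa => //; exact: measurable_funD.
have ib m i : P.-integrable setT (EFin \o (fun w => beta (branch a (om w) m i))).
  apply: (@intg_bounded _ _ _ P _ 1) => // w.
  by rewrite ger0_norm ?beta_ge0// beta_le1.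
have cb i : \int[P]_w beta (branch a (om w) m i) @[m --> \oo] --> (0 : R).
  rewrite -(Rint_prob_cst P 0).
  apply: (@Rint_DCT _ _ _ P _ _ (fun=> 1)) => //.
  - exact: intg_cst.
  - by move=> n w; rewrite ger0_norm ?beta_ge0// beta_le1.
  apply: filterS2 L0 (limit_mass_cvg famX X0_ge0 X0_mean am) => w Lw [_].
  rewrite Lw /= => cY.
  have cz : branch a (om w) m i @[m --> \oo] --> (0 : R).
    apply: (@squeeze_cvgr _ _ _ R (fun=> 0) (fun m => cascade_mass a (om w) m.+1)).
    - by apply: nearW => m; rewrite b0 branch_le.
    - exact: cvg_cst.
    - by move: cY; rewrite -(cvg_shiftn 1); under eq_fun do rewrite addn1.
  apply: (@squeeze_cvgr _ _ _ R (fun=> 0) (fun m => 2 * Num.sqrt (branch a (om w) m i * (1 + branch a (om w) m i)))).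
  - by apply: nearW => m; rewrite beta_ge0// beta_sqrt.
  - exact: cvg_cst.
  - rewrite -[X in _ --> X](_ : 2 * Num.sqrt (0 * (1 + 0)) = 0); last first.
      by rewrite mul0r sqrtr0 mulr0.
    apply: cvgM; first exact: cvg_cst.
    apply: continuous_cvg; first exact: sqrt_continuous.
    by apply: cvgM => //; apply: cvgD => //; exact: cvg_cst.
apply: (@squeeze_cvgr _ _ _ R (fun=> 0) (fun m => \sum_i \int[P]_w beta (branch a (om w) m i))).
- apply: nearW => m; apply/andP; split.
    by apply: fine_ge0; apply: integral_ge0 => w _; rewrite lee_fin split_info_ge0.
  rewrite -lee_fin fineK ?mean_split_fin// -sumEFin.
  apply: le_trans (mean_split_le m am a1) _; apply: lee_sum => i _.
  by rewrite Rint_EFin.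
- exact: cvg_cst.
- rewrite -[X in _ --> X](_ : \sum_(i : letter b) 0 = 0); last by rewrite big1.
  exact: cvg_sumr.
Qed.

(** With N words of length n, the mean of [sum_mul_ln_ge] reads N + 1 <= N + n h - H_n + 1 + E I_n,
    where H_n is the block entropy and I_n is [total_info]; E I_n is a sum of n terms that tend to
    0. *)
Lemma entropy_le_of_singular (nu : ergodic_measure b R) :
  {ae P, forall w, limit_mass (mass_of nu) (om w) = 0%E} -> entropy nu <= h.
Proof.
set a := mass_of nu => L0.
have am : is_mass a by exact: is_mass_of.
have a1 : a [::] <= 1 by exact: mass_le1.
have ainv u : a u = \sum_(i : letter b) a (i :: u).
  exact: (invariant_mass (@ergodic_invariant _ _ nu)).
apply: (@entropy_le_block _ _ nu h (fun m => fine (mean_split a m))); last first.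
  exact: mean_split_cvg0.
move=> n; rewrite -/a.
have : (mean_info n a <= (\sum_(0 <= k < n) fine (mean_split a k))%:E)%E.
  rewrite -sumEFin; apply: le_trans (mean_info_le am ainv n) _.
  by apply: lee_sum => k _; rewrite fineK// mean_split_fin.
set r := \sum_(0 <= k < n) _ => rn.
pose g (u : n.-tuple (letter b)) w := 1 + (a u * weight (om w) u) * ln (a u * weight (om w) u).
have maw (u : W) : measurable_fun setT (fun w => a u * weight (om w) u) by exact: measurable_funM.
have mg' (u : n.-tuple (letter b)) : measurable_fun setT (g u).
  exact: (@measurableT_comp _ _ _ _ _ _ (fun t : R => 1 + t * ln t) setT).
have g0 (u : n.-tuple (letter b)) w : 0 <= g u w by apply: g_ge0; rewrite mulr_ge0// am.1.
pose N : R := \sum_(u : n.-tuple (letter b)) 1.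
have N0 : 0 <= N by apply: sumr_ge0.
have mY : measurable_fun setT (fun w => cascade_mass a (om w) n).
  exact: (measurable_mass_path famX a n).
have Y0 w : 0 <= cascade_mass a (om w) n by exact: (mass_path_ge0 famX am).
have mI : measurable_fun setT (fun w => total_info n a (om w)).
  exact: (measurable_env_path famX (@measurable_total_info a n)).
have I0 w : 0 <= total_info n a (om w) by apply: total_info_ge0.
have mSg : measurable_fun setT (fun w => \sum_u g u w) by exact: measurable_sum.
have Sg0 w : 0 <= \sum_u g u w by exact: sumr_ge0.
have mI1 : measurable_fun setT (fun w => 1 + total_info n a (om w)) by exact: measurable_funD.
have I10 w : 0 <= 1 + total_info n a (om w) by exact: addr_ge0.
have : (\int[P]_w (N + cascade_mass a (om w) n)%:E <=
    \int[P]_w (\sum_u g u w + (1 + total_info n a (om w)))%:E)%E.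
  apply: ge0_le_integral => //.
  - by move=> w _; rewrite lee_fin addr_ge0.
  - by apply/measurable_EFinP; exact: measurable_funD.
  - by apply/measurable_EFinP; exact: measurable_funD.
  - by move=> w _; rewrite lee_fin; exact: sum_mul_ln_ge.
rewrite !ge0_integralD_EFin// integral_prob_cst (integral_cascade_mass famX X0_ge0 X0_mean am).
rewrite ge0_integral_sumr// integral_prob_cst.
under eq_bigr => u _ do rewrite integral_mass_weight_ln ?am.1 ?mass_le1// size_tuple.
rewrite sumEFin -EFinD => H.
have := le_trans H (leeD (lexx _) (leeD (lexx _) rn)).
rewrite -!EFinD lee_fin big_split /= -/N big_split /= -mulr_suml -mass_sum0//.
have -> : a [::] = 1 by exact: mass_of_nil_prob.
by rewrite mul1r /block_entropy sumrN; lra.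
Qed.

End entropy_bound.

(** * Singularity below the critical entropy *)

Section tilting.
Context {R : realType}.
Implicit Types (x y s t : R).

(** The power x^(1-s), with value 0 at 0. *)
Definition tilt s x := x * expR (- (s * ln x)).

Lemma tilt_ge0 s x : 0 <= x -> 0 <= tilt s x.
Proof. by move=> x0; rewrite mulr_ge0// expR_ge0. Qed.

Lemma tiltM s x y : 0 <= x -> 0 <= y -> tilt s (x * y) = tilt s x * tilt s y.
Proof.
rewrite le_eqVlt => /predU1P[<- _|x0]; first by rewrite /tilt !mul0r.
rewrite le_eqVlt => /predU1P[<-|y0]; first by rewrite /tilt mulr0 !mul0r mulr0.
by rewrite /tilt lnM ?posrE// mulrDr opprD expRD; ring.
Qed.

Lemma tilt_le s x : 0 <= s -> 0 <= x -> s <= 1 -> tilt s x <= 1 + x.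
Proof.
move=> s0; rewrite le_eqVlt => /predU1P[<- _|x0 s1]; first by rewrite /tilt mul0r addr0.
have [x1|x1] := leP 1 x.
  apply: (@le_trans _ _ x); last by rewrite lerDr.
  rewrite /tilt ler_piMr ?(ltW x0)// -(expR0 R) ler_expR oppr_le0 mulr_ge0// ln_ge0//.
apply: (@le_trans _ _ 1); last by rewrite lerDl ltW.
rewrite /tilt -{1}(lnK x0) -expRD -(expR0 R) ler_expR.
rewrite -{1}[ln x]mul1r -mulrBl mulr_ge0_le0 ?subr_ge0// ln_le0// ltW//.
Qed.

(** A bound uniform in [s], which permits Fatou's lemma. For x < 1 and l = - ln x, the condition s
    <= 1/2 leaves a factor exp(-l/2), and l exp(-l/2) <= 2. *)
Lemma tilt_lower s x : 0 < s -> s <= 2^-1 -> 0 <= x -> -2 <= (x - tilt s x) / s.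
Proof.
move=> s0 s2; rewrite le_eqVlt => /predU1P[<-|x0].
  by rewrite /tilt mul0r subr0 mul0r oppr_le0.
rewrite ler_pdivlMr// lerBrDl -lerBrDr mulNr opprK.
have [x1|x1] := leP 1 x.
  apply: (@le_trans _ _ x); last by rewrite lerDl mulr_ge0// ltW.
  rewrite /tilt ler_piMr ?(ltW x0)// -(expR0 R) ler_expR oppr_le0 mulr_ge0 ?(ltW s0)// ln_ge0//.
set l := - ln x; have l0 : 0 <= l by rewrite oppr_ge0 ln_le0// ltW.
rewrite /tilt -mulrN -/l.
have H1 : expR (s * l) <= 1 + s * l * expR (s * l).
  have := ler_wpM2l (expR_ge0 (s * l)) (expR_ge1Dx (- (s * l))).
  by rewrite -expRD subrr expR0; lra.
have H2 : x * expR (s * l) <= expR (- (l / 2)).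
  rewrite -{1}(lnK x0) -expRD ler_expR -[ln x]opprK -/l.
  by have := ler_wpM2r l0 s2; lra.
have H3 : l * expR (- (l / 2)) <= 2.
  have := expR_ge1Dx (l / 2) => H.
  rewrite expRN ler_pdivrMr ?expR_gt0//; lra.
have H4 : x * (s * l * expR (s * l)) <= s * 2.
  rewrite (_ : x * _ = s * (l * (x * expR (s * l)))); last by ring.
  rewrite ler_wpM2l ?(ltW s0)//; apply: le_trans H3.
  by rewrite ler_wpM2l.
by have := ler_wpM2l (ltW x0) H1; lra.
Qed.

(** The derivative of -x^(1-s) at s = 0, along s = 1/(n+2), which respects s <= 1/2. *)
Lemma tilt_cvg x : 0 <= x -> (x - tilt n.+2%:R^-1 x) * n.+2%:R @[n --> \oo] --> x * ln x.
Proof.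
rewrite le_eqVlt => /predU1P[<-|x0].
  by under eq_fun do rewrite /tilt mul0r subr0 mul0r; rewrite mul0r; exact: cvg_cst.
set l := ln x.
have c0 : (n.+2%:R^-1 : R) @[n --> \oo] --> (0 : R).
  by have := @cvg_harmonic R; rewrite -(cvg_shiftn 1); under eq_fun do rewrite addn1.
have E n : (x - tilt n.+2%:R^-1 x) * n.+2%:R = x * ((1 - expR (- (n.+2%:R^-1 * l))) * n.+2%:R).
  by rewrite /tilt -/l; ring.
under eq_fun do rewrite E.
apply: cvgM; first exact: cvg_cst.
have cl : l / (1 + n.+2%:R^-1 * l) @[n --> \oo] --> l.
  rewrite -[X in _ --> X](_ : l / (1 + 0 * l) = l); last by rewrite mul0r addr0 divr1.
  apply: cvgM; first exact: cvg_cst.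
  apply: cvgV; first by rewrite mul0r addr0 oner_eq0.
  by apply: cvgD; [exact: cvg_cst|apply: cvgM => //; exact: cvg_cst].
have csl : (n.+2%:R^-1 * l : R) @[n --> \oo] --> (0 : R).
  by rewrite -[X in _ --> X](mul0r l); apply: cvgM => //; exact: cvg_cst.
apply: (@squeeze_cvgr _ _ _ R (fun n => l / (1 + n.+2%:R^-1 * l)) (fun=> l)); last 2 first.
- exact: cl.
- exact: cvg_cst.
have [N _ NP] := (@cvgrPdist_lt _ _ _ _ _ _ _).1 csl 1 ltr01.
exists N => // n /= /NP; rewrite sub0r normrN ltr_norml => /andP[y1 _].
set y := n.+2%:R^-1 * l in y1 *.
have n0 : 0 < n.+2%:R :> R by [].
have yE : l = y * n.+2%:R by rewrite /y mulrAC mulVf ?mul1r.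
have y1' : 0 < 1 + y by rewrite -ltrBlDl sub0r.
apply/andP; split.
- have -> : l / (1 + y) = y / (1 + y) * n.+2%:R by rewrite yE; ring.
  rewrite ler_pM2r// lerBrDl -lerBrDr expRN.
  have -> : 1 - y / (1 + y) = (1 + y)^-1 by field; rewrite gt_eqF.
  by rewrite lef_pV2 ?posrE ?expR_gt0// expR_ge1Dx.
- rewrite yE ler_pM2r//.
  by have := expR_ge1Dx (- y); lra.
Qed.

(** For t <= K use t = t^s t^(1-s) <= K^s t^(1-s); for t > K use 1 <= t/K. *)
Lemma min_mul_tilt m t s K : 0 <= m -> 0 <= t -> 0 <= s -> 0 < K ->
  Num.min (m * t) 1 <= m * (expR (s * ln K) * tilt s t) + t / K.
Proof.
move=> m0; rewrite le_eqVlt => /predU1P[<- s0 K0|t0 s0 K0].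
  by rewrite /tilt !(mul0r, mulr0) addr0 ge_min lexx.
have [tK|Kt] := leP t K.
- rewrite ge_min; apply/orP; left; apply: (@le_trans _ _ (m * (expR (s * ln K) * tilt s t))).
    rewrite ler_wpM2l// /tilt mulrCA -expRD ler_peMr ?(ltW t0)//.
    by rewrite -(expR0 R) ler_expR -mulrBr mulr_ge0// subr_ge0 ler_ln.
  by rewrite lerDl divr_ge0 ?(ltW t0)// ltW.
- rewrite ge_min; apply/orP; right; apply: (@le_trans _ _ (t / K)).
    by rewrite ler_pdivlMr// mul1r ltW.
  by rewrite lerDr mulr_ge0// mulr_ge0 ?expR_ge0// tilt_ge0// ltW.
Qed.

End tilting.

Section tilted_integrals.
Context {b : nat} {R : realType} d0 (T0 : measurableType d0) (P0 : probability T0 R).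
Variable X0 : {RV P0 >-> R}.
Hypothesis X0_ge0 : forall w, 0 <= X0 w.
Hypothesis X0_mean : ('E_P0[X0] = 1)%E.
Let f w := X0 w * ln (X0 w).
Let mf : measurable_fun setT f.
Proof.
by apply: measurable_funM => //; apply: measurableT_comp => //; exact: measurable_ln.
Qed.
Let f_ge w : -1 <= f w.
Proof. by have := mul_ln_ge (X0_ge0 w); have := X0_ge0 w; rewrite /f; lra. Qed.

(** As x ln x >= -1, the negative part has a finite integral, so the identity holds even when the
    expectation is +oo. *)
Lemma integral_add_mul_ln (c : R) : 1 <= c ->
  (\int[P0]_w (c + X0 w * ln (X0 w))%:E = c%:E + 'E_P0[(fun w => X0 w * ln (X0 w))%R])%E.
Proof.
move=> c1; rewrite unlock -/f [X in (_ = _ + X)%E]integralE.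
have mp : measurable_fun setT (fun w => Num.max (f w) 0) by apply: measurable_maxr.
have mn : measurable_fun setT (fun w => Num.max (- f w) 0).
  by apply: measurable_maxr => //; exact: measurable_funN.
have p0 w : 0 <= Num.max (f w) 0 by rewrite le_max lexx orbT.
have n0 w : 0 <= Num.max (- f w) 0 by rewrite le_max lexx orbT.
have cf0 w : 0 <= c + f w by have := f_ge w; lra.
have mcf : measurable_fun setT (fun w => c + f w) by exact: measurable_funD.
have Ep : (\int[P0]_x (EFin \o f)^\+ x = \int[P0]_w (Num.max (f w) 0)%:E)%E.
  by apply: eq_integral => w _; rewrite funeposE EFin_max.
have En : (\int[P0]_x (EFin \o f)^\- x = \int[P0]_w (Num.max (- f w) 0)%:E)%E.
  by apply: eq_integral => w _; rewrite funenegE EFin_max.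
rewrite Ep En.
have K : (\int[P0]_w (c + Num.max (f w) 0)%:E = \int[P0]_w ((c + f w) + Num.max (- f w) 0)%:E)%E.
  apply: eq_integral => w _; congr EFin; rewrite -addrA; congr (_ + _).
  by case: (leP (f w) 0) => ?; case: (leP (- f w) 0) => ?; lra.
have nfin : (\int[P0]_w (Num.max (- f w) 0)%:E)%E \is a fin_num.
  rewrite ge0_fin_numE; last by apply: integral_ge0 => w _; rewrite lee_fin.
  apply: (@le_lt_trans _ _ (\int[P0]_w 1%:E)%E); last by rewrite integral_prob_cst ltry.
  apply: ge0_le_integral => //; [by move=> w _; rewrite lee_fin|exact/measurable_EFinP|].
  by move=> w _; rewrite lee_fin ge_max ler01 andbT; have := f_ge w; lra.
have c0 : forall w : T0, 0 <= c by move=> _; exact: le_trans c1.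
move: K; rewrite (ge0_integralD_EFin P0 (measurable_cst c) mp c0 p0) (ge0_integralD_EFin P0 mcf mn cf0 n0).
by rewrite integral_prob_cst => K; rewrite addeA K addeK.
Qed.

Lemma measurable_tilt (s : R) : measurable_fun setT (tilt s).
Proof.
apply: measurable_funM => //; apply: measurableT_comp; first exact: measurable_expR.
by apply: measurableT_comp => //; apply: measurable_funM => //; exact: measurable_ln.
Qed.

(** If every s = 1/(n+2) failed, the difference quotients (x - x^(1-s))/s would have means at most
    [q]; raised by 2 they are nonnegative, and Fatou would give h_X <= q. *)
Lemma exists_tilt (q : R) : (q%:E < 'E_P0[(fun w => X0 w * ln (X0 w))%R])%E ->
  exists2 s, 0 < s <= 2^-1 & (\int[P0]_w (tilt s (X0 w))%:E <= (1 - s * q)%:E)%E.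
Proof.
move=> qh; apply: contrapT => nex.
pose s_ n : R := n.+2%:R^-1.
have s0 n : 0 < s_ n by rewrite invr_gt0.
have s2 n : s_ n <= 2^-1 by rewrite lef_pV2 ?posrE// ler_nat.
have s1 n : s_ n <= 1 by apply: le_trans (s2 n) _; rewrite invf_le1// ler1n.
pose g n w := (X0 w - tilt (s_ n) (X0 w)) * n.+2%:R + 2.
have mt n : measurable_fun setT (fun w => tilt (s_ n) (X0 w)).
  by apply: (@measurableT_comp _ _ _ _ _ _ (tilt (s_ n)) setT) => //; exact: measurable_tilt.
have mg n : measurable_fun setT (g n).
  by apply: measurable_funD => //; apply: measurable_funM => //; exact: measurable_funB.
have g0 n w : 0 <= g n w.
  have := tilt_lower (s0 n) (s2 n) (X0_ge0 w); rewrite /s_ invrK -/(s_ n) => H.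
  by rewrite /g; lra.
have t0 n w : 0 <= tilt (s_ n) (X0 w) by exact: tilt_ge0.
have iX : P0.-integrable setT (EFin \o X0).
  apply/integrableP; split; first exact/measurable_EFinP.
  under eq_integral do rewrite /= ger0_norm//.
  by move: X0_mean; rewrite unlock => ->; rewrite ltry.
have it n : P0.-integrable setT (EFin \o (fun w => tilt (s_ n) (X0 w))).
  apply: (intg_le (g := fun w => 1 + X0 w)) => //.
  - by move=> w; rewrite !ger0_norm ?addr_ge0// tilt_le// ltW.
  - by apply: intgD => //; exact: intg_cst.
have ig n : (\int[P0]_w (g n w)%:E <= (q + 2)%:E)%E.
  have E1 : \int[P0]_w g n w = (1 - \int[P0]_w tilt (s_ n) (X0 w)) * n.+2%:R + 2.
    have -> : \int[P0]_w g n w = \int[P0]_w (n.+2%:R * (X0 w - tilt (s_ n) (X0 w)) + 2).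
      by congr Rintegral; apply/funext => w; rewrite /g mulrC.
    rewrite RintegralD//; last 2 first.
    - by apply: intgZ; exact: intgB.
    - exact: intg_cst.
    rewrite RintegralZl//; last exact: intgB.
    rewrite RintegralB// Rint_prob_cst mulrC; congr (_ + _); congr ((_ - _) * _).
    by move: X0_mean; rewrite unlock /Rintegral => ->.
  rewrite Rint_EFin; last first.
    apply: intgD; last exact: intg_cst.
    rewrite (_ : (fun x => _) = (fun w => n.+2%:R * (X0 w - tilt (s_ n) (X0 w)))); last first.
      by apply/funext => w; rewrite mulrC.
    by apply: intgZ; exact: intgB.
  rewrite lee_fin E1 lerD2r -ler_pdivlMr// -/(s_ n).
  rewrite lerBlDr -lerBlDl leNgt; apply/negP => tlt; apply: nex; exists (s_ n).
    by rewrite s0 s2.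
  by rewrite Rint_EFin// lee_fin; lra.
have : (\int[P0]_w (2 + X0 w * ln (X0 w))%:E <= (q + 2)%:E)%E.
  apply: (@le_trans _ _ (\int[P0]_w limn_einf (fun n => (g n w)%:E))%E).
    rewrite le_eqVlt; apply/orP; left; apply/eqP; apply: eq_integral => w _.
    apply/esym/cvg_limn_einf; apply/cvg_EFin; first exact: nearW.
    rewrite addrC; apply: cvgD; last exact: cvg_cst.
    exact: tilt_cvg.
  apply: le_trans (fatou _ _ _ _) _ => //.
  - by move=> n; exact/measurable_EFinP.
  - by move=> n w _; rewrite lee_fin.
  rewrite limn_einf_lim; apply: lime_le; first exact: is_cvg_einfs.
  by apply: nearW => n; apply: le_trans (ig n); apply: ereal_inf_lbound; exists n => /=.
rewrite integral_add_mul_ln ?ler1n// leNgt addrC EFinD => /negP; apply.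
by rewrite lteD2lE.
Qed.

Context d (T : measurableType d) (P : probability T R) (X : seq (letter b) -> T -> R).
Hypothesis famX : cascade_family X0 P X.

Lemma integral_tilt_weight (s phi : R) u : 0 <= phi ->
  (\int[P0]_w (tilt s (X0 w))%:E <= phi%:E)%E ->
  (\int[P]_w (tilt s (weight (X^~ w) u))%:E <= (phi ^+ size u)%:E)%E.
Proof.
move=> phi0 tphi.
have tg t : 0 <= t -> 0 <= tilt s t := @tilt_ge0 _ s t.
have W0 v w : 0 <= weight (X^~ w) v by apply: weight_ge0 => v'; exact: (family_ge0 famX).
elim/last_ind: u => [|u i IH].
  under eq_integral do rewrite /= /tilt ln1 mulr0 oppr0 expR0 mulr1.
  by rewrite integral_prob_cst.
set v := rcons u i; have v0 : v != [::] by rewrite -size_eq0 size_rcons.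
have nbv : ~ below (size u) v by move=> [_]; rewrite size_rcons ltnn.
under eq_integral do rewrite weight_rcons tiltM ?(family_ge0 famX)// EFinM.
rewrite (indep_integral famX (D1 := below (size u)) (D2 := [set v])
    (F := fun om => (tilt s (weight om u))%:E) (G := fun om => (tilt s (om v))%:E))//.
- rewrite size_rcons exprSr EFinM.
  have -> : (\int[P]_w (tilt s (X v w))%:E = \int[P0]_w (tilt s (X0 w))%:E)%E.
    transitivity (\int[P]_w `|(tilt s (X v w))%:E|)%E.
      by apply: eq_integral => w _; rewrite gee0_abs// lee_fin tg// (family_ge0 famX).
    rewrite (family_integral famX (g := fun t => `|(tilt s t)%:E|%E) v0)//.
      by apply: eq_integral => w _; rewrite gee0_abs// lee_fin tg.
    by apply: measurableT_comp => //; apply/measurable_EFinP; exact: measurable_tilt.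
  apply: lee_pmul => //; apply: integral_ge0 => w _; rewrite lee_fin tg//.
- exact: below_nonroot.
- by move=> _ ->.
- by apply/seteqP; split => // x [xb /= xv]; apply: nbv; rewrite -xv.
- apply/measurable_EFinP; apply: (@measurableT_comp _ _ _ _ _ _ (tilt s) setT).
    exact: measurable_tilt.
  exact: (@measurable_weight_below b R u).
- apply/measurable_EFinP; apply: (@measurableT_comp _ _ _ _ _ _ (tilt s) setT).
    exact: measurable_tilt.
  exact: measurable_coord.
- by move=> w; rewrite lee_fin tg.
- by move=> w; rewrite lee_fin tg// (family_ge0 famX).
Qed.

End tilted_integrals.

(** * Words of low entropy, by universal codes *)

Section coding.
Context {b : nat} {R : realType}.
Local Notation W := (seq (letter b)).
Local Notation fmeasure := {finite_measure set (seq_space b) -> \bar R}.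

Lemma sum_tuple_cst n (c : R) : \sum_(u : n.-tuple (letter b)) c = (b.-1.+1)%:R ^+ n * c.
Proof. by rewrite sumr_const card_tuple card_ord -[LHS]mulr_natl natrX. Qed.

(* A table of counts of the words of length [projT1 p].+1, from which the conditional code
   of a letter given the following [projT1 p] letters is built. *)
Definition code_table : Type := {k : nat & {ffun k.+1.-tuple (letter b) -> nat}}.
HB.instance Definition _ := Countable.on code_table.

Definition code_order (p : code_table) : nat := (projT1 p).+1.

(** The added 1 keeps every conditional probability positive and every cost finite. *)
Definition table_count (p : code_table) (v : W) : R :=
  (if insub v is Some u then projT2 p u else 0)%:R + 1.

(** Minus the logarithm of the conditional probability, according to the table, of the first letter
    of [v] given the rest. *)
Definition letter_cost (p : code_table) (v : W) : R :=
  ln (\sum_(j : letter b) table_count p (j :: behead v)) - ln (table_count p v).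

(** Letters too close to the end to have a full context are free; the constant in [kraft] pays for
    them. *)
Fixpoint code_length (p : code_table) (u : W) : R :=
  if u is _ :: v then
    (if (code_order p <= size u)%N then letter_cost p (take (code_order p) u) else 0)
      + code_length p v
  else 0.

Lemma table_count_gt0 p v : 0 < table_count p v.
Proof. by rewrite ltr_pwDr. Qed.

Lemma sum_table_count_gt0 p v : 0 < \sum_(j : letter b) table_count p (j :: v).
Proof.
rewrite (bigD1 ord0)//= ltr_pwDl ?table_count_gt0//.
by apply: sumr_ge0 => j _; exact/ltW/table_count_gt0.
Qed.

Lemma sum_expR_letter_cost p v :
  \sum_(i : letter b) expR (- letter_cost p (i :: v)) = 1.
Proof.
under eq_bigr => i _ do
  rewrite /letter_cost opprB expRD expRN !lnK ?posrE ?table_count_gt0 ?sum_table_count_gt0//=.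
by rewrite -mulr_suml divff// gt_eqF// sum_table_count_gt0.
Qed.

Lemma letter_cost_ge0 p i v : 0 <= letter_cost p (i :: v).
Proof.
rewrite subr_ge0 ler_ln ?posrE ?table_count_gt0 ?sum_table_count_gt0//=.
rewrite (bigD1 i)//= lerDl; apply: sumr_ge0 => j _; exact/ltW/table_count_gt0.
Qed.

Lemma kraft p n :
  \sum_(u : n.-tuple (letter b)) expR (- code_length p u) <= (b.-1.+1)%:R ^+ code_order p.
Proof.
set B : R := (b.-1.+1)%:R.
have B1 : 1 <= B by rewrite ler1n.
(* Invariant of the induction: while the word is shorter than the order, each free letter costs a
   factor [B]; afterwards the probabilities of the first letter sum to 1. *)
apply: (@le_trans _ _ (B ^+ minn n (code_order p))); last first.
  by rewrite ler_weXn2l// geq_minr.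
elim: n => [|n IH].
  by rewrite (sum_tuple0 (fun u => expR (- code_length p u))) min0n expr0 oppr0 expR0.
rewrite (sum_tuple_cons n (fun u => expR (- code_length p u))) exchange_big /=.
have [kn|nk] := leqP (code_order p) n.+1.
- apply: (@le_trans _ _ (B ^+ minn n (code_order p))); last first.
    by rewrite ler_weXn2l// geq_minr.
  apply: le_trans IH; rewrite le_eqVlt; apply/orP; left; apply/eqP; apply: eq_bigr => v _.
  under eq_bigr => i _ do rewrite size_tuple kn opprD expRD.
  by rewrite -mulr_suml sum_expR_letter_cost mul1r.
- under eq_bigr => v _ do under eq_bigr => i _ do
    rewrite size_tuple leqNgt nk add0r.
  under eq_bigr => v _ do rewrite sumr_const card_ord -mulr_natl.
  rewrite -mulr_sumr exprS ler_wpM2l//.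
  by move: IH; rewrite (minn_idPl _)//; apply: ltnW; apply: ltnW.
Qed.

Definition table_of (j : nat) : code_table :=
  odflt (existT _ 0%N [ffun=> 0%N]) (unpickle j).

Lemma table_of_pickle p : table_of (pickle p) = p.
Proof. by rewrite /table_of pickleK. Qed.

(** The second term offsets the constant of [kraft]; the third gives table [j] a share 2^-(j+1) of
    the total, so that the exponentials of minus the cost sum to at most 1 over words and tables. *)
Definition coded_cost j (u : W) : R :=
  code_length (table_of j) u + (code_order (table_of j))%:R * ln (b.-1.+1)%:R + j.+1%:R * ln 2.

(* This set depends on [q] only: the same words serve all ergodic measures of entropy below [q],
   because there are countably many tables and [coded_cost] charges for the index of the table. *)
Definition short_words (q : R) n : pred W :=
  fun u => [exists j : 'I_n, coded_cost j u <= n%:R * q].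

Lemma sum_half_powers n : \sum_(j < n) expR (- (j.+1%:R * ln 2)) <= 1 :> R.
Proof.
suff -> : \sum_(j < n) expR (- (j.+1%:R * ln 2)) = 1 - expR (- (n%:R * ln 2)) :> R.
  by rewrite lerBlDr lerDl expR_ge0.
elim: n => [|n IH]; first by rewrite big_ord0 mul0r oppr0 expR0 subrr.
rewrite big_ord_recr /= IH -[n.+1%:R]natr1 mulrDl mul1r opprD expRD [expR (- ln 2)]expRN lnK ?posrE//.
by field.
Qed.

Lemma card_short_words q n :
  (\sum_(u : n.-tuple (letter b) | short_words q n u) 1) <= expR (n%:R * q).
Proof.
set B : R := (b.-1.+1)%:R; have B0 : 0 < B by rewrite ltr0n.
apply: (@le_trans _ _ (\sum_(u : n.-tuple (letter b)) \sum_(j < n)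
    expR (n%:R * q - coded_cost j u))).
  rewrite big_mkcond; apply: ler_sum => u _; case: ifP => [/existsP[j ju]|_]; last first.
    by apply: sumr_ge0 => j _; exact: expR_ge0.
  rewrite (bigD1 j)//= -[leLHS]addr0 lerD//.
    by rewrite -[leLHS](expR0 R) ler_expR subr_ge0.
  by apply: sumr_ge0 => i _; exact: expR_ge0.
rewrite exchange_big /= -[leRHS]mulr1.
apply: (@le_trans _ _ (expR (n%:R * q) * \sum_(j < n) expR (- (j.+1%:R * ln 2)))); last first.
  by rewrite ler_wpM2l ?expR_ge0// sum_half_powers.
rewrite mulr_sumr; apply: ler_sum => j _.
under eq_bigr => u _ do
  rewrite /coded_cost opprD opprD expRD expRD expRD.
rewrite -mulr_sumr ler_wpM2l ?expR_ge0// -mulr_suml -[leRHS]mul1r ler_wpM2r ?expR_ge0//.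
rewrite -mulr_suml expRN ler_pdivrMr ?expR_gt0// mul1r expRM_natl lnK ?posrE//.
exact: kraft.
Qed.

(** An inequality, since the Birkhoff sum also charges the last letters, reading their context
    beyond position [n]. *)
Lemma code_length_birkhoff p n x : code_length p (restr x n) <=
  birkhoff_sum (fun y : seq_space b => letter_cost p (restr y (code_order p))) n x.
Proof.
elim: n x => [//|n IH] x.
have -> : code_length p (restr x n.+1) =
    (if (code_order p <= n.+1)%N then letter_cost p (take (code_order p) (restr x n.+1)) else 0)
    + code_length p (restr (shift x) n).
  by rewrite restr_cons /= size_restr.
apply: lerD => //.
by case: ifP => kn; [rewrite take_restr|rewrite restr_cons letter_cost_ge0].
Qed.

Lemma birkhoff_sumB (F : seq_space b -> R) c n x :
  birkhoff_sum (fun y => F y - c) n x = birkhoff_sum F n x - n%:R * c.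
Proof.
elim: n x => [|n IH] x; first by rewrite /= mul0r subr0.
by rewrite /= IH -[n.+1%:R]natr1; ring.
Qed.

Section ergodic_coding.
Variable nu : ergodic_measure b R.
Local Notation a := (mass_of nu).
Let am : is_mass a. Proof. exact: is_mass_of. Qed.
Let a_ge0 u : 0 <= a u. Proof. by case: am. Qed.

(** Otherwise, as the block entropy of order 0 is 0, every block entropy of order k would be at
    least k q. *)
Lemma exists_entropy_increment q : entropy nu < q ->
  exists j, block_entropy a j.+1 - block_entropy a j < q.
Proof.
move=> /entropy_lt_block[k _ kq]; apply: contrapT => nex; move: kq; apply/negP; rewrite -leNgt.
elim: k => [|k IH].
  by rewrite mul0r /block_entropy (sum_tuple0 (fun u => - (a u * ln (a u)))) mass_of_nil_prob
    ln1 mulr0 oppr0.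
rewrite -natr1 mulrDl mul1r -lerBrDl; apply: contrapT => /negP; rewrite -ltNge => lt.
by apply: nex; exists k; move: IH lt; lra.
Qed.

(** Rounded multiples N a(u) give conditional probabilities close to those of [nu], so the mean cost
    approaches the conditional entropy H_(j+1) - H_j. *)
Lemma exists_table q : entropy nu < q ->
  exists p, \int[nu]_x letter_cost p (restr x (code_order p)) < q.
Proof.
move=> /exists_entropy_increment[j Hj].
set B : R := (b.-1.+1)%:R.
pose del := q - (block_entropy a j.+1 - block_entropy a j).
have del0 : 0 < del by rewrite subr_gt0.
(* Rounding costs at most B/N for each of the B^j contexts; this [N] keeps the sum below the margin
   [del]. *)
pose N : R := (Num.truncn (B ^+ j * B / del)).+1%:R.
have N0 : 0 < N by rewrite ltr0n.
have NB : B ^+ j * (B / N) < del.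
  by rewrite mulrA ltr_pdivrMr// -ltr_pdivrMl// mulrC truncnS_gt.
pose p : code_table := existT _ j [ffun u : j.+1.-tuple (letter b) => Num.truncn (N * a u)].
exists p.
have cE u : size u = j.+1 -> table_count p u = (Num.truncn (N * a u))%:R + 1.
  move=> su; rewrite /table_count /=; case: insubP => [v _ <-|]; first by rewrite ffunE.
  by rewrite su eqxx.
have c_lo u : size u = j.+1 -> N * a u <= table_count p u.
  by move=> su; rewrite cE// natr1; apply/ltW/truncnS_gt.
have c_hi u : size u = j.+1 -> table_count p u <= N * a u + 1.
  by move=> su; rewrite cE// lerD2r truncn_le// mulr_ge0// ltW.
have ainv v : a v = \sum_(i : letter b) a (i :: v) by exact: invariant_mass (ergodic_invariant nu) v.
have lc i v : size v = j -> letter_cost p (i :: v) * a (i :: v) <=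
    a (i :: v) * (ln (N * a v + B) - ln N) - a (i :: v) * ln (a (i :: v)).
  move=> sv; have [->|ai0] := eqVneq (a (i :: v)) 0; first by rewrite !(mulr0, mul0r) subr0.
  have aip : 0 < a (i :: v) by rewrite lt_def ai0 a_ge0.
  rewrite mulrC -mulrBr ler_wpM2l ?a_ge0// -addrA lerD//.
  - have S0 := sum_table_count_gt0 p v.
    have SB : \sum_(i0 : letter b) table_count p (i0 :: v) <= N * a v + B.
      rewrite ainv mulr_sumr.
      have -> : B = \sum_(i0 : letter b) 1 by rewrite sumr_const card_ord.
      by rewrite -big_split; apply: ler_sum => i0 _; apply: c_hi; rewrite /= sv.
    by rewrite ler_ln ?posrE//; exact: lt_le_trans SB.
  - rewrite -opprD lerN2 -lnM ?posrE// ler_ln ?posrE ?table_count_gt0 ?mulr_gt0//.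
    by apply: c_lo; rewrite /= sv.
have lv v : a v * (ln (N * a v + B) - ln N) <= a v * ln (a v) + B / N.
  have BN0 : 0 <= B / N by rewrite divr_ge0 ?ler0n// ltW.
  have [->|av0] := eqVneq (a v) 0; first by rewrite !mul0r add0r.
  have avp : 0 < a v by rewrite lt_def av0 a_ge0.
  have -> : N * a v + B = N * (a v * (1 + B / N / a v)) by field; rewrite av0 gt_eqF.
  have p1 : 0 < 1 + B / N / a v by rewrite ltr_pwDl// divr_ge0// ltW.
  rewrite !lnM ?posrE ?mulr_gt0// addrAC subrr add0r mulrDr lerD2l.
  apply: (@le_trans _ _ (a v * (B / N / a v))); last by rewrite mulrCA divff ?mulr1.
  by rewrite ler_wpM2l ?(ltW avp)//; have := ln_le_subr1 p1; rewrite addrAC subrr add0r.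
rewrite (Rint_restr nu _ (letter_cost p)) -[code_order p]/(j.+1).
apply: (@le_lt_trans _ _ (block_entropy a j.+1 - block_entropy a j + B ^+ j * (B / N))); last first.
  by move: NB; rewrite /del ltrBrDl.
rewrite (sum_tuple_cons _ (fun u => letter_cost p u * a u)).
rewrite {1}/block_entropy (sum_tuple_cons _ (fun u => - (a u * ln (a u)))).
rewrite exchange_big [X in _ <= X - _ + _]exchange_big /=.
rewrite -sum_tuple_cst /block_entropy -sumrN -!big_split /=.
apply: ler_sum => v _.
apply: (@le_trans _ _ (\sum_i (a (i :: v) * (ln (N * a v + B) - ln N) - a (i :: v) * ln (a (i :: v))))).
  by apply: ler_sum => i _; apply: lc; rewrite size_tuple.
rewrite big_split /= -mulr_suml -ainv opprK -addrA addrC lerD2l; exact: lv.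
Qed.

Lemma short_words_cvg q : entropy nu < q ->
  \sum_(u : n.-tuple (letter b) | ~~ short_words q n u) a u @[n --> \oo] --> (0 : R).
Proof.
move=> /exists_table[p pq].
pose F (x : seq_space b) := letter_cost p (restr x (code_order p)).
set c := \int[nu]_x F x in pq.
(* One third of the gap makes the mean of [G] negative, one is the threshold in [birkhoff_lln], and
   one covers the fixed overhead [K]. *)
pose e := (q - c) / 3.
have e0 : 0 < e by rewrite divr_gt0// subr_gt0.
have [C [C0 FC]] := tuple_bounded (code_order p) (fun u => letter_cost p u).
have mF : measurable_fun setT F by exact: measurable_restr.
pose G x := F x - (c + e).
have mG : measurable_fun setT G by exact: measurable_funB.
have GC x : `|G x| <= C + `|c + e|.
  by apply: le_trans (ler_normB _ _) _; rewrite lerD2r FC// size_restr.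
have iF : nu.-integrable setT (EFin \o F) by exact: intg_restr.
have GI : \int[nu]_x G x < 0.
  by rewrite RintegralB// ?Rint_prob_cst -/c; [move: e0; lra|exact: intg_cst].
have lln := birkhoff_lln mG GC (@ergodic_invariant _ _ nu) (@ergodic_zero_total _ _ nu) GI e0.
pose K : R := (code_order p)%:R * ln (b.-1.+1)%:R + (pickle p).+1%:R * ln 2.
(* From [M] on, the table [p] is among the first n tables and the overhead [K] is below n e. *)
pose M := maxn (pickle p).+1 (Num.truncn (K / e)).+1.
rewrite -(cvg_shiftn M); rewrite -(cvg_shiftn M) in lln.
apply: (squeeze_cvgr _ (cvg_cst 0) lln).
apply: nearW => n; set m := (n + M)%N.
have pm : (pickle p < m)%N by rewrite /m /M; lia.
have Ke : K < m%:R * e.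
  rewrite -ltr_pdivrMr//; apply: (lt_le_trans (truncnS_gt _)); rewrite ler_nat; exact: leq_trans (leq_maxr _ _) (leq_addl _ _).
rewrite sumr_ge0//= -/m.
have -> : \sum_(u : m.-tuple (letter b) | ~~ short_words q m u) a u =
    \int[nu]_x (~~ short_words q m (restr x m))%:R.
  rewrite (Rint_restr nu m (fun u => (~~ short_words q m u)%:R)) big_mkcond.
  by apply: eq_bigr => u _; case: (~~ _); rewrite ?mul1r ?mul0r.
apply: Rint_le.
- exact: (intg_restr nu m (fun u => (~~ short_words q m u)%:R)).
- apply: (@intg_bounded _ _ _ _ _ 1); last first.
    by move=> x; rewrite ger0_norm ?ler0n// lern1 leq_b1.
  apply: measurable_ler_nat.
  by elim: m {pm Ke} => [|m IH] /=; [exact: measurable_cst|apply: measurable_funD => //; apply: measurableT_comp => //; exact: measurable_shift].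
move=> x; rewrite ler_nat; case: (boolP (short_words q m (restr x m))) => //= nsw.
suff -> : m%:R * e <= birkhoff_sum G m x by [].
apply: contraNT nsw; rewrite -ltNge birkhoff_sumB => lt.
apply/existsP; exists (Ordinal pm); rewrite /coded_cost /= table_of_pickle.
have := code_length_birkhoff p m x; rewrite -/F.
have -> : m%:R * q = m%:R * c + 3 * (m%:R * e) by rewrite /e; field.
by move: lt Ke; rewrite /K; lra.
Qed.

End ergodic_coding.
End coding.

Lemma min_sum_le {R : realType} (I : Type) (s : seq I) (y : I -> R) : (forall i, 0 <= y i) ->
  Num.min (\sum_(i <- s) y i) 1 <= \sum_(i <- s) Num.min (y i) 1.
Proof.
move=> y0; elim: s => [|i s IH]; first by rewrite !big_nil ge_min lexx.
rewrite !big_cons; have : 0 <= \sum_(j <- s) y j by exact: sumr_ge0.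
set S := \sum_(j <- s) y j => S0; apply: (@le_trans _ _ (Num.min (y i) 1 + Num.min S 1)).
  have [yi1|yi1] := leP (y i) 1.
    have [S1|S1] := leP S 1; first by rewrite ge_min lexx.
    by rewrite ge_min lerDr y0 orbT.
  by rewrite ge_min [1 <= _]lerDl le_min S0 ler01 orbT.
by rewrite lerD2l.
Qed.

Section truncated_limit.
Context {b : nat} {R : realType} d0 (T0 : measurableType d0) (P0 : probability T0 R).
Variable X0 : {RV P0 >-> R}.
Hypothesis X0_ge0 : forall w, 0 <= X0 w.
Hypothesis X0_mean : ('E_P0[X0] = 1)%E.
Context d (T : measurableType d) (P : probability T R) (X : seq (letter b) -> T -> R).
Hypothesis famX : cascade_family X0 P X.
Local Notation om w := (X^~ w).
Variable a : seq (letter b) -> R.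
Hypothesis am : is_mass a.

Let a_ge0 u : 0 <= a u. Proof. by case: am. Qed.
Let W0 u w : 0 <= weight (om w) u.
Proof. by apply: weight_ge0 => v; exact: (family_ge0 famX). Qed.
Let mW u : measurable_fun setT (fun w => weight (om w) u).
Proof. exact: (measurable_env_path famX (@measurable_weight_below b R u)). Qed.
Let mY n : measurable_fun setT (fun w => cascade_mass a (om w) n).
Proof. exact: (measurable_mass_path famX). Qed.
Let Y0 n w : 0 <= cascade_mass a (om w) n.
Proof. exact: (mass_path_ge0 famX). Qed.

(* A word of [G] is cut at weight [expR (n * h)]: below the cut the tilted moment is exponentially
   small, and by Markov's inequality it is unlikely that a word of [G] exceeds the cut. *)
Lemma integral_min_mass_le (G : pred (seq (letter b))) n (q h r s : R) :
  0 < s -> (\int[P0]_w (tilt s (X0 w))%:E <= (1 - s * r)%:E)%E ->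
  \sum_(u : n.-tuple (letter b) | G u) 1 <= expR (n%:R * q) ->
  (\int[P]_w (Num.min (cascade_mass a (om w) n) 1)%:E <=
   (\sum_(u : n.-tuple (letter b) | ~~ G u) a u +
    (expR (- (n%:R * (s * (r - h)))) * a [::] + expR (- (n%:R * (h - q)))))%:E)%E.
Proof.
move=> s0 tphi cG.
pose K := expR (n%:R * h); have K0 : 0 < K := expR_gt0 _.
have tphi' : (\int[P0]_w (tilt s (X0 w))%:E <= (expR (- (s * r)))%:E)%E.
  by apply: le_trans tphi _; rewrite lee_fin; exact: expR_ge1Dx.
pose t u w := tilt s (weight (om w) u).
have t0 u w : 0 <= t u w by exact: tilt_ge0.
have mt u : measurable_fun setT (t u).
  by apply: (@measurableT_comp _ _ _ _ _ _ (tilt s) setT) => //; exact: measurable_tilt.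
pose Z1 w := \sum_(u : n.-tuple (letter b)) (~~ G u)%:R * a u * weight (om w) u.
pose Z2 w := \sum_(u : n.-tuple (letter b)) (G u)%:R * a u * expR (s * ln K) * t u w.
pose Z3 w := \sum_(u : n.-tuple (letter b)) (G u)%:R / K * weight (om w) u.
have c1_ge0 (u : n.-tuple (letter b)) : 0 <= (~~ G u)%:R * a u by rewrite mulr_ge0.
have c2_ge0 (u : n.-tuple (letter b)) : 0 <= (G u)%:R * a u * expR (s * ln K).
  by rewrite !mulr_ge0// expR_ge0.
have c3_ge0 (u : n.-tuple (letter b)) : 0 <= (G u)%:R / K by rewrite divr_ge0// ltW.
have Z1_0 w : 0 <= Z1 w by apply: sumr_ge0 => u _; rewrite mulr_ge0.
have Z2_0 w : 0 <= Z2 w by apply: sumr_ge0 => u _; rewrite mulr_ge0.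
have Z3_0 w : 0 <= Z3 w by apply: sumr_ge0 => u _; rewrite mulr_ge0.
have mZ1 : measurable_fun setT Z1.
  by apply: measurable_sum => u; exact: measurable_funM.
have mZ2 : measurable_fun setT Z2.
  by apply: measurable_sum => u; exact: measurable_funM.
have mZ3 : measurable_fun setT Z3.
  by apply: measurable_sum => u; exact: measurable_funM.
have mZ23 := measurable_funD mZ2 mZ3.
have Z23_0 w : 0 <= Z2 w + Z3 w by exact: addr_ge0.
apply: (@le_trans _ _ (\int[P]_w (Z1 w + (Z2 w + Z3 w))%:E)%E).
  apply: ge0_le_integral => //.
  - by move=> w _; rewrite lee_fin le_min Y0 ler01.
  - by apply/measurable_EFinP; exact: measurable_minr.
  - by apply/measurable_EFinP; exact: measurable_funD.
  move=> w _; rewrite lee_fin /Z1 /Z2 /Z3 /cascade_mass.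
  apply: le_trans (min_sum_le _ _) _ => [u|]; first by rewrite mulr_ge0.
  rewrite -!big_split /=; apply: ler_sum => u _.
  case: (G u) => /=; rewrite ?(mul1r, mul0r, add0r, addr0); last by rewrite ge_min lexx.
  apply: le_trans (min_mul_tilt (a_ge0 u) (W0 u w) (ltW s0) K0) _.
  by rewrite mulrA [X in _ + X]mulrC.
rewrite (ge0_integralD_EFin P mZ1 mZ23 Z1_0 Z23_0) (ge0_integralD_EFin P mZ2 mZ3 Z2_0 Z3_0).
rewrite !EFinD; apply: leeD; [|apply: leeD].
- rewrite (@ge0_integral_sumr _ _ _ P _ _ (fun (u : n.-tuple (letter b)) w => (~~ G u)%:R * a u * weight (om w) u)); last 2 first.
  + by move=> u; exact: measurable_funM.
  + by move=> u w; rewrite !mulr_ge0.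
  rewrite [X in (_ <= X%:E)%E]big_mkcond /= -sumEFin; apply: lee_sum => u _.
  rewrite ge0_integralZr_EFin// (integral_weight X0_ge0 X0_mean famX) mule1 lee_fin.
  by case: (G u); rewrite /= ?mul1r ?mul0r.
- rewrite (@ge0_integral_sumr _ _ _ P _ _ (fun (u : n.-tuple (letter b)) w => (G u)%:R * a u * expR (s * ln K) * t u w)); last 2 first.
  + by move=> u; exact: measurable_funM.
  + by move=> u w; rewrite !mulr_ge0 ?expR_ge0.
  rewrite (mass_sum0 n am) mulr_sumr -sumEFin; apply: lee_sum => u _.
  rewrite ge0_integralZr_EFin//.
  apply: (@le_trans _ _ ((a u * expR (s * ln K))%:E * (expR (- (s * r)) ^+ n)%:E)%E).
    apply: lee_pmul.
    + by rewrite lee_fin.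
    + by apply: integral_ge0 => w _; rewrite lee_fin.
    + rewrite lee_fin ler_wpM2r ?expR_ge0// ler_piMl// lern1 leq_b1//.
    + by have := integral_tilt_weight X0_ge0 famX u (expR_ge0 _) tphi'; rewrite size_tuple.
  rewrite -EFinM lee_fin /K expRK -expRM_natl -mulrA -expRD [leRHS]mulrC ler_wpM2l//.
  by rewrite ler_expR; lra.
- rewrite (@ge0_integral_sumr _ _ _ P _ _ (fun (u : n.-tuple (letter b)) w => (G u)%:R / K * weight (om w) u)); last 2 first.
  + by move=> u; exact: measurable_funM.
  + by move=> u w; rewrite mulr_ge0// divr_ge0// ltW.
  apply: (@le_trans _ _ (expR (n%:R * q) / K)%:E); last first.
    by rewrite /K -expRN -expRD lee_fin ler_expR; lra.
  apply: (@le_trans _ _ ((\sum_(u : n.-tuple (letter b) | G u) 1) / K)%:E); last first.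
    by rewrite lee_fin ler_wpM2r// invr_ge0 ltW.
  rewrite mulr_suml [X in (_ <= X%:E)%E]big_mkcond /= -sumEFin; apply: lee_sum => u _.
  rewrite ge0_integralZr_EFin// (integral_weight X0_ge0 X0_mean famX) mule1 lee_fin.
  by case: (G u); rewrite /= ?mul0r.
Qed.

Let Lr w := fine (limit_mass a (om w)).

(** Truncation at 1 makes the passage to the limit dominated. The level [eps] leaves room for the
    part of a mixture that the short words fail to cover. *)
Lemma min_limit_mass_le (q eps : R) (r : nat -> R) :
  (q%:E < 'E_P0[(fun w => X0 w * ln (X0 w))%R])%E ->
  (forall n, \sum_(u : n.-tuple (letter b) | ~~ short_words q n u) a u <= r n) ->
  r n @[n --> \oo] --> eps ->
  \int[P]_w Num.min (Lr w) 1 <= eps.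
Proof.
move=> qh ar reps.
have [h qh1 hE] : exists2 h, q < h & (h%:E < 'E_P0[(fun w => X0 w * ln (X0 w))%R])%E.
  move: qh; case: ('E_P0[_])%E => [e|_|//]; last by exists (q + 1); rewrite ?ltry ?ltrDl.
  by rewrite lte_fin => /midf_lt[m1 m2]; exists ((q + e) / 2).
have [s /andP[s0 _] ts] := exists_tilt X0_ge0 X0_mean hE.
(* The cut lies strictly between [q] and [h], which makes both exponents s (h - h') and h' - q
   positive. *)
pose h' := (q + h) / 2.
have [qh' h'h] := midf_lt qh1.
have B n : \int[P]_w Num.min (cascade_mass a (om w) n) 1 <=
    r n + (expR (- (n%:R * (s * (h - h')))) * a [::] + expR (- (n%:R * (h' - q)))).
  have mm : measurable_fun setT (fun w => Num.min (cascade_mass a (om w) n) 1).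
    exact: measurable_minr.
  have im : P.-integrable setT (EFin \o (fun w => Num.min (cascade_mass a (om w) n) 1)).
    apply: (@intg_bounded _ _ _ _ _ 1) => // w.
    by rewrite ger0_norm ?le_min ?Y0 ?ler01// ge_min lexx orbT.
  rewrite -lee_fin -Rint_EFin//.
  apply: (le_trans (integral_min_mass_le h' s0 ts (card_short_words q n))).
  by rewrite lee_fin lerD2r.
have e0 (c : R) : 0 < c -> expR (- (n%:R * c)) @[n --> \oo] --> (0 : R).
  move=> c0.
  have -> : (fun n => expR (- (n%:R * c))) = (fun n => expR (- c) ^+ n).
    by apply/funext => n; rewrite -expRM_natl mulrN.
  by apply: cvg_expr; rewrite ger0_norm ?expR_ge0// -(expR0 R) ltr_expR oppr_lt0.
have C1 : r n + (expR (- (n%:R * (s * (h - h')))) * a [::] + expR (- (n%:R * (h' - q))))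
    @[n --> \oo] --> eps.
  rewrite -[X in _ --> X]addr0 -[X in _ --> _ + X]addr0; apply: cvgD => //.
  apply: cvgD; last by apply: e0; rewrite subr_gt0.
  rewrite -(mul0r (a [::])); apply: cvgM; last exact: cvg_cst.
  by apply: e0; rewrite mulr_gt0// subr_gt0.
have mL : measurable_fun setT Lr.
  by apply: measurableT_comp => //; exact: (measurable_limit_path famX).
have L0 w : 0 <= Lr w by apply: fine_ge0; exact: (limit_path_ge0 famX).
have C2 : \int[P]_w Num.min (cascade_mass a (om w) n) 1 @[n --> \oo] -->
    \int[P]_w Num.min (Lr w) 1.
  apply: (@Rint_DCT _ _ _ P _ _ (fun=> 1)).
  - by move=> n; exact: measurable_minr.
  - exact: measurable_minr.
  - exact: intg_cst.
  - by move=> n w; rewrite ger0_norm ?le_min ?Y0 ?ler01// ge_min lexx orbT.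
  have := limit_mass_cvg famX X0_ge0 X0_mean am; apply: filterS => w [_ cw].
  have cm : {for Lr w, continuous ((@idfun R : R -> R^o) \min cst 1)}.
    by apply: (@continuous_min R R); [exact: cvg_id|exact: cvg_cst].
  exact: (continuous_cvg _ cm cw).
by apply: (ler_cvg_to C2 C1); exact: nearW.
Qed.
End truncated_limit.

(** * Mixtures of ergodic measures *)

Lemma integral_setE d (T : measurableType d) (R : realType) (m : {measure set T -> \bar R})
    (S : set T) (g : T -> R) :
  (\int[m]_(x in S) (g x)%:E = \int[m]_x (\1_S x * g x)%:E)%E.
Proof.
rewrite integral_mkcond; apply: eq_integral => x _; rewrite patchE indicE.
by case: (x \in S); rewrite ?mul1r ?mul0r.
Qed.

Section measure_integrals.
Context {b : nat} {R : realType}.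
Local Notation E := (ergodic_measure b R).
Local Notation fmeasure := {finite_measure set (seq_space b) -> \bar R}.

Lemma measurable_Rint_ergodic (f : seq_space b -> R) : continuous f ->
  measurable_fun setT (fun nu : E => \int[nu]_x f x).
Proof.
move=> cf; pose i : {f : seq_space b -> R | continuous f} := exist _ f cf.
have ci : continuous (fun nu : E => test_integrals nu i).
  move=> nu; apply: (@continuous_comp _ _ _ (@test_integrals b R) (fun g => g i)).
    exact: (@initial_continuous _ _ (@test_integrals b R)).
  have h := @proj_continuous {classic {f : seq_space b -> R | continuous f}} (fun=> R : topologicalType) i (test_integrals nu). exact: h.
apply: (measurability _ (RGenOpens.measurableE R)) => _ [_ [c [e ->] <-]].
rewrite setTI; apply: sub_sigma_algebra.
by apply: (@open_comp _ _ (fun nu : E => test_integrals nu i)) => // x _; exact: ci.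
Qed.

Lemma measurable_mass_of u : measurable_fun setT (fun nu : E => mass_of nu u).
Proof.
under eq_fun do rewrite -Rint_eqw.
by apply: measurable_Rint_ergodic; exact: (@continuous_restr b R _ (fun w => (w == u)%:R)).
Qed.

Lemma measurable_entropy : measurable_fun setT (@entropy b R).
Proof.
apply: (@measurable_fun_cvg _ E R setT (fun n (nu : E) => n%:R^-1 * block_entropy (mass_of nu) n)).
- move=> n; apply: measurable_funM => //; apply: measurable_sum => u.
  apply: measurableT_comp => //; apply: measurable_funM; first exact: measurable_mass_of.
  by apply: measurableT_comp; [exact: measurable_ln|exact: measurable_mass_of].
- by move=> nu _; exact: entropy_cvg.
Qed.

Lemma measurable_entropy_gt (h : \bar R) : measurable [set nu : E | (h < (entropy nu)%:E)%E].
Proof.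
have := measurable_entropy => /measurable_EFinP /(_ measurableT _ (emeasurable_itv `]h, +oo[)).
rewrite setTI; congr measurable; apply/seteqP; split => nu /=; rewrite in_itv /= andbT//.
Qed.

Lemma measurable_entropy_lt (h : \bar R) : measurable [set nu : E | ((entropy nu)%:E < h)%E].
Proof.
have := measurable_entropy => /measurable_EFinP /(_ measurableT _ (emeasurable_itv `]-oo, h[)).
rewrite setTI; congr measurable; apply/seteqP; split => nu /=; rewrite in_itv //=.
Qed.

Section integral.
Variables (rho : probability E R) (S : set E) (N : E -> fmeasure).
Hypothesis mS : measurable S.

(** Indicators of cylinders are continuous, hence admissible test functions. *)
Lemma measure_integral_cylinder (M : fmeasure) u : is_measure_integral rho S N M ->
  ((mass_of M u)%:E = \int[rho]_(nu in S) (mass_of (N nu) u)%:E)%E.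
Proof.
have K (m : fmeasure) : (\int[m]_x ((restr x (size u) == u)%:R)%:E = (mass_of m u)%:E)%E.
  rewrite Rint_EFin; last exact: (intg_restr m (size u) (fun w => (w == u)%:R)).
  by rewrite -Rint_eqw.
move=> /(_ _ (@continuous_restr b R (size u) (fun w => (w == u)%:R))).
by rewrite K => ->; apply: eq_integral => nu _; rewrite K.
Qed.

Hypothesis mN : forall u, measurable_fun setT (fun nu => mass_of (N nu) u).

(** The converse: Riemann sums carry the identity from cylinders to continuous [f], dominated by a
    bound of [f] times the total mass of [N nu] on [S]. *)
Lemma is_measure_integralP (M : fmeasure) :
  (forall u, (mass_of M u)%:E = \int[rho]_(nu in S) (mass_of (N nu) u)%:E)%E ->
  is_measure_integral rho S N M.
Proof.
move=> MN f cf.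
pose m u nu := \1_S nu * mass_of (N nu) u.
have m0 u nu : 0 <= m u nu by rewrite mulr_ge0 ?fine_ge0// measure_ge0.
have mm u : measurable_fun setT (m u) by apply: measurable_funM => //; exact: measurable_indic.
have MN' u : ((mass_of M u)%:E = \int[rho]_nu (m u nu)%:E)%E.
  by rewrite MN integral_setE.
have im u : rho.-integrable setT (EFin \o m u).
  apply/integrableP; split; first exact/measurable_EFinP.
  by under eq_integral do rewrite /= ger0_norm//; rewrite -MN' ltry.
have [C [C0 fC]] := continuous_bounded cf.
have Sf nu : \1_S nu * \int[N nu]_x f x = \int[N nu]_x (\1_S nu * f x).
  by rewrite RintegralZl//; exact: intg_continuous.
pose s k nu := \sum_(u : k.-tuple (letter b)) f (pad u) * m u nu.
have ms k : measurable_fun setT (s k).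
  by apply: measurable_sum => u; exact: measurable_funM.
have cs nu : s k nu @[k --> \oo] --> \1_S nu * \int[N nu]_x f x.
  have -> : s^~ nu = (fun k => \1_S nu * \sum_(u : k.-tuple (letter b)) f (pad u) * mass_of (N nu) u).
    by apply/funext => k; rewrite /s mulr_sumr; apply: eq_bigr => u _; rewrite /m mulrCA.
  by apply: cvgM; [exact: cvg_cst|exact: cvg_Rint_continuous].
have mI : measurable_fun setT (fun nu => \1_S nu * \int[N nu]_x f x).
  by apply: (@measurable_fun_cvg _ _ _ _ s) => // nu _; exact: cs.
have sC k nu : `|s k nu| <= C * m [::] nu.
  apply: le_trans (ler_norm_sum _ _ _) _.
  have -> : m [::] nu = \sum_(u : k.-tuple (letter b)) m u nu.
    by rewrite /m (mass_sum0 k (is_mass_of _)) mulr_sumr.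
  by rewrite mulr_sumr; apply: ler_sum => u _; rewrite normrM (ger0_norm (m0 _ _)) ler_wpM2r.
have IC nu : `|\1_S nu * \int[N nu]_x f x| <= C * m [::] nu.
  apply: (cvg_to_const_le (u := fun k => `|s k nu|)) => [|k]; last exact: sC.
  exact: cvg_norm.
have iC : rho.-integrable setT (EFin \o (fun nu => C * m [::] nu)) by exact: intgZ.
have E1 : (\int[rho]_(nu in S) \int[N nu]_x (f x)%:E =
           (\int[rho]_nu (\1_S nu * \int[N nu]_x f x))%:E)%E.
  rewrite -Rint_EFin; last first.
    apply: intg_le iC => // nu; apply: le_trans (IC nu) _; exact: ler_norm.
  rewrite -integral_setE//; apply: eq_integral => nu _.
  by rewrite Rint_EFin//; exact: intg_continuous.
rewrite E1 Rint_EFin; last exact: intg_continuous.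
have mE u : mass_of M u = \int[rho]_nu m u nu.
  by apply: EFin_inj; rewrite MN' Rint_EFin.
have D : \int[rho]_nu s k nu @[k --> \oo] --> \int[rho]_nu (\1_S nu * \int[N nu]_x f x).
  apply: (@Rint_DCT _ _ _ rho _ _ (fun nu => C * m [::] nu)) => //.
  by apply: nearW => nu; exact: cs.
congr EFin; apply: (@cvg_unique R _ (\int[rho]_nu s k nu @[k --> \oo]));
  [exact: Rhausdorff| |exact: D].
suff <- : (fun k => \sum_(u : k.-tuple (letter b)) f (pad u) * mass_of M u) =
    (fun k => \int[rho]_nu s k nu) by exact: cvg_Rint_continuous.
apply/funext => k; rewrite Rint_sum => [|u _]; last exact: intgZ.
by apply: eq_bigr => u _; rewrite RintegralZl// -mE.
Qed.

End integral.

Lemma exists_measure_integral (rho : probability E R) (S : set E) : measurable S ->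
  exists M, is_measure_integral rho S (fun nu => nu : fmeasure) M.
Proof.
move=> mS; pose m u (nu : E) := \1_S nu * mass_of nu u.
have m0 u nu : 0 <= m u nu by rewrite mulr_ge0 ?fine_ge0// measure_ge0.
have mm u : measurable_fun setT (m u).
  by apply: measurable_funM; [exact: measurable_indic|exact: measurable_mass_of].
have im u : rho.-integrable setT (EFin \o m u).
  apply: (@intg_bounded _ _ _ _ _ 1) => // nu; rewrite ger0_norm// /m.
  by rewrite -[leRHS]mulr1 ler_pM ?fine_ge0 ?measure_ge0 ?mass_le1// indicE lern1 leq_b1.
have [|M ME] := @mass_extension b R (fun u => \int[rho]_nu m u nu).
  split=> u; first by apply: Rintegral_ge0.
  rewrite -Rint_sum//; apply: eq_Rintegral => nu _.
  by rewrite /m -mulr_sumr; congr (_ * _); case: (is_mass_of (nu : fmeasure)).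
exists M; apply: is_measure_integralP => // [u|u]; first exact: measurable_mass_of.
by rewrite -mass_ofE integral_setE Rint_EFin; [exact: ME|exact: im].
Qed.

End measure_integrals.

(** * From limits of masses to weak convergence *)

Section weak_limit.
Context {b : nat} {R : realType} d (T : measurableType d).
Variables (X : seq (letter b) -> T -> R) (w : T).
Local Notation om := (X^~ w).
Local Notation fmeasure := {finite_measure set (seq_space b) -> \bar R}.

Lemma cascade_densityE n x : cascade_density X n w x = weight om (restr x n).
Proof.
elim: n => [|n IH]; first by rewrite /cascade_density big_geq.
by rewrite restrS weight_rcons -IH /cascade_density big_nat_recr//= restrS.
Qed.

Hypothesis om_ge0 : forall v, 0 <= X v w.

Lemma is_cascade_limit_of (mu M : fmeasure) : good_env (mass_of mu) om ->
  (forall u, mass_of M u = limit_of (mass_of mu) om u) -> is_cascade_limit X mu w M.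
Proof.
set a := mass_of mu => gd ME f cf.
have am : is_mass a := is_mass_of mu.
have [C [C0 fC]] := continuous_bounded cf.
have mf := measurable_continuous cf.
pose wt n x := weight om (restr x n).
have wt0 n x : 0 <= wt n x by exact: weight_ge0.
have iwt n : mu.-integrable setT (EFin \o wt n) by exact: (intg_restr mu n (weight om)).
have ifw n (g : seq_space b -> R) (D : R) : measurable_fun setT g -> (forall x, `|g x| <= D) ->
    mu.-integrable setT (EFin \o (fun x => g x * wt n x)).
  move=> mg gD; apply: (intg_le (g := fun x => D * wt n x)); last exact: intgZ.
    by apply: measurable_funM => //; exact: (measurable_restr n (weight om)).
  by move=> x; rewrite !normrM ler_wpM2r// (le_trans (gD x))// ler_norm.
have Yw n : \int[mu]_x wt n x = cascade_mass a om n.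
  by rewrite /wt Rint_restr; apply: eq_bigr => u _; rewrite mulrC.
rewrite Rint_EFin; last exact: intg_continuous.
have -> : (fun n => \int[mu]_x (f x * cascade_density X n w x)%:E)%E =
    (fun n => (\int[mu]_x (f x * wt n x))%:E).
  apply/funext => n; rewrite -Rint_EFin; last exact: ifw fC.
  by apply: eq_integral => x _; rewrite cascade_densityE.
apply/cvg_EFin; first exact: nearW.
pose L := limit_of a om [::].
have L0 : 0 <= L by exact: limit_of_ge0.
have YL : cascade_mass a om n @[n --> \oo] --> L.
  by have := gd [::]; rewrite !subtree_nil /L limit_of_nil => -[].
apply/cvgrPdist_le => e' e'0.
(* The errors are e L under the limit measure, e for the approximating function of the first [k]
   letters, and e (L + 1) under the finite cascade once its mass is below L + 1. *)
pose e := e' / (2 * L + 2).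
have L2 : 0 < 2 * L + 2 by rewrite ltr_wpDl// mulr_ge0.
have e0 : 0 < e by rewrite divr_gt0.
have [k kP] := continuous_approx_pad cf e0.
pose g (u : seq (letter b)) := f (pad u).
pose fk x := g (restr x k).
have fkf x : `|f x - fk x| <= e by exact: kP.
have mfk : measurable_fun setT fk by exact: measurable_restr.
have fkC x : `|fk x| <= C by exact: fC.
have BE m : \int[mu]_x (fk x * wt (k + m) x) = \sum_(u : k.-tuple (letter b))
    g u * (weight om u * cascade_mass (subtree a u) (subtree om u) m).
  transitivity (\int[mu]_x ((fun u => g (take k u) * weight om u) (restr x (k + m)))).
    by apply: eq_Rintegral => x _ /=; rewrite take_restr ?leq_addr.
  rewrite (Rint_restr mu (k + m) (fun u => g (take k u) * weight om u)).
  rewrite (sum_tuple_cat k m (fun u => g (take k u) * weight om u * a u)).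
  apply: eq_bigr => u _; rewrite /cascade_mass !mulr_sumr; apply: eq_bigr => v _.
  by rewrite take_size_cat ?size_tuple// weight_cat /subtree; ring.
have cB : \int[mu]_x (fk x * wt (k + m) x) @[m --> \oo] --> \int[M]_x fk x.
  under eq_fun do rewrite BE.
  rewrite /fk Rint_restr; apply: cvg_sumr => u; apply: cvgM; first exact: cvg_cst.
  by rewrite ME; exact: cvg_limit_of.
have ML : \int[M]_x e = e * L by rewrite Rint_cst1 ME.
have dM : `|\int[M]_x f x - \int[M]_x fk x| <= e * L.
  rewrite -RintegralB//; [|exact: intg_continuous|exact: intg_restr].
  rewrite -ML; apply: le_trans (le_normr_Rintegral _ _) _ => //.
    by apply: intgB; [exact: intg_continuous|exact: intg_restr].
  apply: Rint_le => //; last exact: intg_cst.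
  by apply: intg_abs; apply: intgB; [exact: intg_continuous|exact: intg_restr].
have dmu n : `|\int[mu]_x (f x * wt n x) - \int[mu]_x (fk x * wt n x)| <= e * cascade_mass a om n.
  have i1 := ifw n f C mf fC; have i2 := ifw n fk C mfk fkC.
  rewrite -RintegralB// -Yw -RintegralZl//.
  apply: le_trans (le_normr_Rintegral _ _) _ => //; first exact: intgB.
  apply: Rint_le => //; [by apply: intg_abs; exact: intgB|exact: intgZ|].
  by move=> x; rewrite -mulrBl normrM (ger0_norm (wt0 n x)) ler_wpM2r.
have [N1 _ N1P] := (@cvgrPdist_le _ _ _ _ _ _ _).1 cB e e0.
have [N2 _ N2P] := (@cvgrPdist_le _ _ _ _ _ _ _).1 YL 1 ltr01.
exists (N1 + N2 + k)%N => // n /= nN.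
have kn : (k + (n - k) = n)%N by lia.
have H4 : `|\int[M]_x fk x - \int[mu]_x (fk x * wt n x)| <= e.
  by rewrite -[in X in wt X]kn; apply: N1P => /=; lia.
have H3 : `|L - cascade_mass a om n| <= 1 by apply: N2P => /=; lia.
have H1 := dM; have H2 := dmu n.
have Y1 : cascade_mass a om n <= L + 1 by move: H3; rewrite ler_norml; lra.
have eE : e' = e * L + e + e * (L + 1) by rewrite /e; field; rewrite gt_eqF.
have := ler_wpM2l (ltW e0) Y1.
rewrite eE; move: H1 H2 H4; rewrite !ler_norml; lra.
Qed.

End weak_limit.

Section measurable_good_env.
Context {b : nat} {R : realType} d (T : measurableType d).
Variables (a om : T -> seq (letter b) -> R).
Hypothesis ma : forall u, measurable_fun setT (a^~ u).
Hypothesis mom : forall u, measurable_fun setT (om^~ u).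
Local Notation mass x u n := (cascade_mass (subtree (a x) u) (subtree (om x) u) n).
Local Notation lim x u := (limit_mass (subtree (a x) u) (subtree (om x) u)).

Lemma measurable_weight_subtree u v : measurable_fun setT (fun x => weight (subtree (om x) u) v).
Proof.
elim: v u => [|i v IH] u; first exact: measurable_cst.
apply: measurable_funM; first exact: mom.
by have := IH (u ++ [:: i]); under eq_fun do rewrite subtree_cat.
Qed.

Lemma measurable_mass_subtree u n : measurable_fun setT (fun x => mass x u n).
Proof.
apply: measurable_sum => v; apply: measurable_funM; first exact: ma.
exact: measurable_weight_subtree.
Qed.

Lemma measurable_limit_subtree u : measurable_fun setT (fun x => lim x u).
Proof.
apply: measurable_limn_einf => n; apply/measurable_EFinP; exact: measurable_mass_subtree.
Qed.

(** Convergence means that an upper limit of distances is 0, for countably many words. Mass and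
    environment both depend on [x], so that the lemma serves in omega, in nu, and jointly. *)
Lemma measurable_good_env : measurable [set x | good_env (a x) (om x)].
Proof.
pose dist u n x := (`|mass x u n - fine (lim x u)|)%:E.
have mdist u n : measurable_fun setT (dist u n).
  apply/measurable_EFinP; apply: measurableT_comp => //; apply: measurable_funB.
    exact: measurable_mass_subtree.
  by apply: measurableT_comp => //; exact: measurable_limit_subtree.
have -> : [set x | good_env (a x) (om x)] =
    \bigcap_(u in setT) ([set x | lim x u \is a fin_num] `&`
      (fun x => limn_esup (dist u ^~ x)) @^-1` [set 0%E]).
  apply/seteqP; split => x /=.
    move=> gx u _; have [lfin lcvg] := gx u; split => //=.
    have c0 : dist u n x @[n --> \oo] --> 0%E.
      apply: cvg_EFin; first exact: nearW.
      rewrite -[X in _ --> X](normr0 R) -(subrr (fine (lim x u))).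
      by apply: cvg_norm; apply: cvgB => //; exact: cvg_cst.
    by rewrite is_cvg_limn_esupE; [exact: cvg_lim c0|apply/cvg_ex; exists 0%E].
  move=> H u; have [/= lfin l0] := H u I; split => //.
  have c0 : dist u n x @[n --> \oo] --> 0%E.
    apply: limn_esup_le_cvg => [|n]; last by rewrite lee_fin.
    by rewrite le_eqVlt; apply/orP; left; apply/eqP.
  have /fine_cvgP[_ /= c1] := c0.
  by apply/subr_cvg0; apply: norm_cvg0.
rewrite -[X in measurable X]setCK setC_bigcap; apply: measurableC.
apply: countable_bigcupT_measurable => [|u]; first exact: countableP.
apply: measurableC; apply: measurableI.
  rewrite -[X in measurable X]setTI; apply: emeasurable_fin_num => //.
  exact: measurable_limit_subtree.
rewrite -[X in measurable X]setTI; apply: measurable_fun_limn_esup => //.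
Qed.
End measurable_good_env.

Lemma ae_eq_of_integral_le d (T : measurableType d) (R : realType)
    (P : {measure set T -> \bar R}) (f g : T -> \bar R) :
  measurable_fun setT f -> measurable_fun setT g -> (forall x, 0 <= g x)%E ->
  (forall x, g x <= f x)%E -> (\int[P]_x f x <= \int[P]_x g x)%E ->
  (\int[P]_x g x < +oo)%E -> {ae P, forall x, f x = g x}.
Proof.
move=> mf mg g0 gf ifg ig.
have f0 x : (0 <= f x)%E by exact: le_trans (gf x).
have inf : P.-integrable setT f.
  by apply/integrableP; split => //; under eq_integral do rewrite gee0_abs//; exact: le_lt_trans ig.
have ing : P.-integrable setT g.
  by apply/integrableP; split => //; under eq_integral do rewrite gee0_abs//.
have /(ae_eq_integral_abs P measurableT (emeasurable_funB mf mg)) K : (\int[P]_x `|f x - g x| = 0)%E.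
  transitivity (\int[P]_x (f x - g x))%E.
    apply: ae_eq_integral => //.
    - by apply: measurableT_comp => //; exact: emeasurable_funB.
    - exact: emeasurable_funB.
    have := integrable_ae measurableT inf; apply: filterS => x /(_ I) ffin _.
    by rewrite gee0_abs// sube_ge0 ?ffin ?orbT.
  have fgE : (\int[P]_x f x = \int[P]_x g x)%E.
    by apply: le_anti; rewrite ifg; apply: ge0_le_integral.
  rewrite integralB// fgE subee// ge0_fin_numE//.
  exact: integral_ge0.
have := integrable_ae measurableT inf; have := integrable_ae measurableT ing; move: K.
apply: filterS3 => x /(_ I) fg0 /(_ I) gfin /(_ I) ffin.
move: ffin gfin fg0 => /fineK <- /fineK <-; rewrite -EFinB => -[] /eqP.
by rewrite subr_eq0 => /eqP ->.
Qed.

(** * Mixtures of regular ergodic measures *)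

Section regular_part.
Context {b : nat} {R : realType} d0 (T0 : measurableType d0) (P0 : probability T0 R).
Variable X0 : {RV P0 >-> R}.
Hypothesis X0_ge0 : forall w, 0 <= X0 w.
Hypothesis X0_mean : ('E_P0[X0] = 1)%E.
Context d (T : measurableType d) (P : probability T R) (X : seq (letter b) -> T -> R).
Hypothesis famX : cascade_family X0 P X.
Local Notation om w := (X^~ w).
Local Notation E := (ergodic_measure b R).
Local Notation fmeasure := {finite_measure set (seq_space b) -> \bar R}.
Variable rho : probability E R.

Let om0 w v : 0 <= X v w. Proof. exact: (family_ge0 famX). Qed.
Let lim a w u := limit_mass (subtree a u) (subtree (om w) u).
Let lim_ge0 a w u : is_mass a -> (0 <= lim a w u)%E.
Proof. by move=> am; apply: limit_mass_ge0 => [|v]; [exact: is_mass_subtree|exact: om0]. Qed.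
Let W0 w u : 0 <= weight (om w) u. Proof. exact: weight_ge0. Qed.
Let mX u : measurable_fun setT (X u). Proof. exact: (family_meas famX). Qed.
Let mW u : measurable_fun setT (fun w => weight (om w) u).
Proof. exact: (measurable_env_path famX (@measurable_weight_below b R u)). Qed.

Let ma2 u : measurable_fun setT (fun p : T * E => mass_of p.2 u).
Proof.
by apply: (@measurableT_comp _ _ _ _ _ _ (fun nu : E => mass_of nu u)) => //; exact: measurable_mass_of.
Qed.

Let mom2 u : measurable_fun setT (fun p : T * E => X u p.1).
Proof. by apply: (@measurableT_comp _ _ _ _ _ _ (X u)). Qed.

(** Each nu has its own null set; Tonelli's theorem on the jointly measurable set of bad pairs
    exchanges the order of the quantifiers. *)
Lemma good_env_ae_ergodic :
  {ae P, forall w, {ae rho, forall nu : E, good_env (mass_of nu) (om w)}}.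
Proof.
have mB : measurable (~` [set p : T * E | good_env (mass_of p.2) (om p.1)]).
  by apply: measurableC; apply: measurable_good_env.
set B := ~` _ in mB.
have m1B : measurable_fun setT (fun p : T * E => (\1_B p)%:E : \bar R).
  by apply/measurable_EFinP; exact: measurable_indic.
have B0 (p : T * E) : (0 <= (\1_B p)%:E :> \bar R)%E by rewrite lee_fin.
have I0 : (\int[P]_w \int[rho]_nu (\1_B (w, nu))%:E = 0)%E.
  rewrite (fubini_tonelli (m1 := P) (m2 := rho) _ m1B B0).
  rewrite (eq_integral (fun=> 0%E)) ?integral0// => nu _.
  rewrite -[RHS](integral0 P setT); apply: ae_eq_integral => //.
    exact: (measurable_fun_pair1 nu m1B).
  have := good_env_ae X0_ge0 X0_mean famX (is_mass_of (nu : fmeasure)).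
  by apply: filterS => w gw _; rewrite indicE memNset//; apply.
have mI : measurable_fun setT (fun w => \int[rho]_nu (\1_B (w, nu))%:E)%E.
  exact: (@measurable_fun_fubini_tonelli_F _ _ _ _ _ rho _ m1B B0).
have J0 w : (0 <= \int[rho]_nu (\1_B (w, nu))%:E)%E.
  by apply: integral_ge0 => nu _.
have : (\int[P]_w `|\int[rho]_nu (\1_B (w, nu))%:E| = 0)%E.
  by rewrite -I0; apply: eq_integral => w _; rewrite gee0_abs.
move=> /(ae_eq_integral_abs P measurableT mI); apply: filterS => w /(_ I) Iw0.
have mw : measurable_fun setT (fun nu : E => (\1_B (w, nu))%:E : \bar R).
  by apply: (@measurableT_comp _ _ _ _ _ _ (fun p : T * E => (\1_B p)%:E) setT (pair w)) => //; exact: pair1_measurable.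
have : (\int[rho]_nu `|(\1_B (w, nu))%:E| = 0)%E.
  by rewrite -[RHS]Iw0; apply: eq_integral => nu _; rewrite gee0_abs.
move=> /(ae_eq_integral_abs rho measurableT mw); apply: filterS => nu /(_ I) /eqP; rewrite /= indicE eqe pnatr_eq0 eqb0.
by move=> nB; apply: contrapT => ng; move/negP: nB; apply; rewrite inE.
Qed.

Variable S : set E.
Hypothesis mS : measurable S.
Hypothesis regS : forall nu, S nu -> forall u, ell P X (mass_of nu) u = mass_of nu u.
Variable mu : fmeasure.
Hypothesis muE : is_measure_integral rho S (fun nu => nu) mu.

Let c := mass_of mu.
Let cm : is_mass c. Proof. exact: is_mass_of. Qed.
Let cE u : ((c u)%:E = \int[rho]_(nu in S) (mass_of nu u)%:E)%E.
Proof. exact: measure_integral_cylinder. Qed.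
Let cE1 u : ((c u)%:E = \int[rho]_nu (\1_S nu * mass_of nu u)%:E)%E.
Proof. by rewrite cE integral_setE. Qed.

Let J u (p : T * E) : \bar R := (lim (mass_of p.2) p.1 u * (\1_S p.2)%:E)%E.
Let J0 u p : (0 <= J u p)%E.
Proof. by rewrite mule_ge0// ?lim_ge0//; exact: is_mass_of. Qed.
Let mJ u : measurable_fun setT (J u).
Proof.
apply: emeasurable_funM; first exact: measurable_limit_subtree.
apply/measurable_EFinP; apply: (@measurableT_comp _ _ _ _ _ _ (\1_S : E -> R)) => //.
Qed.
Let mJ2 u w : measurable_fun setT (fun nu => J u (w, nu)).
Proof. by apply: (@measurableT_comp _ _ _ _ _ _ (J u) setT (pair w)) => //; exact: pair1_measurable. Qed.

Let WJ u (p : T * E) : \bar R := ((weight (om p.1) u)%:E * J u p)%E.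
Let WJ0 u p : (0 <= WJ u p)%E. Proof. by rewrite mule_ge0// lee_fin. Qed.
Let mWJ u : measurable_fun setT (WJ u).
Proof.
apply: emeasurable_funM => //; apply/measurable_EFinP.
by apply: (@measurableT_comp _ _ _ _ _ _ (fun w => weight (om w) u)).
Qed.

Let mean_weight_limit a u : is_mass a ->
  (\int[P]_w ((weight (om w) u)%:E * lim a w u) = (ell P X a u)%:E)%E.
Proof.
move=> am; have aum := is_mass_subtree u am.
rewrite (integral_mul_subtree famX (D := below (size u)) (F := fun x => (weight x u)%:E)
  (G := limit_mass (subtree a u)))//.
- by rewrite (integral_weight X0_ge0 X0_mean famX) mul1e -(ellE X0_ge0 X0_mean famX).
- exact: below_nonroot.
- by move=> v v0 [_]; rewrite size_cat -[leqRHS]addn0 leq_add2l leqn0 size_eq0 (negbTE v0).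
- apply/measurable_EFinP; exact: (@measurable_weight_below b R u).
- exact: measurable_limit_mass.
- by move=> w; rewrite lee_fin.
- by move=> x x0; apply: limit_mass_ge0.
Qed.

(** In good environments this is the mass of Q.mu on the cylinder of [u]; the next function, [B], is
    the corresponding integral of the masses of Q.nu. *)
Let A u w := ((weight (om w) u)%:E * lim c w u)%E.
Let B u w := (\int[rho]_nu WJ u (w, nu))%E.

Let mA u : measurable_fun setT (A u).
Proof.
apply: emeasurable_funM; first exact/measurable_EFinP.
by apply: (@measurable_limit_subtree _ _ _ _ (fun=> c) (fun w => om w)).
Qed.

(** Fatou's lemma in nu for a fixed environment: at each finite generation the cascade mass is
    linear in the measure, so the integrals over nu are the masses of [mu]. *)
Let B_le_A u w : (B u w <= A u w)%E.
Proof.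
rewrite /B /A; have -> : (\int[rho]_nu WJ u (w, nu) =
    (weight (om w) u)%:E * \int[rho]_nu J u (w, nu))%E.
  by rewrite -ge0_integralZl ?lee_fin//.
apply: lee_pmul => //; [by rewrite lee_fin|exact: integral_ge0|].
pose f n (nu : E) : R := cascade_mass (subtree (mass_of nu) u) (subtree (om w) u) n * \1_S nu.
have mf n : measurable_fun setT (f n).
  apply: measurable_funM; last exact: measurable_indic.
  by apply: (@measurable_mass_subtree _ _ _ _ (fun nu : E => mass_of nu) (fun=> om w)) => //; exact: measurable_mass_of.
have Y0 n (nu : E) : 0 <= cascade_mass (subtree (mass_of nu) u) (subtree (om w) u) n.
  by apply: cascade_mass_ge0 => [|v]; [exact/is_mass_subtree/is_mass_of|exact: om0].
have f0 n nu : 0 <= f n nu by rewrite mulr_ge0.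
apply: (@le_trans _ _ (\int[rho]_nu limn_einf (fun n => (f n nu)%:E))%E).
  rewrite le_eqVlt; apply/orP; left; apply/eqP; apply: eq_integral => nu _.
  rewrite /J /f /= indicE; case: (nu \in S).
    by rewrite mule1; congr limn_einf; apply/funext => n; rewrite mulr1.
  rewrite mule0; apply/esym/cvg_limn_einf.
  by under eq_fun do rewrite mulr0; exact: cvg_cst.
apply: le_trans (fatou _ _ _ _) _ => //.
- by move=> n; exact/measurable_EFinP.
- by move=> n nu _; rewrite lee_fin.
rewrite le_eqVlt; apply/orP; left; apply/eqP; congr limn_einf; apply/funext => n.
pose g (v : n.-tuple (letter b)) (nu : E) := weight (subtree (om w) u) v * (\1_S nu * mass_of nu (u ++ v)).
have g0' v (nu : E) : 0 <= \1_S nu * mass_of nu v.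
  by rewrite mulr_ge0 ?fine_ge0 ?measure_ge0.
have mg' v : measurable_fun setT (fun nu : E => \1_S nu * mass_of nu v).
  by apply: measurable_funM; [exact: measurable_indic|exact: measurable_mass_of].
have W0' v : 0 <= weight (subtree (om w) u) v.
  by apply: weight_ge0 => v'; exact: om0.
transitivity (\int[rho]_nu (\sum_(v : n.-tuple (letter b)) g v nu)%:E)%E.
  apply: eq_integral => nu _; congr EFin; rewrite /f /cascade_mass mulr_suml.
  by apply: eq_bigr => v _; rewrite /g /subtree; ring.
rewrite ge0_integral_sumr; last 2 first.
- by move=> v; exact: measurable_funM.
- by move=> v nu; rewrite mulr_ge0.
rewrite /cascade_mass -sumEFin; apply: eq_bigr => v _.
by rewrite ge0_integralZr_EFin// -cE1 -EFinM mulrC.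
Qed.

Let integral_B u : (\int[P]_w B u w = (c u)%:E)%E.
Proof.
rewrite /B (fubini_tonelli (m1 := P) (m2 := rho) _ (mWJ u) (@WJ0 u)) cE1.
apply: eq_integral => nu _; rewrite /WJ /J /= indicE.
have [nuS|nuS] := boolP (nu \in S).
  under eq_integral do rewrite mule1.
  rewrite mean_weight_limit; last exact: is_mass_of.
  by rewrite mul1r regS//; rewrite inE in nuS.
by under eq_integral do rewrite !mule0; rewrite integral0 mul0r.
Qed.

Let mB u : measurable_fun setT (B u).
Proof. exact: (@measurable_fun_fubini_tonelli_F _ _ _ _ _ rho _ (@mWJ u) (@WJ0 u)). Qed.

Let A_le u : (\int[P]_w A u w <= (c u)%:E)%E.
Proof. by rewrite mean_weight_limit// lee_fin (ell_le X0_ge0 X0_mean famX). Qed.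

(** [B <= A], while the mean of [A] is at most c(u), which by regularity of the components is the
    mean of [B]. *)
Let limit_integral_ae : {ae P, forall w, forall u, A u w = B u w}.
Proof.
apply: ae_forall_count => u; apply: ae_eq_of_integral_le => //.
- by move=> w; apply: integral_ge0.
- by rewrite integral_B.
- by rewrite integral_B ltry.
Qed.

Let integral_A u : (\int[P]_w A u w = (c u)%:E)%E.
Proof.
apply: le_anti; rewrite A_le -integral_B; apply: ge0_le_integral => //.
by move=> w _; apply: integral_ge0.
Qed.
Lemma regular_of_ergodic : Q_regular P X mu.
Proof.
(* The null measure is the default value in bad environments. *)
have ex w : exists M : fmeasure, forall u, mass_of M u =
    if `[< good_env c (om w) >] then limit_of c (om w) u else 0.
  case: asboolP => gw; last by exists mzero => u; rewrite /mass_of.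
  have [M ME] := mass_extension (is_mass_limit_of cm (om0 w) gw).
  by exists M => u; rewrite /mass_of ME.
have [Q QE] := choice ex.
have gae := good_env_ae X0_ge0 X0_mean famX cm.
exists Q.
  rewrite /is_cascade; apply: filterS gae => w gw; apply: is_cascade_limit_of => // u.
  by rewrite QE; case: asboolP.
have mg : measurable [set w | good_env c (om w)].
  by apply: (@measurable_good_env _ _ _ _ (fun=> c) (fun w => om w)).
rewrite -cylinder_nil mass_ofE -/c -integral_A.
apply: ae_eq_integral => //.
- have -> : (fun w => Q w (cylinder [::])) =
      (fun w => (\1_[set w | good_env c (om w)] w * limit_of c (om w) [::])%:E).
    apply/funext => w; rewrite mass_ofE QE indicE; case: asboolP => gw.
      by rewrite mem_set// mul1r.
    by rewrite memNset// mul0r.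
  apply/measurable_EFinP; apply: measurable_funM; first exact: measurable_indic.
  apply: measurable_funM => //; apply: measurableT_comp => //.
  by apply: (@measurable_limit_subtree _ _ _ _ (fun=> c) (fun w => om w)).
apply: filterS gae => w gw _; rewrite mass_ofE QE; case: asboolP => // _.
by rewrite /A /limit_of EFinM fineK//; have [] := gw [::].
Qed.

Lemma cascade_integral_ae : {ae P, forall w, exists Qmu Qnu,
  [/\ is_cascade_limit X mu w Qmu,
      {ae rho, forall nu : E, is_cascade_limit X nu w (Qnu nu)} &
      is_measure_integral rho S Qnu Qmu]}.
Proof.
have gae := good_env_ae X0_ge0 X0_mean famX cm.
move: limit_integral_ae good_env_ae_ergodic gae; apply: filterS3 => w AB gnu gw.
have [Qmu QmuE] := mass_extension (is_mass_limit_of cm (om0 w) gw).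
have ex (nu : E) : exists M : fmeasure, forall u, mass_of M u =
    if `[< good_env (mass_of nu) (om w) >] then limit_of (mass_of nu) (om w) u else 0.
  case: asboolP => gv; last by exists mzero => u; rewrite /mass_of.
  have [M ME] := mass_extension (is_mass_limit_of (is_mass_of (nu : fmeasure)) (om0 w) gv).
  by exists M => u; rewrite /mass_of ME.
have [Qnu QnuE] := choice ex.
exists Qmu, Qnu; split.
- by apply: is_cascade_limit_of => // u; rewrite /mass_of QmuE.
- apply: filterS gnu => nu gv; apply: is_cascade_limit_of => // u.
  by rewrite QnuE; case: asboolP.
have mg : measurable [set nu : E | good_env (mass_of nu) (om w)].
  apply: (@measurable_good_env _ _ _ _ (fun nu : E => mass_of nu) (fun=> om w)) => //.
  exact: measurable_mass_of.
have mN u : measurable_fun setT (fun nu => mass_of (Qnu nu) u).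
  have -> : (fun nu => mass_of (Qnu nu) u) = (fun nu : E =>
      \1_[set nu : E | good_env (mass_of nu) (om w)] nu * limit_of (mass_of nu) (om w) u).
    apply/funext => nu; rewrite QnuE indicE; case: asboolP => gv.
      by rewrite mem_set// mul1r.
    by rewrite memNset// mul0r.
  apply: measurable_funM; first exact: measurable_indic.
  apply: measurable_funM => //; apply: measurableT_comp => //.
  apply: (@measurable_limit_subtree _ _ _ _ (fun nu : E => mass_of nu) (fun=> om w)) => //.
  exact: measurable_mass_of.
apply: is_measure_integralP => // u.
transitivity (A u w).
  by rewrite -mass_ofE QmuE /A /limit_of EFinM fineK//; have [] := gw u.
rewrite AB integral_setE; apply: ae_eq_integral => //.
- by apply: (@measurableT_comp _ _ _ _ _ _ (WJ u) setT (pair w)) => //; exact: pair1_measurable.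
- by apply/measurable_EFinP; apply: measurable_funM => //; exact: measurable_indic.
apply: filterS gnu => nu gv _; rewrite QnuE; case: asboolP => // _.
rewrite /WJ /J /= muleA [RHS]EFinM muleC; congr (_ * _)%E.
by rewrite /limit_of EFinM fineK//; have [] := gv u.
Qed.

End regular_part.

(** * Mixtures of low entropy *)

Section singular_part.
Context {b : nat} {R : realType} d0 (T0 : measurableType d0) (P0 : probability T0 R).
Variable X0 : {RV P0 >-> R}.
Hypothesis X0_ge0 : forall w, 0 <= X0 w.
Hypothesis X0_mean : ('E_P0[X0] = 1)%E.
Context d (T : measurableType d) (P : probability T R) (X : seq (letter b) -> T -> R).
Hypothesis famX : cascade_family X0 P X.
Local Notation om w := (X^~ w).
Local Notation E := (ergodic_measure b R).
Local Notation fmeasure := {finite_measure set (seq_space b) -> \bar R}.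
Variable rho : probability E R.
Local Notation h_X := ('E_P0[(fun w => X0 w * ln (X0 w))%R])%E.
Let S : set E := [set nu | ((entropy nu)%:E < h_X)%E].
Variable mu : fmeasure.
Hypothesis muE : is_measure_integral rho S (fun nu => nu) mu.

Let mS : measurable S. Proof. exact: measurable_entropy_lt. Qed.
Let c := mass_of mu.
Let cm : is_mass c. Proof. exact: is_mass_of. Qed.
Let om0 w v : 0 <= X v w. Proof. exact: (family_ge0 famX). Qed.

Let m u (nu : E) := \1_S nu * mass_of nu u.
Let m0 u nu : 0 <= m u nu. Proof. by rewrite mulr_ge0 ?fine_ge0 ?measure_ge0. Qed.
Let mm u : measurable_fun setT (m u).
Proof. by apply: measurable_funM; [exact: measurable_indic|exact: measurable_mass_of]. Qed.
Let im u : rho.-integrable setT (EFin \o m u).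
Proof.
apply: (@intg_bounded _ _ _ _ _ 1) => // nu; rewrite ger0_norm// /m.
by rewrite -[leRHS]mulr1 ler_pM ?fine_ge0 ?measure_ge0 ?mass_le1// indicE lern1 leq_b1.
Qed.
Let cE u : c u = \int[rho]_nu m u nu.
Proof.
by apply: EFin_inj; rewrite (measure_integral_cylinder u muE) integral_setE Rint_EFin//; exact: im.
Qed.

Let low q : set E := [set nu | ((entropy nu)%:E < q%:E)%E].
Let mlow q : measurable (low q). Proof. exact: measurable_entropy_lt. Qed.
Let rest q : set E := S `\` low q.
Let mrest q : measurable (rest q). Proof. exact: measurableD. Qed.

(** The words of [short_words q] asymptotically carry every component of entropy below [q]; the
    components between [q] and h_X are charged with their full weight. *)
Let truncated_le q : (q%:E < h_X)%E ->
  \int[P]_w Num.min (fine (limit_mass c (om w))) 1 <= \int[rho]_nu \1_(rest q) nu.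
Proof.
move=> qh.
pose phi n (nu : E) := \sum_(u : n.-tuple (letter b) | ~~ short_words q n u) mass_of nu u.
have phi0 n nu : 0 <= phi n nu by apply: sumr_ge0 => u _; rewrite fine_ge0 ?measure_ge0.
have phi1 n nu : phi n nu <= 1.
  rewrite -(mass_of_nil_prob nu) (mass_sum0 n (is_mass_of _)) /phi big_mkcond.
  by apply: ler_sum => u _; case: ifP; rewrite ?fine_ge0 ?measure_ge0.
have mphi n : measurable_fun setT (phi n).
  rewrite /phi; under eq_fun do rewrite big_mkcond; apply: measurable_sum => u.
  by case: (~~ _); [exact: measurable_mass_of|exact: measurable_cst].
pose psi n (nu : E) := \1_(low q) nu * phi n nu.
have mpsi n : measurable_fun setT (psi n).
  by apply: measurable_funM => //; exact: measurable_indic.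
have psi01 n nu : 0 <= psi n nu <= 1.
  by rewrite /psi indicE; case: (nu \in low q); rewrite ?mul1r ?mul0r ?phi0 ?phi1// lexx ler01.
have ipsi n : rho.-integrable setT (EFin \o psi n).
  apply: (@intg_bounded _ _ _ _ _ 1) => // nu.
  by have /andP[? ?] := psi01 n nu; rewrite ger0_norm.
have irest : rho.-integrable setT (EFin \o (fun nu => \1_(rest q) nu : R)).
  apply: (@intg_bounded _ _ _ _ _ 1) => [|nu]; first exact: measurable_indic.
  by rewrite indicE ger0_norm// lern1 leq_b1.
have cpsi : \int[rho]_nu psi n nu @[n --> \oo] --> (0 : R).
  rewrite -[X in _ --> X](Rint_prob_cst rho 0).
  apply: (@Rint_DCT _ _ _ rho _ _ (fun=> 1)) => //; [exact: intg_cst| |].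
    by move=> n nu; have /andP[? ?] := psi01 n nu; rewrite ger0_norm.
  apply: nearW => nu; rewrite /psi indicE; have [nl|nl] := boolP (nu \in low q).
    under eq_fun do rewrite mul1r.
    by apply: short_words_cvg; rewrite inE /low /= lte_fin in nl.
  by under eq_fun do rewrite mul0r; exact: cvg_cst.
apply: (min_limit_mass_le X0_ge0 X0_mean famX cm qh
  (r := fun n => \int[rho]_nu psi n nu + \int[rho]_nu \1_(rest q) nu)); last first.
  rewrite -[X in _ --> X]add0r; apply: cvgD => //; exact: cvg_cst.
move=> n; under eq_bigr do rewrite cE.
rewrite -Rint_sum// -RintegralD//; apply: Rint_le.
- by apply: intg_sum => u _; exact: im.
- exact: intgD.
move=> nu; rewrite /m -mulr_sumr -/(phi n nu) /psi !indicE.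
have [nS|nS] := boolP (nu \in S); last by rewrite mul0r addr_ge0 ?mulr_ge0.
have [nl|nl] := boolP (nu \in low q); first by rewrite mul1r lerDl.
rewrite mul1r mul0r add0r mem_set//; split; first by rewrite inE in nS.
by move=> el; move/negP: nl; apply; rewrite inE.
Qed.

Lemma singular_of_ergodic : Q_singular P X mu.
Proof.
pose Lr w := fine (limit_mass c (om w)).
have L0 w : 0 <= Lr w by apply: fine_ge0; exact: (limit_path_ge0 famX).
have mL : measurable_fun setT Lr.
  by apply: measurableT_comp => //; exact: (measurable_limit_path famX).
have hXN : h_X != -oo%E.
  have := integral_add_mul_ln X0_ge0 (lexx 1); case: h_X => // /esym H.
  have : (0 <= \int[P0]_w (1 + X0 w * ln (X0 w))%:E)%E.
    by apply: integral_ge0 => w _; rewrite lee_fin; have := mul_ln_ge (X0_ge0 w); have := X0_ge0 w; lra.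
  by rewrite -H.
(* Levels that approach h_X from below: h - 1/(k+1) if it is finite, the integers k if it is +oo. *)
have [q [qh qS]] : exists q : nat -> R, (forall k, (q k)%:E < h_X)%E /\
    forall x : R, (x%:E < h_X)%E -> \forall k \near \oo, x < q k.
  move: hXN; case: h_X => // [h _|_].
    exists (fun k => h - k.+1%:R^-1); split => [k|x xh]; first by rewrite lte_fin ltrBlDr ltrDl.
    have := @cvg_harmonic R => /cvgrPdist_lt /(_ (h - x)); rewrite subr_gt0 => /(_ xh).
    by apply: filterS => k; rewrite sub0r normrN ger0_norm ?invr_ge0// ltrBrDl -ltrBrDr.
  exists (fun k => k%:R); split => [k|x _]; first by rewrite ltry.
  exists (Num.truncn x).+1 => // k /= xk; apply: lt_le_trans (truncnS_gt x) _.
  by rewrite ler_nat.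
(* Each component of [S] has entropy strictly below h_X, so it leaves [rest (q k)] for large k. *)
have rest0 : \int[rho]_nu \1_(rest (q k)) nu @[k --> \oo] --> (0 : R).
  rewrite -[X in _ --> X](Rint_prob_cst rho 0).
  apply: (@Rint_DCT _ _ _ rho _ _ (fun=> 1)) => //; [by move=> k; exact: measurable_indic|exact: intg_cst| |].
    by move=> k nu; rewrite indicE ger0_norm// lern1 leq_b1.
  apply: nearW => nu; have [nS|nS] := pselect (S nu); last first.
    under eq_fun do rewrite indicE memNset => [|[]//]; exact: cvg_cst.
  apply: cvg_near_cst; have := qS _ nS; apply: filterS => k lt.
  by rewrite indicE memNset// => -[_]; apply; rewrite /low /= lte_fin.
have I0 : \int[P]_w Num.min (Lr w) 1 = 0.
  apply: le_anti; apply/andP; split; last first.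
    by apply: Rintegral_ge0 => w _; rewrite le_min L0 ler01.
  by apply: (ler_cvg_to_const rest0) => k; exact: truncated_le.
have mmin : measurable_fun setT (fun w => Num.min (Lr w) 1) by exact: measurable_minr.
have min0 w : 0 <= Num.min (Lr w) 1 by rewrite le_min L0 ler01.
have : (\int[P]_w `|(Num.min (Lr w) 1)%:E| = 0)%E.
  under eq_integral do rewrite gee0_abs ?lee_fin//.
  rewrite Rint_EFin ?I0//; apply: (@intg_bounded _ _ _ _ _ 1) => // w.
  by rewrite ger0_norm// ge_min lexx orbT.
have mmin' : measurable_fun setT (fun w => (Num.min (Lr w) 1)%:E) by exact/measurable_EFinP.
move=> /(ae_eq_integral_abs P measurableT mmin').
have := good_env_ae X0_ge0 X0_mean famX cm; rewrite /Q_singular /is_cascade.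
apply: filterS2 => w gw /(_ I) [Lw0].
apply: is_cascade_limit_of => // u; rewrite [LHS]/mass_of /=.
have lm := is_mass_limit_of cm (om0 w) gw.
apply/esym/le_anti; case: (lm) => -> _; rewrite andbT.
apply: le_trans (mass_le0 u lm) _; rewrite limit_of_nil -/(Lr w).
rewrite leNgt; apply/negP => Lpos; have mpos : 0 < Num.min (Lr w) 1 by rewrite lt_min Lpos ltr01.
exact: (elimF eqP (gt_eqF mpos) Lw0).
Qed.

End singular_part.

(** * The corollary *)

Section nonnegative_version.
Context {b : nat} {R : realType} d0 (T0 : measurableType d0) (P0 : probability T0 R).
Variable X0 : {RV P0 >-> R}.
Hypothesis X0_ge0 : forall w, 0 <= X0 w.
Context d (T : measurableType d) (P : probability T R).
Variable X : seq (letter b) -> {RV P >-> R}.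
Hypothesis X_law : forall u : seq (letter b), u != [::] -> forall A, measurable A ->
  distribution P (X u) A = distribution P0 X0 A.
Hypothesis X_indep : mutually_independent P [set u | u != [::]] X.
Local Notation fmeasure := {finite_measure set (seq_space b) -> \bar R}.

(* The variables [X u] are nonnegative only almost surely. *)
Definition nonneg_part (u : seq (letter b)) (w : T) : R := Num.max (X u w) 0.

Let pos (x : R) := Num.max x 0.
Let mpos : measurable_fun setT pos. Proof. exact: measurable_maxr. Qed.
Let mpos_pre (A : set R) : measurable A -> measurable (pos @^-1` A).
Proof. by move=> mA; rewrite -[X in measurable X]setTI; exact: mpos. Qed.

(** Law and independence of the [X u] are used on preimages under [pos], which fixes the values of
    [X0]. *)
Lemma cascade_family_nonneg_part : cascade_family X0 P nonneg_part.
Proof.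
split.
- by move=> u; apply: measurable_maxr => //; exact: measurable_funP.
- by move=> u w; rewrite le_max lexx orbT.
- move=> s A us sD mA.
  exact: (X_indep (A := fun i => pos @^-1` A i) us sD (fun i => mpos_pre (mA i))).
- move=> u A u0 mA; rewrite [LHS](X_law u0 (mpos_pre mA)).
  congr (P0 _); apply/seteqP; split => w; rewrite /preimage /= /pos max_l//.
Qed.

Lemma nonneg_part_ae : {ae P, forall w, forall u, u != [::] -> nonneg_part u w = X u w}.
Proof.
apply: ae_forall_count => u; have [->|u0] := eqVneq u [::]; first exact: aeW.
have mN : measurable [set x : R | x < 0].
  suff -> : [set x : R | x < 0] = [set` `]-oo, 0[] by exact: measurable_itv.
  by apply/seteqP; split => x /=; rewrite in_itv.
exists (X u @^-1` [set x | x < 0]); split.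
- have mXu : measurable_fun setT (X u) by exact: measurable_funP.
  by rewrite -[X in measurable X]setTI; exact: mXu.
- rewrite [LHS](X_law u0 mN) /distribution /pushforward.
  rewrite (_ : X0 @^-1` _ = set0) ?measure0//.
  by apply/seteqP; split => w //=; rewrite ltNge X0_ge0.
- move=> w /= H; rewrite ltNge; apply/negP => Xge0; apply: H => _.
  by rewrite /nonneg_part max_l.
Qed.

Lemma is_cascade_limit_nonneg_part (mu : fmeasure) w M :
  (forall u, u != [::] -> nonneg_part u w = X u w) ->
  is_cascade_limit nonneg_part mu w M -> is_cascade_limit X mu w M.
Proof.
move=> eqX lim f cf.
have -> : (fun n => \int[mu]_x (f x * cascade_density X n w x)%:E)%E =
    (fun n => \int[mu]_x (f x * cascade_density nonneg_part n w x)%:E)%E; last exact: lim.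
apply/funext => n; apply: eq_integral => x _; congr (_ * _)%:E; apply: eq_big_nat => k /andP[k0 _].
by apply/esym/eqX; rewrite -size_eq0 size_restr -lt0n.
Qed.

Lemma is_cascade_nonneg_part (mu : fmeasure) Q :
  is_cascade P nonneg_part mu Q -> is_cascade P X mu Q.
Proof.
move: nonneg_part_ae; apply: filterS2 => w; exact: is_cascade_limit_nonneg_part.
Qed.

End nonnegative_version.

Lemma ell_of_large_entropy (b : nat) (R : realType) d0 (T0 : measurableType d0)
    (P0 : probability T0 R) (X0 : {RV P0 >-> R}) d (T : measurableType d) (P : probability T R)
    (X : seq (letter b) -> T -> R) (nu : ergodic_measure b R) :
  (forall w, 0 <= X0 w) -> ('E_P0[X0] = 1)%E -> cascade_family X0 P X ->
  ('E_P0[(fun w => X0 w * ln (X0 w))%R] < (entropy nu)%:E)%E ->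
  forall u, ell P X (mass_of nu) u = mass_of nu u.
Proof.
move=> X0_ge0 X0_mean famX hnu.
have [L0|//] := zero_one_law X0_ge0 X0_mean famX nu.
have I := integral_add_mul_ln X0_ge0 (lexx 1).
have I0 : (0 <= \int[P0]_w (1 + X0 w * ln (X0 w))%:E)%E.
  by apply: integral_ge0 => w _; rewrite lee_fin; have := mul_ln_ge (X0_ge0 w); have := X0_ge0 w; lra.
(* The value +oo is excluded because the entropy is a real number, and -oo because [1 + X0 * ln X0]
   is nonnegative. *)
move: I I0 hnu; case: ('E_P0[_])%E => [h| |] //; last by move=> ->.
move=> I _; rewrite lte_fin ltNge => /negP[].
exact: (entropy_le_of_singular X0_ge0 X0_mean famX I L0).
Qed.

Theorem corollary2p12 (R : realType) (b : nat) (hb : (2 <= b)%N)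
  (d0 : measure_display) (T0 : measurableType d0) (P0 : probability T0 R)
  (X0 : {RV P0 >-> R})
  (X0_ge0 : forall w, 0 <= X0 w)
  (X0_mean : ('E_P0[X0] = 1)%E)
  (X0_neq1 : (0 < P0 [set w | (X0 w != 1)%R])%E)
  (d : measure_display) (T : measurableType d) (P : probability T R)
  (X : seq (letter b) -> {RV P >-> R})
  (X_law : forall u : seq (letter b), u != [::] -> forall A, measurable A ->
    distribution P (X u) A = distribution P0 X0 A)
  (X_indep : mutually_independent P [set u | u != [::]] X)
  (rho : probability (ergodic_measure b R) R) :
  let h_X := ('E_P0[(fun w => X0 w * ln (X0 w))%R])%E in
  let E_hi := [set nu : ergodic_measure b R | (h_X < (entropy nu)%:E)%E] in
  let E_lo := [set nu : ergodic_measure b R | ((entropy nu)%:E < h_X)%E] in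
  [/\ exists mu_hi, is_measure_integral rho E_hi (fun nu => nu) mu_hi,
      exists mu_lo, is_measure_integral rho E_lo (fun nu => nu) mu_lo &
  forall mu_hi mu_lo,
    is_measure_integral rho E_hi (fun nu => nu) mu_hi ->
    is_measure_integral rho E_lo (fun nu => nu) mu_lo ->
  [/\ Q_regular P X mu_hi,
      Q_singular P X mu_lo &
      {ae P, forall w, exists Qmu Qnu,
        [/\ is_cascade_limit X mu_hi w Qmu,
            {ae rho, forall nu : ergodic_measure b R,
              is_cascade_limit X nu w (Qnu nu)} &
            is_measure_integral rho E_hi Qnu Qmu]}]].
Proof.
move=> h_X E_hi E_lo.
have mhi : measurable E_hi by exact: measurable_entropy_gt.
have mlo : measurable E_lo by exact: measurable_entropy_lt.
split; [exact: exists_measure_integral|exact: exists_measure_integral|].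
move=> mu_hi mu_lo hi lo.
have famX := cascade_family_nonneg_part X0_ge0 X_law X_indep.
have regX nu : E_hi nu -> forall u, ell P (nonneg_part X) (mass_of nu) u = mass_of nu u.
  exact: ell_of_large_entropy.
split.
- have [Q Qmu EQ] := regular_of_ergodic X0_ge0 X0_mean famX mhi regX hi.
  by exists Q => //; exact: (is_cascade_nonneg_part X0_ge0 X_law).
- apply: (is_cascade_nonneg_part X0_ge0 X_law).
  exact: (singular_of_ergodic X0_ge0 X0_mean famX lo).
have := cascade_integral_ae X0_ge0 X0_mean famX mhi regX hi.
move: (nonneg_part_ae X0_ge0 X_law); apply: filterS2 => w eqX [Qmu [Qnu [c1 c2 c3]]].
exists Qmu, Qnu; split => //; first exact: (is_cascade_limit_nonneg_part eqX).
by apply: filterS c2 => nu; exact: is_cascade_limit_nonneg_part.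
Qed.
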